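(* For every $\alpha > 0$ there exists $\gamma_0 > 0$ such that for every $0 < \gamma \le \gamma_0$ there exists $n_0 \in \mathbb{N}$ such that the following holds for every $n \ge n_0$. Let $H$ be a $3$-graph on $n$ vertices with $\delta_2(H) \ge (7/9+\alpha)n$. Then for all pairs of disjoint ordered triples of vertices $\mathbf{e}_1$ and $\mathbf{e}_2$ that are edges of $H$, there is a squared-tight-path from $\mathbf{e}_1$ to $\mathbf{e}_2$ in $H$ which covers all but at most $\gamma n$ vertices of $H$.
   Context: A $3$-graph $H$ consists of a finite vertex set $V(H)$ and a set $E(H)$ of $3$-element subsets of $V(H)$ (edges). The minimum codegree $\delta_2(H)$ is the largest $m$ such that every pair of distinct vertices of $H$ is contained in at least $m$ edges. $K_4^3$ is the complete $3$-graph on four vertices. An ordered triple $(v_1,v_2,v_3)$ is said to be an edge of $H$ if $\{v_1,v_2,v_3\} \in E(H)$. A squared-tight-path in $H$ is a sequence $(v_1,\dots,v_\ell)$ of distinct vertices in which every set of four consecutive vertices forms a copy of $K_4^3$ in $H$; it is from $\mathbf{u}$ to $\mathbf{v}$ if $\mathbf{u} = (v_1,v_2,v_3)$ and $\mathbf{v} = (v_{\ell-2},v_{\ell-1},v_\ell)$ (as ordered triples). *)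

(* Defs.v *)
From HB Require Import structures.
From mathcomp Require Import all_boot all_order all_algebra.
From mathcomp Require Import reals.

Set Implicit Arguments.
Unset Strict Implicit.
Unset Printing Implicit Defensive.

Record graph3 (V : finType) := Graph3 {
  edges : {set {set V}};
  edges_card3 : forall e, e \in edges -> #|e| = 3 }.

Definition codegree (V : finType) (H : graph3 V) (x y : V) : nat :=
  #|[set e in edges H | [set x; y] \subset e]|.

(* The range of m is bounded only to make the maximum finite: a codegree never
   exceeds #|edges H|, so the bound is harmless as soon as V has two distinct
   vertices (see min_codegreeP). *)
Definition min_codegree (V : finType) (H : graph3 V) : nat :=
  \max_(m < #|edges H|.+1
       | [forall x, forall y, (x != y) ==> (m <= codegree H x y)]) m.

Lemma min_codegreeP (V : finType) (H : graph3 V) (m : nat) :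
  1 < #|V| ->
  reflect (forall x y : V, x != y -> m <= codegree H x y)
          (m <= min_codegree H).
Proof.
move=> V2; apply: (iffP idP) => [le_m x y nxy | le_m].
  apply: leq_trans le_m _; apply/bigmax_leqP => k /forallP/(_ x).
  by move=> /forallP/(_ y)/implyP; apply.
have /card_gt1P[x [y [_ _ nxy]]] : 1 < #|predT : pred V| by [].
have ltm : m < #|edges H|.+1.
  rewrite ltnS; apply: leq_trans (le_m x y nxy) (subset_leq_card _).
  by apply/subsetP => e; rewrite inE => /andP[].
apply: (bigmax_sup (Ordinal ltm)) => //=.
by apply/forallP => a; apply/forallP => b; apply/implyP; apply: le_m.
Qed.

Definition forms_K4 (V : finType) (H : graph3 V) (S : {set V}) : Prop :=
  #|S| = 4 /\ forall T : {set V}, T \subset S -> #|T| = 3 -> T \in edges H.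

Definition edge_triple (V : finType) (H : graph3 V) (u : 3.-tuple V) : Prop :=
  [set x in u] \in edges H.

Definition squared_tight_path (V : finType) (H : graph3 V) (s : seq V) : Prop :=
  uniq s /\
  forall i, i + 4 <= size s -> forms_K4 H [set x in take 4 (drop i s)].

Definition path_from_to (V : finType) (s : seq V) (u v : 3.-tuple V) : Prop :=
  prefix u s /\ suffix v s.

(* Main.v *)
(* A 3-graph whose pairs have more than 7/9 n neighbours is connected in a strong
   sense: if the triples are 2-coloured so that every K4 is monochromatic, then only
   one colour occurs (a double count in the links), and every K4 allows its vertices
   to be permuted by walks through neighbouring K4's. Hence any ordered edge reaches
   any other by a walk (a, b, c) -> (b, c, d) along K4's. Running this inside a
   random sample of bounded size, and blowing up, gives a disjoint path of bounded
   length between any two ordered edges that avoids a prescribed small set.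
   Almost all vertices can be covered by disjoint complete 4-partite 3-graphs of
   constant class size: as long as linearly many vertices are left over, these can
   be combined with some of the tiles to increase the covered part by a fixed
   proportion, at the price of smaller tiles. Finally a complete 4-partite tile is
   traversed almost completely by going round its classes, and consecutive tiles are
   joined by connecting paths. *)

Require Import Defs.
From mathcomp Require Import all_boot all_order all_algebra.
From mathcomp Require Import reals.
From mathcomp Require Import zify ring.
Import Order.TTheory GRing.Theory Num.Theory.

Set Implicit Arguments.
Unset Strict Implicit.
Unset Printing Implicit Defensive.

(** * Connectivity of ordered edges *)

(** 3-graphs are handled as symmetric ternary relations, so that a sampled tuple of vertices carries
    an induced relation on its indices even when it repeats a vertex. The constant 7/9 comes from
    the colouring argument: if every pair has at most mu non-neighbours among n vertices, its
    contradictions come from counts that end in 2 n <= 9 mu. Connectivity alone only yields a walk,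
    which may repeat vertices and whose length depends on the host. A sample of fixed size bounds
    the length, and the classes of a blow-up supply a fresh vertex for each visit. The surplus alpha
    lets most samples inherit the strict inequality. The tiling works with coarser margins: since
    7/9 > 3/4, the neighbours of a pair fill a positive proportion of all four classes of some tile,
    and since 1/3 > 1/4, the vertices completing an edge to a K4 do so for two classes. Losses are
    measured by the smallest class of a tile, so taking u vertices from one class costs as much as
    taking u from all four; the exchanges are arranged to use the classes evenly. *)

Definition is_tgraph (T : finType) (E : T -> T -> T -> bool) :=
  [/\ forall x y z, E x y z = E y x z, forall x y z, E x y z = E x z y
    & forall x z, E x x z = false].

Definition k4 (T : finType) (E : T -> T -> T -> bool) a b c d :=
  [&& E a b c, E a b d, E a c d & E b c d].

Definition nonnbr (T : finType) (E : T -> T -> T -> bool) x y :=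
  [set z | ~~ E x y z].

Lemma disjoint_card3 (T : finType) (A B C : {set T}) :
  [disjoint A & B] -> [disjoint A & C] -> [disjoint B & C] ->
  #|A| + #|B| + #|C| <= #|T|.
Proof.
move=> AB AC BC.
have dABC : [disjoint A :|: B & C].
  by rewrite -setI_eq0 setIUl setU_eq0 !setI_eq0 AC BC.
move: (leq_card_setU A B) (leq_card_setU (A :|: B) C) => [_ +] [_ +].
by rewrite AB dABC => /eqP <- /eqP <-; apply: max_card.
Qed.

Lemma double_count (S T : finType) (X : {set S}) (Y : {set T}) (P : S -> T -> bool) :
  \sum_(x in X) #|[set y in Y | P x y]| = \sum_(y in Y) #|[set x in X | P x y]|.
Proof.
under eq_bigr => x _.
  rewrite -sum1_card; under eq_bigl => y do rewrite inE.
  rewrite big_mkcondr; over.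
rewrite exchange_big /=; apply: eq_bigr => y _.
rewrite -sum1_card [RHS](eq_bigl (fun x => (x \in X) && P x y)) ?big_mkcondr //.
by move=> x; rewrite inE.
Qed.

(** The threshold is tight here. With n = 9 mu / 2 + t and c = n - 3 mu + e, the worst case d = mu
    leaves the difference e (mu / 2 - e) + t (2 mu - e), where 0 <= e <= mu / 2 - t; for t = 0 it
    vanishes at both ends of the range of e. *)
Lemma onesided_arith n mu c b d K U L :
  9 * mu < 2 * n -> c <= 2 * mu -> n <= c + 3 * mu -> n <= b + c + mu ->
  d + c + b = n -> K + n <= c + 4 * mu -> U <= d * K -> c * b <= L + mu * b -> U < L.
Proof.
move=> h1 h2 h3 h4 h5 h6 h7 h8.
have dmu : d <= mu by lia.
have [e eP] : exists e, c = n - 3 * mu + e by exists (c - (n - 3 * mu)); lia.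
have [f fP] : exists f, 2 * mu = c + f by exists (2 * mu - c); lia.
have [g gP] : exists g, mu = d + g by exists (mu - d); lia.
have [k kP] : exists k, 2 * n = 9 * mu + k.+1 by exists (2 * n - 9 * mu).-1; lia.
have h9 : d * K <= d * (c + 4 * mu - n) by rewrite leq_mul2l; apply/orP; right; lia.
have h10 : d * (c + 4 * mu - n) = d * (mu + e) by congr (_ * _); lia.
suff : d * (mu + e) + mu * b < c * b by lia.
have bE : b = n - c - d by lia.
nia.
Qed.

(** * Two-colourings that are constant on every K4 *)

Section Colouring.

Variables (T : finType) (E : T -> T -> T -> bool) (mu : nat).
Hypothesis tE : is_tgraph E.
Hypothesis muP : forall x y, x != y -> #|nonnbr E x y| <= mu.
Hypothesis mu_small : 9 * mu < 2 * #|T|.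

Let E12 x y z : E x y z = E y x z. Proof. by case: tE. Qed.
Let E23 x y z : E x y z = E x z y. Proof. by case: tE. Qed.
Let Exx x z : E x x z = false. Proof. by case: tE. Qed.

Lemma edge_neq x y z : E x y z -> [/\ x != y, x != z & y != z].
Proof.
move=> Exyz; split; apply: contraTneq Exyz => ->; first by rewrite Exx.
  by rewrite E23 Exx.
by rewrite E12 E23 Exx.
Qed.

Definition common_nbr x y z := [set v | k4 E x y z v].

(** A vertex fails to complete an edge to a K4 only if it is a non-neighbour of one of the three
    pairs. *)
Lemma card_common_nbr x y z : E x y z -> #|T| <= #|common_nbr x y z| + 3 * mu.
Proof.
move=> Exyz; have [nxy nxz nyz] := edge_neq Exyz.
have sub : ~: common_nbr x y z \subset
    nonnbr E x y :|: nonnbr E x z :|: nonnbr E y z.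
  apply/subsetP=> v; rewrite !inE /k4 Exyz /=.
  by rewrite !negb_and orbA.
rewrite -(cardsC (common_nbr x y z)) leq_add2l.
apply: leq_trans (subset_leq_card sub) _.
move: (leq_card_setU (nonnbr E x y :|: nonnbr E x z) (nonnbr E y z)).1.
move: (leq_card_setU (nonnbr E x y) (nonnbr E x z)).1.
move: (muP nxy) (muP nxz) (muP nyz); lia.
Qed.

Variable col : T -> T -> T -> bool.
Hypothesis col12 : forall x y z, col x y z = col y x z.
Hypothesis col23 : forall x y z, col x y z = col x z y.
Hypothesis col_k4 : forall a b c d, k4 E a b c d -> col a b c = col a b d.

Lemma k4_mono a b c d : k4 E a b c d ->
  [/\ col a b d = col a b c, col a c d = col a b c & col b c d = col a b c].
Proof.
move=> K; have K1 := col_k4 K.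
have K2 : col a c b = col a c d.
  by apply: col_k4; case/and4P: K => h1 h2 h3 h4; rewrite /k4 E23 h1 h3 h2 /= E12 -E23 E12 E23 E12 E23 E12 h4.
have K3 : col b c a = col b c d.
  by apply: col_k4; case/and4P: K => h1 h2 h3 h4; rewrite /k4 h4 (E23 b c a) (E12 b a c) h1 (E12 b a d) h2 (E12 c a d) h3.
by split; rewrite // -?K2 -?K3 ?(col23 a c b) // (col23 b c a) col12.
Qed.

Section Link.

Variable x : T.

(* In the link of [x], with its edges coloured by [col x]: [lnb c z] is the set of
   neighbours of [z] along colour [c], [bichr] the set of vertices on which both
   colours occur. *)
Definition lnb c z := [set v | E x z v & col x z v == c].
Definition bichr := [set z | (lnb true z != set0) && (lnb false z != set0)].

Lemma bichrP z : reflect (forall c, lnb c z != set0) (z \in bichr).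
Proof.
rewrite inE; apply: (iffP andP) => [[h1 h2] [] //|h]; by split; apply: h.
Qed.

Lemma lnb_sym c z v : (v \in lnb c z) = (z \in lnb c v).
Proof. by rewrite !inE E23 col23. Qed.

Lemma lnb_disj c c' z v : v \in lnb c z -> v \in lnb c' z -> c = c'.
Proof. by rewrite !inE => /andP[_ /eqP <-] /andP[_ /eqP <-]. Qed.

Lemma lnb_edge c z v : v \in lnb c z -> E x z v.
Proof. by rewrite inE => /andP[]. Qed.

Lemma bichr_of c z u v : u \in lnb c z -> v \in lnb (~~ c) z -> z \in bichr.
Proof.
move=> hu hv; apply/bichrP => c'; apply/set0Pn.
by case: (eqVneq c' c) => [->|]; [exists u | case: c c' hu hv => [] [] // *; exists v].
Qed.

Lemma lnb_nonempty z c : z \in bichr -> exists v, v \in lnb c z.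
Proof. by move=> /bichrP/(_ c)/set0Pn. Qed.

Lemma common_lnb c z z' : z' \in lnb c z ->
  common_nbr x z z' \subset lnb c z :&: lnb c z'.
Proof.
move=> h; apply/subsetP => v; rewrite !inE => K.
have [c1 c2 c3] := k4_mono K; case/and4P: K => h1 h2 h3 h4.
by move: h; rewrite inE h2 h3 c1 c2 => /andP[_ ->].
Qed.

Lemma lnb_cap_lb c z z' : z' \in lnb c z ->
  #|T| <= #|lnb c z :&: lnb c z'| + 3 * mu.
Proof.
move=> h; have := card_common_nbr (lnb_edge h).
have := subset_leq_card (common_lnb h); lia.
Qed.

Lemma lnb_lb c z : z \in bichr -> #|T| <= #|lnb c z| + 3 * mu.
Proof.
move=> /(lnb_nonempty c)[v hv].
by apply: leq_trans (lnb_cap_lb hv) _; rewrite leq_add2r subset_leq_card // subsetIl.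
Qed.

(* A K4 on x, z, u, v would be two-coloured. *)
Lemma lnb_nonmono c z u v : u \in lnb c z -> v \in lnb (~~ c) z ->
  E x u v -> v \in nonnbr E z u.
Proof.
move=> hu hv xuv; rewrite inE; apply: contraTN isT => zuv.
have K : k4 E x z u v by rewrite /k4 (lnb_edge hu) (lnb_edge hv) xuv zuv.
have [c1 _ _] := k4_mono K.
by move: hu hv; rewrite !inE c1 => /andP[_ /eqP->] /andP[_]; case: c.
Qed.

Lemma link_neq c z v : v \in lnb c z -> [/\ x != z, x != v & z != v].
Proof. by move=> /lnb_edge/edge_neq. Qed.

(** Fix a neighbour [b] of [z] in the other colour. A vertex of [lnb c z] that is a neighbour of
    both pairs [x b] and [z b] would give a two-coloured K4. *)
Lemma lnb_ub c z : z \in bichr -> #|lnb c z| <= 2 * mu.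
Proof.
move=> hz; have [b hb] := lnb_nonempty (~~ c) hz.
have [n1 n2 n3] := link_neq hb.
have sub : lnb c z \subset nonnbr E x b :|: nonnbr E z b.
  apply/subsetP => v hv; rewrite in_setU.
  case: (boolP (E x b v)) => e; last by rewrite inE e.
  rewrite -[c]negbK in hv; by rewrite (lnb_nonmono hb hv e) orbT.
have := subset_leq_card sub.
have := (leq_card_setU (nonnbr E x b) (nonnbr E z b)).1.
move: (muP n2) (muP n3); lia.
Qed.

Lemma nbr_splitc c z v : E x z v -> (v \in lnb c z) || (v \in lnb (~~ c) z).
Proof. by move=> e; rewrite !inE e /=; case: (col x z v); case: c. Qed.

Lemma lnb_sum c z : x != z -> #|T| <= #|lnb c z| + #|lnb (~~ c) z| + mu.
Proof.
move=> n; have := muP n.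
have sub : ~: nonnbr E x z \subset lnb c z :|: lnb (~~ c) z.
  apply/subsetP => v; rewrite in_setC in_setU inE negbK => e; exact: nbr_splitc e.
have := subset_leq_card sub; have := (leq_card_setU (lnb c z) (lnb (~~ c) z)).1.
have := cardsC (nonnbr E x z); lia.
Qed.

Lemma same_col_nonmono c z z' v : z' \in lnb c z ->
  v \in lnb (~~ c) z -> v \in lnb (~~ c) z' -> v \in nonnbr E z z'.
Proof. by move=> h1 h2 h3; apply: lnb_nonmono h1 h2 (lnb_edge h3). Qed.

Section Pair.
Variables (c : bool) (z z' : T).
Hypotheses (zZ : z \in bichr) (z'Z : z' \in bichr) (hzz' : z' \in lnb c z).

(** Otherwise the common neighbourhood of [x z z'] and the two sets [lnb (~~ c)] would be pairwise
    disjoint, each of size at least n - 3 mu, while 3 (n - 3 mu) > n. *)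
Lemma pair_cap_nonempty : exists b, b \in lnb (~~ c) z :&: lnb (~~ c) z'.
Proof.
apply/set0Pn; rewrite setI_eq0; apply/negP => d.
have dis w : w = z \/ w = z' -> [disjoint common_nbr x z z' & lnb (~~ c) w].
  move=> hw; rewrite -setI_eq0; apply/eqP/setP => v; rewrite !in_setI in_set0.
  apply/negP => /andP[/(subsetP (common_lnb hzz')) /setIP[h1 h2] h3].
  by case: hw h3 => -> h3; [have := lnb_disj h1 h3 | have := lnb_disj h2 h3]; case: c.
have := disjoint_card3 (dis z (or_introl erefl)) (dis z' (or_intror erefl)) d.
have := card_common_nbr (lnb_edge hzz').
have := lnb_lb (~~ c) zZ; have := lnb_lb (~~ c) z'Z; lia.
Qed.

(** A bichromatic [b] has at most 2 mu neighbours in colour [~~ c]. They include the common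
    neighbourhoods of [x z b] and of [x z' b], each of size at least n - 3 mu; these share at most
    mu vertices, all of them non-neighbours of [z z']. Hence 2 (n - 3 mu) <= 3 mu. *)
Lemma pair_cap_pure b : b \in lnb (~~ c) z -> b \in lnb (~~ c) z' -> b \notin bichr.
Proof.
move=> h1 h2; apply/negP => bZ.
have [_ _ nzz'] := link_neq hzz'.
have s1 := common_lnb h1; have s2 := common_lnb h2.
set Q1 := common_nbr x z b in s1; set Q2 := common_nbr x z' b in s2.
have sub : Q1 :&: Q2 \subset nonnbr E z z'.
  apply/subsetP => v /setIP[/(subsetP s1)/setIP[hv _] /(subsetP s2)/setIP[hv' _]].
  exact: same_col_nonmono hzz' hv hv'.
have sub2 : Q1 :|: Q2 \subset lnb (~~ c) b.
  rewrite subUset (subset_trans s1 (subsetIr _ _)).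
  by rewrite (subset_trans s2 (subsetIr _ _)).
have := subset_leq_card sub; have := subset_leq_card sub2; have := muP nzz'.
have := lnb_ub (~~ c) bZ; have := cardsUI Q1 Q2.
have := card_common_nbr (lnb_edge h1); have := card_common_nbr (lnb_edge h2).
rewrite -/Q1 -/Q2; clear sub sub2; move: mu_small.
move: #|Q1 :|: Q2| #|Q1 :&: Q2| #|Q1| #|Q2| #|T| #|nonnbr E z z'| #|lnb (~~ c) b|.
clear; lia.
Qed.

End Pair.

(** The edge [z' v] has colour [~~ c], and [z] is joined to both its ends by colour [c]; so
    [pair_cap_pure] would make [z] monochromatic. *)
Lemma pair_no_mix c z z' v : z \in bichr -> z' \in bichr -> z' \in lnb c z ->
  v \in lnb c z -> v \in lnb (~~ c) z' -> False.
Proof.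
move=> zZ z'Z h h1 h2.
have vZ : v \in bichr by apply: (@bichr_of c v z z'); rewrite lnb_sym.
have hz' : z \in lnb (~~ ~~ c) z' by rewrite negbK lnb_sym.
have hv : z \in lnb (~~ ~~ c) v by rewrite negbK lnb_sym.
by have := pair_cap_pure h2 hz' hv; rewrite zZ.
Qed.

(** If [r] and [b] are both monochromatic in the link, an edge between them makes one of them
    bichromatic. If both are bichromatic, the end whose edges to [z] and to the other end agree in
    colour contradicts [pair_cap_pure]. *)
Lemma no_mixed_edge c z r b : z \in bichr -> r \in lnb c z -> b \in lnb (~~ c) z ->
  (r \in bichr) = (b \in bichr) -> ~~ E x r b.
Proof.
move=> zZ hr hb eqZ; apply/negP => e.
case: (boolP (r \in bichr)) => rZ.
  have bZ : b \in bichr by rewrite -eqZ.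
  case/orP: (nbr_splitc c e) => h.
    have hr' : r \in lnb (~~ ~~ c) z by rewrite negbK.
    have hrb : r \in lnb (~~ ~~ c) b by rewrite negbK lnb_sym.
    by have := pair_cap_pure hb hr' hrb; rewrite rZ.
  by have := pair_cap_pure hr hb h; rewrite bZ.
case/negP: (rZ); case/orP: (nbr_splitc c e) => h.
  by rewrite eqZ; apply: (@bichr_of c b r z); rewrite lnb_sym.
by apply: (@bichr_of c r z b); rewrite // lnb_sym.
Qed.

(** The bichromatic [b'] leaves room for at most mu bichromatic vertices in [lnb c z], and the
    monochromatic [b0] for at most mu others. This yields two bichromatic vertices [r'] and [r'']
    joined by colour [c], each with at least n - 4 mu bichromatic neighbours in colour [~~ c]. The
    two neighbour sets are disjoint and consist of non-neighbours of [x z], so 2 (n - 4 mu) <=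
    mu. *)
Lemma bichr_sides c z r' b' : z \in bichr ->
  r' \in lnb c z -> r' \in bichr -> b' \in lnb (~~ c) z -> b' \in bichr -> False.
Proof.
move=> zZ hr' r'Z hb' b'Z.
have [b0 /setIP[b0z b0r]] := pair_cap_nonempty zZ r'Z hr'.
have b0p := pair_cap_pure hr' b0z b0r.
have [_ nxb' _] := link_neq hb'; have [_ nxb0 _] := link_neq b0z.
have [nxz _ _] := link_neq hr'.
have cZ : #|lnb c z :&: bichr| <= mu.
  apply: leq_trans (muP nxb'); apply/subset_leq_card/subsetP => r /setIP[hr rZ].
  by rewrite inE E23 (no_mixed_edge zZ hr hb') // rZ b'Z.
have cP : #|lnb c z :\: bichr| <= mu.
  apply: leq_trans (muP nxb0); apply/subset_leq_card/subsetP => r /setDP[hr rZ].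
  by rewrite inE E23 (no_mixed_edge zZ hr b0z) // (negPf rZ) (negPf b0p).
have [r'' /setIP[/setIP[hr'' hrr] r''Z]] :
    exists r'', r'' \in lnb c z :&: lnb c r' :&: bichr.
  apply/set0Pn; rewrite -card_gt0.
  have sub : lnb c z :&: lnb c r' \subset
      (lnb c z :&: lnb c r' :&: bichr) :|: (lnb c z :\: bichr).
    by apply/subsetP => v; rewrite !inE => /andP[-> ->] /=; rewrite andbT orbN.
  have := subset_leq_card sub; have := lnb_cap_lb hr'.
  have := (leq_card_setU (lnb c z :&: lnb c r' :&: bichr) (lnb c z :\: bichr)).1.
  move: mu_small cP; clear; lia.
have big w : w \in lnb c z -> w \in bichr ->
    #|T| <= #|lnb (~~ c) w :&: bichr| + 4 * mu.
  move=> hw wZ.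
  have [r /setDP[/setIP[_ hr] rp]] : exists r, r \in (lnb c z :&: lnb c w) :\: bichr.
    apply/set0Pn; rewrite -card_gt0.
    have sub : lnb c z :&: lnb c w \subset
        ((lnb c z :&: lnb c w) :\: bichr) :|: (lnb c z :&: bichr).
      by apply/subsetP => v; rewrite !inE => /andP[-> ->] /=; rewrite andbT orNb.
    have := subset_leq_card sub; have := lnb_cap_lb hw.
    have := (leq_card_setU ((lnb c z :&: lnb c w) :\: bichr) (lnb c z :&: bichr)).1.
    move: mu_small cZ; clear; lia.
  have [_ nxr _] := link_neq hr.
  have : #|lnb (~~ c) w :\: bichr| <= mu.
    apply: leq_trans (muP nxr); apply/subset_leq_card/subsetP => b /setDP[hb bp].
    by rewrite inE (no_mixed_edge wZ hr hb) // (negPf rp) (negPf bp).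
  have := lnb_lb (~~ c) wZ; have := cardsID bichr (lnb (~~ c) w).
  clear; lia.
have inM w : w \in lnb c z -> w \in bichr ->
    lnb (~~ c) w :&: bichr \subset nonnbr E x z.
  move=> hw wZ; apply/subsetP => v /setIP[hv vZ]; rewrite inE; apply/negP => e.
  case/orP: (nbr_splitc c e) => h; first exact: pair_no_mix zZ wZ hw h hv.
  by have := pair_cap_pure hw h hv; rewrite vZ.
have dis : [disjoint lnb (~~ c) r' :&: bichr & lnb (~~ c) r'' :&: bichr].
  rewrite -setI_eq0; apply/eqP/setP => v; rewrite !in_setI in_set0.
  apply/negP => /andP[/andP[h1 vZ] /andP[h2 _]].
  by have := pair_cap_pure hrr h1 h2; rewrite vZ.
have := (leq_card_setU (lnb (~~ c) r' :&: bichr) (lnb (~~ c) r'' :&: bichr)).2.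
rewrite dis => /eqP eU.
have sub : (lnb (~~ c) r' :&: bichr) :|: (lnb (~~ c) r'' :&: bichr)
    \subset nonnbr E x z by rewrite subUset !inM.
have := subset_leq_card sub; have := muP nxz; have := big _ hr' r'Z.
have := big _ hr'' r''Z; move: mu_small eU; clear; lia.
Qed.

Lemma nbr_meets_lnb c z r : z \in bichr -> x != r ->
  exists2 b, E x r b & b \in lnb c z.
Proof.
move=> zZ nxr.
have /set0Pn[b /setDP[h1]] : lnb c z :\: nonnbr E x r != set0.
  rewrite -card_gt0; have := lnb_lb c zZ; have := muP nxr.
  have := cardsID (nonnbr E x r) (lnb c z).
  have := subset_leq_card (subsetIr (lnb c z) (nonnbr E x r)).
  move: mu_small; clear; lia.
by rewrite inE negbK => h2; exists b.
Qed.

Definition onesided c :=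
  [set z in bichr | lnb (~~ c) z :&: bichr == set0].

Lemma bichr_onesided z : z \in bichr -> exists c, z \in onesided c.
Proof.
move=> zZ; case: (eqVneq (lnb true z :&: bichr) set0) => [e|/set0Pn[r /setIP[h1 h2]]].
  by exists false; rewrite inE zZ e eqxx.
exists true; rewrite inE zZ /=; apply/negPn/negP => /set0Pn[b /setIP[h3 h4]].
exact: bichr_sides zZ h1 h2 h3 h4.
Qed.

(** A monochromatic [r] would be adjacent in the link to some vertex of [lnb (~~ c) z], which is
    monochromatic too, against [no_mixed_edge]. A bichromatic [r] already has the bichromatic
    neighbour [z] in colour [c], so [bichr_sides] rules out the other side. *)
Lemma onesided_lnb c z r : z \in onesided c -> r \in lnb c z -> r \in onesided c.
Proof.
rewrite inE => /andP[zZ /eqP e0] hr.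
have pure b : b \in lnb (~~ c) z -> b \notin bichr.
  by move=> hb; apply/negP => bZ; have := in_set0 b; rewrite -e0 inE hb bZ.
have [_ nxr _] := link_neq hr.
have rZ : r \in bichr.
  have [b e hb] := nbr_meets_lnb (~~ c) zZ nxr.
  apply/negPn/negP => rp.
  by move: (no_mixed_edge zZ hr hb); rewrite (negPf rp) (negPf (pure _ hb)) e => /(_ erefl).
rewrite inE rZ /=; apply/negPn/negP => /set0Pn[b /setIP[hb bZ]].
by apply: (@bichr_sides c r z b) => //; rewrite lnb_sym.
Qed.

(* Count the triples (z, r, b) with z one-sided, [r \in lnb c z], [b] joined by
   colour [~~ c] to [z] but not to [r]. Colour [c] is symmetric and does not leave
   the one-sided vertices, so summing over [z] first ([L]) or over [r] first ([U])
   gives the same total; but each one-sided vertex has [U < L]. *)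
Lemma onesided_empty c : onesided c = set0.
Proof.
apply/eqP/negPn/negP => /set0Pn[z0 z0Z].
pose R z := lnb c z; pose B z := lnb (~~ c) z.
pose L z := \sum_(r in R z) #|B z :\: B r|.
pose U r := \sum_(z in R r) #|B z :\: B r|.
have LU : \sum_(z in onesided c) L z = \sum_(z in onesided c) U z.
  rewrite /L /U (exchange_big_dep (mem (onesided c))) /=; last first.
    by move=> z r hz; apply: onesided_lnb.
  apply: eq_bigr => r hr; apply: eq_bigl => z.
  apply/andP/idP => [[_]|h]; rewrite lnb_sym //.
  by rewrite (onesided_lnb hr) // -?lnb_sym.
have lt z : z \in onesided c -> U z < L z.
  move=> hz; have zZ : z \in bichr by move: hz; rewrite inE => /andP[].
  have [v hv] := lnb_nonempty c zZ; have [nxz _ _] := link_neq hv.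
  have RB : #|~: (R z :|: B z)| + #|R z| + #|B z| = #|T|.
    have := (leq_card_setU (R z) (B z)).2.
    have -> : [disjoint R z & B z].
      rewrite -setI_eq0; apply/eqP/setP => w; rewrite in_setI in_set0.
      by apply/negP => /andP[h1 h2]; case: (c) (lnb_disj h1 h2).
    by move=> /eqP; have := cardsC (R z :|: B z); clear; lia.
  have Rge : #|T| <= #|R z| + 3 * mu by apply: lnb_lb.
  have few b w : b \in B w -> #|[set r in R w | b \in B r]| <= mu.
    move=> hb; have [_ _ nwb] := link_neq hb.
    apply: leq_trans (muP nwb); apply/subset_leq_card/subsetP => r.
    rewrite [r \in [set _ in _ | _]]inE => /andP[hr hbr].
    apply: lnb_nonmono hb _ _; first by rewrite negbK.
    by rewrite E23; apply: lnb_edge hbr.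
  apply: (@onesided_arith #|T| mu #|R z| #|B z| #|~: (R z :|: B z)|
            (#|R z| + 4 * mu - #|T|)) => //.
  - exact: lnb_ub.
  - by have := lnb_sum c nxz; rewrite -/(R z) -/(B z); clear; lia.
  - by move: Rge; clear; lia.
  (* By [pair_no_mix], a vertex of [B w] outside [B z] is outside [R z] as well, so only vertices
     outside both sets are counted. *)
  - have -> : U z = \sum_(w in R z) #|[set d in ~: (R z :|: B z) | d \in B w]|.
      apply: eq_bigr => w hw; apply: eq_card => d.
      rewrite in_setD [RHS]inE in_setC in_setU negb_or.
      case: (boolP (d \in B w)) => hd; rewrite ?andbF // !andbT.
      case: (boolP (d \in R z)) => // hdz; exfalso.
      have wZ : w \in bichr by move: (onesided_lnb hz hw); rewrite inE => /andP[].
      exact: (pair_no_mix zZ wZ hw hdz hd).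
    rewrite double_count -sum_nat_const; apply: leq_sum => d _.
    have [->|/set0Pn[w]] := eqVneq [set w in R z | d \in B w] set0.
      by rewrite cards0.
    rewrite [w \in [set _ in _ | _]]inE => /andP[hw hd].
    (* With one such [w] fixed, the others lie in [R w], at most mu of them by [few], or in [R z]
       outside [R w], at most |R z| - (n - 3 mu) of them. *)
    have sub : [set w in R z | d \in B w] \subset
        [set r in R w | d \in B r] :|: (R z :\: (R z :&: R w)).
      apply/subsetP => r; rewrite [r \in [set _ in _ | _]]inE => /andP[hr hdr].
      by rewrite !in_setU [r \in [set _ in _ | _]]inE hdr !in_setD !in_setI hr !andbT /= orbN.
    have := subset_leq_card sub; have := few d w hd.
    have := (leq_card_setU [set r in R w | d \in B r] (R z :\: (R z :&: R w))).1.
    rewrite cardsDS ?subsetIl //; have := lnb_cap_lb hw; rewrite -/(R z) -/(R w).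
    have := subset_leq_card (subsetIl (R z) (R w)); clear; lia.
  - have -> : #|R z| * #|B z| = \sum_(r in R z) (#|B z :\: B r| + #|[set b in B z | b \in B r]|).
      rewrite -sum_nat_const; apply: eq_bigr => r _.
      by rewrite -(cardsID (B r) (B z)) addnC; congr (_ + _); apply: eq_card => b; rewrite !inE.
    rewrite big_split /= leq_add2l double_count mulnC -sum_nat_const.
    by apply: leq_sum => b; apply: few.
have : \sum_(z in onesided c) (U z).+1 <= \sum_(z in onesided c) L z.
  by apply: leq_sum => z; apply: lt.
rewrite LU (bigD1 z0) //= [X in _ <= X](bigD1 z0) //=.
rewrite addSn ltn_add2l ltnNge => /negP; apply.
by apply: leq_sum => z _; apply: leqnSn.
Qed.

Lemma bichr_empty z : z \notin bichr.
Proof.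
apply/negP => /bichr_onesided[c]; by rewrite onesided_empty inE.
Qed.

(** Without bichromatic vertices, link edges that share a vertex agree in colour, and [u] and [u']
    have a common neighbour in the link. *)
Lemma link_col u v u' v' : E x u v -> E x u' v' -> col x u v = col x u' v'.
Proof.
have step a b b' : E x a b -> E x a b' -> col x a b = col x a b'.
  move=> e e'; apply/eqP/negPn/negP => ne; case/negP: (bichr_empty a).
  apply: (@bichr_of (col x a b) a b b'); rewrite inE ?e ?e' ?eqxx //=.
  by case: (col x a b) ne; case: (col x a b').
move=> e e'; have [nxu _ _] := edge_neq e; have [nxu' _ _] := edge_neq e'.
have /set0Pn[w] : ~: (nonnbr E x u :|: nonnbr E x u') != set0.
  rewrite -card_gt0; have := cardsC (nonnbr E x u :|: nonnbr E x u').
  have := (leq_card_setU (nonnbr E x u) (nonnbr E x u')).1.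
  move: (muP nxu) (muP nxu') mu_small; clear; lia.
rewrite !inE negb_or !negbK => /andP[h1 h2].
by rewrite (step _ _ _ e h1) col23 (step w u u') -1?col23 -1?E23 // (step _ _ _ h2 e').
Qed.

End Link.

(** An edge [a a' w] belongs to the links of both [a] and [a']. *)
Theorem monochromatic a b c a' b' c' : E a b c -> E a' b' c' -> col a b c = col a' b' c'.
Proof.
move=> e e'.
have [eaa|naa] := eqVneq a a'; first by rewrite eaa in e *; apply: link_col.
have /set0Pn[w] : ~: nonnbr E a a' != set0.
  rewrite -card_gt0; have := cardsC (nonnbr E a a').
  move: (muP naa) mu_small; clear; lia.
rewrite !inE negbK => h.
by rewrite (link_col e h) col12; apply: link_col; rewrite // E12.
Qed.

End Colouring.

(** * Reaching every ordering of an edge *)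

Section Orderings.

Variables (T : finType) (E : T -> T -> T -> bool) (mu : nat).
Hypothesis tE : is_tgraph E.
Hypothesis muP : forall x y, x != y -> #|nonnbr E x y| <= mu.
Hypothesis mu_small : 9 * mu < 2 * #|T|.

Let E12 x y z : E x y z = E y x z. Proof. by case: tE. Qed.
Let E23 x y z : E x y z = E x z y. Proof. by case: tE. Qed.

Lemma k4_12 a b c d : k4 E a b c d = k4 E b a c d.
Proof. by rewrite /k4 (E12 a b c) (E12 a b d) [_ && E b c d]andbC. Qed.

Lemma k4_23 a b c d : k4 E a b c d = k4 E a c b d.
Proof. by rewrite /k4 (E23 a b c) (E12 b c d) [E a b d && _]andbCA. Qed.

Lemma k4_34 a b c d : k4 E a b c d = k4 E a b d c.
Proof. by rewrite /k4 (E23 a c d) (E23 b c d) andbCA. Qed.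

Lemma k4_rot a b c d : k4 E a b c d = k4 E b c d a.
Proof. by rewrite k4_12 k4_23 k4_34. Qed.

Variables (X : eqType) (f : T -> T -> T -> X).
Hypothesis fP : forall p q r s, k4 E p q r s -> f p q r = f q r s.

Definition cyc_eqs a b c d :=
  [/\ f a b c = f b c d, f b c d = f c d a & f c d a = f d a b].

Lemma k4_cyc a b c d : k4 E a b c d -> cyc_eqs a b c d.
Proof.
by move=> K; split; apply: fP; [| rewrite -k4_rot | rewrite -2!k4_rot].
Qed.

Lemma k4_cycs a b c d : k4 E a b c d ->
  [/\ cyc_eqs a b c d, cyc_eqs a b d c & cyc_eqs a c b d] /\
  [/\ cyc_eqs a c d b, cyc_eqs a d b c & cyc_eqs a d c b].
Proof.
move=> K; split; split; apply: k4_cyc; rewrite // ?[k4 E a b d c]k4_34 //.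
- by rewrite -k4_23.
- by rewrite k4_34 -k4_23.
- by rewrite k4_23 -k4_34.
- by rewrite k4_34 k4_23 -k4_34.
Qed.

(** The vertex [v] has to be a neighbour of every pair among [p], [q], [u], [w] except possibly
    [u w]. *)
Definition swappable u w p q := exists v, k4 E p q u v && k4 E p q w v.

Lemma swappable_sym u w p q : swappable u w p q ->
  [/\ swappable w u p q, swappable u w q p & swappable w u q p].
Proof.
move=> [v /andP[h1 h2]]; split; exists v; rewrite ?h1 ?h2 //.
  by rewrite k4_12 h1 k4_12 h2.
by rewrite k4_12 h2 k4_12 h1.
Qed.

(* A walk can replace u by v, then w by u, then v by w. *)
Lemma swap_eqs u w p q : swappable u w p q ->
  [/\ f p q u = f p q w, f p u q = f p w q & f u p q = f w p q] /\
  [/\ f q p u = f q p w, f q u p = f q w p & f u q p = f w q p].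
Proof.
move=> [v /andP[/k4_cycs [[[? ? ?] [? ? ?] [? ? ?]] [[? ? ?] [? ? ?] [? ? ?]]]
  /k4_cycs [[[? ? ?] [? ? ?] [? ? ?]] [[? ? ?] [? ? ?] [? ? ?]]]]].
by split; split; congruence.
Qed.

Definition const_on (s : seq T) := forall p q r p' q' r',
  uniq [:: p; q; r] -> uniq [:: p'; q'; r'] ->
  {subset [:: p; q; r] <= s} -> {subset [:: p'; q'; r'] <= s} ->
  f p q r = f p' q' r'.

Lemma const_on_sub s s' : const_on s -> {subset s' <= s} -> const_on s'.
Proof.
move=> h sub p q r p' q' r' u u' i i'.
by apply: h => // x hx; apply: sub; [apply: i | apply: i'].
Qed.

(* Two transpositions sharing a vertex generate all orderings. *)
Lemma two_swaps o x y s : k4 E o x y s ->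
  swappable x s o y -> swappable y s o x -> const_on [:: o; x; y; s].
Proof.
move=> /k4_cycs [[[? ? ?] [? ? ?] [? ? ?]] [[? ? ?] [? ? ?] [? ? ?]]].
move=> /swap_eqs [[? ? ?] [? ? ?]] /swap_eqs [[? ? ?] [? ? ?]].
have key p q r : uniq [:: p; q; r] -> {subset [:: p; q; r] <= [:: o; x; y; s]} ->
    f p q r = f o x y.
  move=> u sub; have := sub p (mem_head _ _).
  have : q \in [:: o; x; y; s] by apply: sub; rewrite !inE eqxx orbT.
  have : r \in [:: o; x; y; s] by apply: sub; rewrite !inE eqxx !orbT.
  clear sub; rewrite !inE => /or4P[] /eqP ? /or4P[] /eqP ? /or4P[] /eqP ?; subst p q r;
  by [congruence | move: u; rewrite /= !inE ?eqxx ?orbT ?andbF].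
by move=> p q r p' q' r' u u' i i'; rewrite key // [RHS]key.
Qed.

(** A vertex [v] that allows none of the four swaps is a non-neighbour of [a b], or of [c d], or of
    two of the other four pairs. With weight 2 on [a b] and [c d] and weight 1 on the others, every
    [v] misses weight at least 2 out of 8, so 2 n <= 8 mu. *)
Lemma some_swap a b c d : k4 E a b c d ->
  [\/ swappable a c b d, swappable b d a c, swappable a d b c | swappable b c a d].
Proof.
move=> K; have /and4P[Kabc Kabd Kacd Kbcd] := K.
have [nab nac nbc] := edge_neq tE Kabc; have [_ nad nbd] := edge_neq tE Kabd.
have [_ _ ncd] := edge_neq tE Kacd.
have [/existsP[v]|no] := boolP [exists v, [|| k4 E b d a v && k4 E b d c v,
  k4 E a c b v && k4 E a c d v, k4 E b c a v && k4 E b c d v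
  | k4 E a d b v && k4 E a d c v]].
  by case/or4P=> h; [apply: Or41|apply: Or42|apply: Or43|apply: Or44]; exists v.
exfalso.
have cnt v : ~~ E a c v + ~~ E b d v + ~~ E a d v + ~~ E b c v + ~~ E a b v + ~~ E a b v + ~~ E c d v + ~~ E c d v >= 2.
  move: no; rewrite negb_exists => /forallP/(_ v); rewrite /k4.
  rewrite (E12 b a) (E12 d a) (E12 d c) (E12 c a) (E12 c b) (E12 d b).
  rewrite ?(E12 b a) ?(E12 c b) ?(E12 d a) ?(E12 d c) ?(E12 d b) ?(E12 c a).
  rewrite (E23 a c b) (E23 a d b) (E23 a d c) (E23 b d c) (E23 b d a) (E23 b c a) ?(E12 b a).
  rewrite ?Kabc ?Kabd ?Kacd ?Kbcd /=.
  by case: (E a b v); case: (E a c v); case: (E a d v); case: (E b c v); case: (E b d v); case: (E c d v).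
have sumN u w : u != w -> \sum_v (~~ E u w v : nat) <= mu.
  move=> n; apply: leq_trans (muP n); rewrite -sum1_card [X in _ <= X]big_mkcond /=.
  by apply: leq_sum => v _; rewrite inE; case: (E u w v).
have : \sum_(v : T) 2 <= \sum_v (~~ E a c v + ~~ E b d v + ~~ E a d v + ~~ E b c v + ~~ E a b v + ~~ E a b v + ~~ E c d v + ~~ E c d v).
  by apply: leq_sum => v _; apply: cnt.
rewrite !big_split /= sum_nat_const.
move: (sumN _ _ nab) (sumN _ _ nac) (sumN _ _ nad) (sumN _ _ nbc) (sumN _ _ nbd) (sumN _ _ ncd).
have -> : #|[pred v : T | true]| = #|T| by apply: eq_card.
move: mu_small; clear; lia.
Qed.

(** The four vertices have three perfect matchings, and [some_swap] gives a swap outside each of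
    them. So the swaps found do not all belong to one matching, and pairs from different matchings
    share a vertex, as [two_swaps] requires. *)
Lemma k4_const a b c d : k4 E a b c d -> const_on [:: a; b; c; d].
Proof.
move=> K; have /and4P[? ? ? ?] := K.
have K2 : k4 E a c b d by rewrite -k4_23.
have K3 : k4 E a d b c by rewrite k4_23 k4_34.
have go o x y s : swappable x s o y -> swappable y s o x -> k4 E o x y s ->
    {subset [:: a; b; c; d] <= [:: o; x; y; s]} -> const_on [:: a; b; c; d].
  by move=> h1 h2 Ko sub; apply: const_on_sub (two_swaps Ko h1 h2) sub.
have D1 := some_swap K; have D2 := some_swap K2; have D3 := some_swap K3.
case: D1 => h1; case: D2 => h2; case: D3 => h3;
have [? ? ?] := swappable_sym h1; have [? ? ?] := swappable_sym h2;
have [? ? ?] := swappable_sym h3;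
match goal with
  i : swappable ?x ?s ?o ?y, j : swappable ?y ?s ?o ?x |- _ => apply: (go o x y s i j)
end;
try (by move=> z; rewrite !inE => /or4P[] ->; rewrite ?orbT);
apply/and4P; split; first [assumption | rewrite E12; assumption
  | rewrite E23; assumption | rewrite E12 E23; assumption
  | rewrite E23 E12; assumption | rewrite E12 E23 E12; assumption].
Qed.

Lemma edge_k4 x y z : E x y z -> exists v, k4 E x y z v.
Proof.
move=> e; have /set0Pn[v] : common_nbr E x y z != set0.
  rewrite -card_gt0; have := card_common_nbr tE muP mu_small e.
  by move: mu_small; clear; lia.
by rewrite inE => h; exists v.
Qed.

(** Edges are coloured by whether [f] takes its value at [a' b' c']; [k4_const] makes this colouring
    symmetric and constant on every K4. *)
Theorem cyc_invariant_const a b c a' b' c' :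
  E a b c -> E a' b' c' -> f a b c = f a' b' c'.
Proof.
move=> e e'; pose col x y z := E x y z && (f x y z == f a' b' c').
have k4u x y z v : k4 E x y z v ->
    [/\ x != y, x != z, y != z & [/\ x != v, y != v & z != v]].
  move=> /and4P[k1 k2 k3 k4].
  by have [-> -> ->] := edge_neq tE k1; have [_ -> ->] := edge_neq tE k2; have [_ _ ->] := edge_neq tE k3.
have perm p q r p' q' r' : E p q r -> uniq [:: p'; q'; r'] ->
    {subset [:: p'; q'; r'] <= [:: p; q; r]} -> f p q r = f p' q' r'.
  move=> k u sub; have [v K] := edge_k4 k.
  have [n1 n2 n3 _] := k4u _ _ _ _ K.
  apply: (k4_const K) => //; first by rewrite /= !inE negb_or n1 n2 n3.
    by move=> w; rewrite !inE => /or3P[] ->; rewrite ?orbT.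
  by move=> w /sub; rewrite !inE => /or3P[] ->; rewrite ?orbT.
have col12 x y z : col x y z = col y x z.
  rewrite /col -E12; case k: (E y x z) => //=.
  have [n1 n2 n3] := edge_neq tE k; rewrite (@perm y x z x y z) //.
    by rewrite /= !inE negb_or eq_sym n1 n2 n3.
  by move=> w; rewrite !inE => /or3P[] ->; rewrite ?orbT.
have col23 x y z : col x y z = col x z y.
  rewrite /col -E23; case k: (E x z y) => //=.
  have [n1 n2 n3] := edge_neq tE k; rewrite (@perm x z y x y z) //.
    by rewrite /= !inE negb_or n1 n2 eq_sym n3.
  by move=> w; rewrite !inE => /or3P[] ->; rewrite ?orbT.
have col_k4 x y z v : k4 E x y z v -> col x y z = col x y v.
  move=> K; have /and4P[h1 h2 _ _] := K; rewrite /col h1 h2 /=; have -> // : f x y z = f x y v.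
  have [n1 n2 n3 [n4 n5 n6]] := k4u _ _ _ _ K.
  apply: (k4_const K); rewrite /= ?inE ?negb_or ?n1 ?n2 ?n3 ?n4 ?n5 //;
  by move=> w; rewrite !inE => /or3P[] ->; rewrite ?orbT.
have := monochromatic tE muP mu_small col12 col23 col_k4 e e'.
by rewrite /col e e' eqxx => /eqP.
Qed.

End Orderings.

Definition tstep (T : finType) (E : T -> T -> T -> bool) : rel (T * T * T) :=
  fun p q => [&& q.1.1 == p.1.2, q.1.2 == p.2 & k4 E p.1.1 p.1.2 p.2 q.2].

(* A step can be undone by going on around the same K4. *)
Theorem triples_connected (T : finType) (E : T -> T -> T -> bool) mu a b c a' b' c' :
  is_tgraph E -> (forall x y, x != y -> #|nonnbr E x y| <= mu) ->
  9 * mu < 2 * #|T| -> E a b c -> E a' b' c' ->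
  connect (tstep E) (a, b, c) (a', b', c').
Proof.
move=> tE muP mus e e'.
have st p q r s : k4 E p q r s -> connect (tstep E) (p, q, r) (q, r, s).
  by move=> K; apply: connect1; rewrite /tstep /= !eqxx K.
pose f x y z := connect (tstep E) (a, b, c) (x, y, z).
have fP p q r s : k4 E p q r s -> f p q r = f q r s.
  move=> K; apply/idP/idP => h; first exact: connect_trans h (st _ _ _ _ K).
  apply: connect_trans h _.
  have K1 : k4 E q r s p by rewrite -k4_rot.
  have K2 : k4 E r s p q by rewrite -k4_rot.
  have K3 : k4 E s p q r by rewrite -k4_rot.
  exact: connect_trans (st _ _ _ _ K1) (connect_trans (st _ _ _ _ K2) (st _ _ _ _ K3)).
by rewrite -/(f a' b' c') -(cyc_invariant_const tE muP mus fP e e') /f connect0.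
Qed.

(** * Density arguments *)

Lemma max_ge_avg (I : finType) (P : {set I}) (g : I -> nat) : P != set0 ->
  exists2 i, i \in P & \sum_(j in P) g j <= #|P| * g i.
Proof.
case/set0Pn => i0 i0P; case: (arg_maxnP g i0P) => i iP imax; exists i => //.
by rewrite -sum_nat_const; apply: leq_sum => j; apply: imax.
Qed.

Lemma subset_ge_avg (T : finType) (f : T -> nat) (D : {set T}) M : M <= #|D| ->
  exists D0 : {set T}, [/\ D0 \subset D, #|D0| = M &
    M * \sum_(x in D) f x <= #|D| * \sum_(x in D0) f x].
Proof.
move=> leM; have [k] := ubnP (#|D| - M); elim: k D leM => // k IH D leM ltk.
have [eM|neM] := eqVneq #|D| M; first by exists D; rewrite eM.
have /card_gt0P[x0 x0D] : 0 < #|D| by move: leM neM; lia.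
case: (arg_minnP f x0D) => x xD xmin.
have {}xD : x \in D := xD.
have cD := cardsD1 x D; rewrite xD in cD.
have [||D0 [sD0 cD0 hD0]] := IH (D :\ x); [move: leM neM cD ltk; lia..|].
exists D0; split=> //; first exact: subset_trans sD0 (subD1set _ _).
have e : \sum_(i in D) f i = f x + \sum_(i in D :\ x) f i by rewrite (big_setD1 x).
have lex : #|D| * f x <= \sum_(y in D) f y.
  by rewrite -sum_nat_const; apply: leq_sum => y; apply: xmin.
move: hD0 lex e cD leM neM.
move: (\sum_(y in D) f y) (\sum_(y in D :\ x) f y) (\sum_(y in D0) f y) #|D| #|D :\ x| (f x).
clear => S S' S0 d d' fx h lex eS ed leM neM; subst S d.
have [->//|M0] := posnP M.
have d'0 : 0 < d' by lia.
rewrite -(leq_pmul2l d'0).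
have h1 : d' * (fx + S') <= (1 + d') * S' by nia.
apply: (@leq_trans (M * ((1 + d') * S'))); first by rewrite mulnCA leq_mul2l h1 orbT.
by rewrite mulnCA [d' * _]mulnCA leq_mul2l h orbT.
Qed.

Lemma sum_count (T : finType) (Y : Type) (W : seq Y) (F : T -> Y -> bool) (D : {set T}) :
  \sum_(x in D) count (F x) W = \sum_(w <- W) #|[set x in D | F x w]|.
Proof.
elim: W => [|w W IH] /=; first by rewrite big_nil big1.
rewrite big_cons big_split /= IH; congr (_ + _).
rewrite -sum1_card [RHS](eq_bigl (fun x => (x \in D) && F x w)) ?big_mkcondr //=.
by move=> x; rewrite inE.
Qed.

(* Kovari-Sos-Turan for one small side: the loss in density is a constant that
   does not depend on [T] and [W], which allows iteration. *)
Lemma bipartite_pigeonhole (T : finType) (Y : Type) (W : seq Y)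
    (F : T -> Y -> bool) (D : {set T}) m K :
  0 < m -> 0 < K -> 2 * K * m <= #|D| ->
  #|D| * size W <= K * \sum_(x in D) count (F x) W ->
  exists S : {set T}, [/\ S \subset D, #|S| = m &
    size W <= 2 * K * 2 ^ (2 * K * m) * count (fun w => [forall x in S, F x w]) W].
Proof.
move=> m0 K0 leM dens; set M := 2 * K * m in leM *.
have M0 : 0 < M by rewrite !muln_gt0 K0 m0.
have [D0 [sD0 cD0 hD0]] := subset_ge_avg (fun x => count (F x) W) leM.
have D0pos : 0 < #|D| by apply: leq_trans M0 leM.
have dens0 : M * size W <= K * \sum_(x in D0) count (F x) W.
  rewrite -(leq_pmul2l D0pos); move: dens hD0.
  move: (\sum_(x in D) _) (\sum_(x in D0) _) #|D| (size W) => S S0 d w; clear; nia.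
rewrite sum_count in dens0.
(* The average degree into [D0] is at least M / K = 2 m, so at least a proportion 1 / (2 K) of [W]
   has degree at least m. Each such element is joined to all of some m-subset of [D0], and there are
   at most 2 ^ M of these. *)
pose deg w := #|[set x in D0 | F x w]|.
pose good := count (fun w => m <= deg w) W.
have degM w : deg w <= M by rewrite -cD0 /deg setIdE subset_leq_card // subsetIl.
have up : \sum_(w <- W) deg w <= m * size W + M * good.
  rewrite /good -sum1_size big_distrr /= -sum1_count big_distrr /= [X in _ + X]big_mkcond -big_split /=.
  apply: leq_sum => w _; case: ifP => h; first by rewrite muln1 (leq_trans (degM w)) // muln1 leq_addl.
  by rewrite addn0 muln1 ltnW // ltnNge h.
have hgood : size W <= 2 * K * good.
  have : m * (size W) <= m * (2 * K * good); last by rewrite leq_pmul2l.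
  have h1 : 2 * (m * size W) <= \sum_(w <- W) deg w.
    by rewrite -(leq_pmul2l K0); apply: leq_trans dens0; rewrite /M; clear; lia.
  move: h1 up; rewrite /M; move: (\sum_(w <- W) deg w) => S; clear; nia.
pose P := [set S : {set T} | (S \subset D0) && (#|S| == m)].
have Pne : P != set0.
  have [|D1 [s1 c1 _]] := @subset_ge_avg T (fun=> 0) D0 m.
    by rewrite cD0 /M leq_pmull // muln_gt0.
  by apply/set0Pn; exists D1; rewrite inE s1 c1 /=.
pose g (S : {set T}) := count (fun w => [forall x in S, F x w]) W.
have [S SP hS] := max_ge_avg g Pne.
exists S; move: SP; rewrite inE => /andP[SD0 /eqP cS]; split=> //; first exact: subset_trans SD0 sD0.
apply: leq_trans hgood _; rewrite -[X in _ <= X]mulnA leq_mul2l; apply/orP; right.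
have cP : #|P| <= 2 ^ M.
  rewrite -cD0 -card_powerset; apply/subset_leq_card/subsetP => S'.
  by rewrite !inE => /andP[].
apply: leq_trans (_ : #|P| * g S <= _); last by rewrite leq_mul2r cP orbT.
apply: leq_trans hS; rewrite (sum_count W (fun (S : {set T}) w => [forall x in S, F x w]) P) /good -sum1_count big_mkcond /=.
apply: leq_sum => w _; case: ifP => // h.
have [D1 [s1 c1 _]] := subset_ge_avg (fun=> 0) h.
rewrite card_gt0; apply/set0Pn; exists D1; rewrite !inE c1 eqxx andbT.
rewrite (subset_trans s1) ?setIdE ?subsetIl //=.
by apply/forall_inP => x /(subsetP s1); rewrite inE => /andP[].
Qed.

(** * Random tuples, one coordinate at a time *)

Section Resample.

Variables (I V : finType).
Implicit Types f g : {ffun I -> V}.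

Definition upd f i x : {ffun I -> V} := [ffun j => if j == i then x else f j].

Lemma upd_id f i : upd f i (f i) = f.
Proof. by apply/ffunP => j; rewrite ffunE; case: eqP => // ->. Qed.

Lemma upd_upd f i x y : upd (upd f i x) i y = upd f i y.
Proof. by apply/ffunP => j; rewrite !ffunE; case: eqP. Qed.

Lemma upd_same f i x : upd f i x i = x.
Proof. by rewrite ffunE eqxx. Qed.

(** Exchanging [x] with the value [f i] is an involution on the pairs of [f] and [x]: a uniform
    tuple stays uniform when one coordinate is resampled. *)
Lemma sum_resample i (P : pred {ffun I -> V}) :
  \sum_f #|[set x | P (upd f i x)]| = #|V| * #|[set f | P f]|.
Proof.
pose h (p : {ffun I -> V} * V) := (upd p.1 i p.2, p.1 i).
have hK : involutive h.
  by move=> [f x]; rewrite /h /= upd_upd upd_id upd_same.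
transitivity (\sum_f \sum_(x : V) (P (upd f i x) : nat)).
  apply: eq_bigr => f _; rewrite -sum1_card big_mkcond /=.
  by apply: eq_bigr => x _; rewrite inE; case: (P _).
rewrite pair_big /= (reindex_inj (inv_inj hK)) /=.
transitivity (\sum_(p : {ffun I -> V} * V) (P p.1 : nat)).
  by apply: eq_bigr => -[f x] _; rewrite /= upd_upd upd_id.
rewrite -(pair_big xpredT xpredT (fun f (x : V) => (P f : nat))) /=.
rewrite (eq_bigr (fun f => #|V| * (P f : nat))); last first.
  by move=> f _; rewrite sum_nat_const.
rewrite -big_distrr /=; congr (_ * _); rewrite -sum1_card [RHS]big_mkcond /=.
by apply: eq_bigr => f _; rewrite inE; case: (P f).
Qed.

(** For exposing a random tuple coordinate by coordinate: [P] ignores coordinate [i], so it survives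
    the resampling that secures [Q]. *)
Lemma resample_lb i (P Q : pred {ffun I -> V}) K : 0 < #|V| ->
  (forall f x, P (upd f i x) = P f) ->
  (forall f, P f -> #|V| <= K * #|[set x | Q (upd f i x)]|) ->
  #|[set f | P f]| <= K * #|[set f | P f && Q f]|.
Proof.
move=> V0 hP hQ; rewrite -(leq_pmul2l V0) mulnCA -(sum_resample i (fun f => P f && Q f)) big_distrr /=.
rewrite mulnC -sum_nat_const big_mkcond /=; apply: leq_sum => f _.
rewrite inE; case: ifP => // Pf; apply: leq_trans (hQ f Pf) _.
by rewrite leq_mul2l; apply/orP; right; apply/subset_leq_card/subsetP => x; rewrite !inE hP Pf.
Qed.

End Resample.

(** Each coordinate in [r] takes one use of [bipartite_pigeonhole]; [f] supplies the coordinates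
    outside [r]. [K] is quantified after [r] because the density drops at every step of the
    induction. *)
Lemma kst_coords (I : finType) m (r : seq I) : 0 < m -> uniq r -> forall K, 0 < K ->
  exists M, forall (V : finType) (F : {set {ffun I -> V}}), M <= #|V| -> 0 < #|V| ->
  #|V| ^ #|I| <= K * #|F| ->
  exists (U : I -> {set V}) (f : {ffun I -> V}), (forall i, i \in r -> #|U i| = m) /\
    forall g : {ffun I -> V}, (forall i, i \in r -> g i \in U i) ->
      (forall i, i \notin r -> g i = f i) -> g \in F.
Proof.
move=> m0; elim: r => [_|i r IH /= /andP[nir ur]] K K0.
  exists 0 => V F _ V0 dens.
  have /card_gt0P[f fF] : 0 < #|F|.
    by rewrite -(ltn_pmul2l K0) muln0; apply: leq_trans dens; rewrite expn_gt0 V0.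
  exists (fun=> set0), f; split=> // g _ gf.
  by have -> : g = f by apply/ffunP => i; apply: gf.
have [|M hM] := IH ur (2 * K * 2 ^ (2 * K * m)).
  by rewrite !muln_gt0 K0 expn_gt0.
exists (M + 2 * K * m) => V F leM V0 dens.
have [||S [_ cS dS]] := @bipartite_pigeonhole V _ (enum {ffun I -> V})
    (fun x f => upd f i x \in F) [set: V] m K m0 K0.
- by rewrite cardsT; apply: leq_trans leM; apply: leq_addl.
- rewrite cardsT -cardE card_ffun sum_count big_enum /=.
  have -> : \sum_(f in {ffun I -> V}) #|[set x in [set: V] | upd f i x \in F]| = #|V| * #|F|.
    have -> : #|F| = #|[set f | f \in F]| by apply: eq_card => f; rewrite inE.
    rewrite -(sum_resample i (fun f => f \in F)).
    by apply: eq_big => // f _; apply: eq_card => x; rewrite !inE.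
  by rewrite mulnCA leq_mul2l dens orbT.
pose F1 := [set f | [forall x in S, upd f i x \in F]].
rewrite -cardE card_ffun in dS.
have cF1 : count (fun f => [forall x in S, upd f i x \in F]) (enum {ffun I -> V}) = #|F1|.
  by rewrite -sum1_count big_enum_cond /= -sum1_card; apply: eq_bigl => f; rewrite !inE.
rewrite cF1 in dS.
have [|U [f [cU hU]]] := hM V F1 _ V0 dS; first by apply: leq_trans leM; apply: leq_addr.
exists (fun j => if j == i then S else U j), f; split.
  move=> j; rewrite inE; case: eqP => [//|_ /=]; exact: cU.
move=> g hg gf.
have : upd g i (f i) \in F1.
  apply: hU => j hj; last first.
    rewrite ffunE; case: eqP => [->//|/eqP nji]; by apply: gf; rewrite inE negb_or nji hj.
  rewrite ffunE; case: eqP => [eji|/eqP nji]; first by rewrite -eji hj in nir.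
  by have := hg j; rewrite inE hj orbT (negPf nji) => /(_ isT).
rewrite inE => /forall_inP/(_ (g i)); rewrite upd_upd upd_id; apply.
by have := hg i; rewrite inE eqxx /= => /(_ isT).
Qed.

(** Erdos's theorem on complete partite subhypergraphs, for ordered tuples over a single vertex set.
    The classes may overlap; where disjointness is wanted, it has to come from the family [F]. *)
Lemma kst (I : finType) m K : 0 < m -> 0 < K ->
  exists M, forall (V : finType) (F : {set {ffun I -> V}}), M <= #|V| -> 0 < #|V| ->
  #|V| ^ #|I| <= K * #|F| ->
  exists U : I -> {set V}, (forall i, #|U i| = m) /\
    forall g : {ffun I -> V}, (forall i, g i \in U i) -> g \in F.
Proof.
move=> m0 K0; have [M hM] := kst_coords m0 (enum_uniq I) K0; exists M => V F h1 h2 h3.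
have [U [f [cU hU]]] := hM V F h1 h2 h3; exists U; split=> [i|g hg].
  by apply: cU; rewrite mem_enum.
by apply: hU => i; [move=> _; apply: hg | rewrite mem_enum].
Qed.

(** * Samples inherit the codegree condition *)

Lemma card_bigcup_le (I T : finType) (P : pred I) (F : I -> {set T}) :
  #|\bigcup_(i | P i) F i| <= \sum_(i | P i) #|F i|.
Proof.
elim/big_rec2: _ => [|i n S _ h]; first by rewrite cards0.
by apply: leq_trans (leq_card_setU _ _).1 _; rewrite leq_add2l.
Qed.

(** Bernoulli's inequality (1 + 1/P)^r >= 1 + r/P, cleared of denominators. *)
Lemma bernoulli_nat P r : P ^ r * (P + r) <= P.+1 ^ r * P.
Proof.
elim: r => [|r IH]; first by rewrite !expn0 !mul1n addn0.
rewrite !expnS -mulnA; apply: leq_trans (_ : P.+1 * (P ^ r * (P + r)) <= _).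
  by clear IH; move: (P ^ r) => A; nia.
by rewrite -mulnA leq_mul2l IH orbT.
Qed.

(** The exponent s - 2 is taken to be 3 r: the cube of Bernoulli's inequality then grows like r ^ 3,
    against a quadratic factor s ^ 2 <= 25 r ^ 2. *)
Lemma exp_beats_square P Q C s0 : P < Q ->
  exists2 s, s0 <= s & C * s ^ 2 * P ^ (s - 2) <= Q ^ (s - 2).
Proof.
move=> PQ; have [->|P0] := posnP P.
  by exists (s0 + 3); [rewrite leq_addr | rewrite exp0n ?muln0 //; lia].
pose r := C * 25 * P ^ 3 + s0 + 1; exists (3 * r + 2); first by rewrite /r; lia.
rewrite addnK; apply: leq_trans (_ : P.+1 ^ (3 * r) <= _); last first.
  by rewrite leq_exp2r // muln_gt0 /r addn1.
have r0 : 0 < r by rewrite /r addn1.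
have h : P ^ (3 * r) * r ^ 3 <= P.+1 ^ (3 * r) * P ^ 3.
  rewrite mulnC [3 * r]mulnC !expnM -!expnMn leq_exp2r // mulnC.
  by apply: leq_trans (bernoulli_nat P r); rewrite leq_mul2l leq_addl orbT.
rewrite -(leq_pmul2r (_ : 0 < P ^ 3)) ?expn_gt0 ?P0 //.
apply: leq_trans h; rewrite mulnAC mulnC leq_mul2l; apply/orP; right.
have h2 : (3 * r + 2) ^ 2 <= 25 * r ^ 2.
  have -> : 25 * r ^ 2 = (5 * r) ^ 2 by rewrite expnMn.
  by rewrite leq_exp2r //; lia.
apply: leq_trans (_ : C * (25 * r ^ 2) * P ^ 3 <= _).
  by rewrite leq_mul2r leq_mul2l h2 !orbT.
have -> : r ^ 3 = r * r ^ 2 by rewrite expnS.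
rewrite mulnA mulnAC leq_mul2r; apply/orP; right; rewrite /r; lia.
Qed.

(* Left: 9 k times the mean weight of a random vertex; right: 9 k times the
   weighted geometric mean at the threshold proportion 2/9 of non-neighbours. *)
Lemma chernoff_base k : 0 < k -> exists a, 0 < a /\
  9 * k * a ^ 9 + (2 * k - 1) * (a.+1 ^ 9 - a ^ 9) < 9 * k * (a ^ 7 * a.+1 ^ 2).
Proof.
(* In the expansion of [a.+1 ^ 9] the coefficients after the first two add up to 502. With this
   bound the claim reduces to (2 k - 1) (9 a + 502) < 9 k (2 a + 1), where the terms in k a cancel
   and 1004 k < 9 a suffices. *)
move=> k0; have [a [a0 ak]] : exists a, 0 < a /\ 1004 * k < 9 * a.
  by exists (112 * k); lia.
exists a; split=> //.
have mono j : j <= 7 -> a ^ j <= a ^ 7 by move=> h; rewrite leq_pexp2l.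
have h9 : a.+1 ^ 9 <= a ^ 9 + 9 * a ^ 8 + 502 * a ^ 7.
  have -> : a.+1 ^ 9 = a ^ 9 + 9 * a ^ 8 + 36 * a ^ 7 + 84 * a ^ 6 + 126 * a ^ 5
     + 126 * a ^ 4 + 84 * a ^ 3 + 36 * a ^ 2 + 9 * a ^ 1 + a ^ 0.
    by rewrite !expnS !expn0; clear; lia.
  move: (mono 0 isT) (mono 1 isT) (mono 2 isT) (mono 3 isT) (mono 4 isT) (mono 5 isT) (mono 6 isT).
  move: (a ^ 0) (a ^ 1) (a ^ 2) (a ^ 3) (a ^ 4) (a ^ 5) (a ^ 6) (a ^ 7) (a ^ 8) (a ^ 9).
  clear; lia.
apply: (@leq_ltn_trans (9 * k * a ^ 9 + (2 * k - 1) * (9 * a ^ 8 + 502 * a ^ 7))).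
  by rewrite leq_add2l leq_mul2l; apply/orP; right; lia.
have -> : 9 * k * (a ^ 7 * a.+1 ^ 2) = 9 * k * a ^ 9 + 9 * k * (2 * a ^ 8 + a ^ 7).
  rewrite -mulnDr; congr (_ * _).
  have -> : a.+1 ^ 2 = a ^ 2 + 2 * a + 1 by rewrite !expnS !expn0; clear; lia.
  have -> : a ^ 9 = a ^ 7 * a ^ 2 by rewrite -expnD.
  have -> : a ^ 8 = a ^ 7 * a by rewrite -expnSr.
  clear; lia.
rewrite ltn_add2l.
have -> : a ^ 8 = a * a ^ 7 by rewrite -expnS.
have a7 : 0 < a ^ 7 by rewrite expn_gt0 a0.
have -> : 9 * (a * a ^ 7) + 502 * a ^ 7 = (9 * a + 502) * a ^ 7 by clear; lia.
have -> : 2 * (a * a ^ 7) + a ^ 7 = (2 * a + 1) * a ^ 7 by clear; lia.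
rewrite !mulnA ltn_pmul2r //; clear a7 h9 mono; nia.
Qed.

(* Codegree at least (7/9 + 1/(9k)) |V|, cleared of denominators. *)
Definition dense (V : finType) (E : V -> V -> V -> bool) k :=
  forall x y, x != y -> 9 * k * #|nonnbr E x y| + #|V| <= 2 * k * #|V|.

Lemma prod_if (I : finType) (p : pred I) A B :
  \prod_(i : I) (if p i then A else B) = A ^ #|[set i | p i]| * B ^ #|[set i | ~~ p i]|.
Proof.
rewrite (bigID p) /=; congr (_ * _).
  rewrite (eq_bigr (fun=> A)) => [|i ->//]; rewrite prod_nat_const; congr (_ ^ _).
  by apply: eq_card => i; rewrite !inE.
rewrite (eq_bigr (fun=> B)) => [|i /negPf->//]; rewrite prod_nat_const; congr (_ ^ _).
by apply: eq_card => i; rewrite !inE.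
Qed.

Lemma sum_if (I : finType) (p : pred I) A B :
  \sum_(i : I) (if p i then A else B) = #|[set i | p i]| * A + #|[set i | ~~ p i]| * B.
Proof.
rewrite (bigID p) /=; congr (_ + _).
  rewrite (eq_bigr (fun=> A)) => [|i ->//]; rewrite sum_nat_const; congr (_ * _).
  by apply: eq_card => i; rewrite !inE.
rewrite (eq_bigr (fun=> B)) => [|i /negPf->//]; rewrite sum_nat_const; congr (_ * _).
by apply: eq_card => i; rewrite !inE.
Qed.

Section Sampling.

Variables (V : finType) (E : V -> V -> V -> bool) (s : nat).
Implicit Types f : {ffun 'I_s -> V}.

Definition induced f : 'I_s -> 'I_s -> 'I_s -> bool := fun i j l => E (f i) (f j) (f l).

Definition bad_pair i j := [set f | 2 * s <= 9 * #|nonnbr (induced f) i j|].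

Definition bad_at (i j : 'I_s) u v := [set f in bad_pair i j | (f i == u) && (f j == v)].

(* Chernoff by hand: Markov's inequality for the product over the sampled vertices
   of the weight [a ^ 9] of a neighbour and [a.+1 ^ 9] of a non-neighbour. *)
Lemma card_bad_at (i j : 'I_s) u v a : 0 < a -> i != j ->
  #|bad_at i j u v| * (a ^ 7 * a.+1 ^ 2) ^ s <= (a.+1 ^ 9) ^ 2 *
   (#|~: nonnbr E u v| * a ^ 9 + #|nonnbr E u v| * a.+1 ^ 9) ^ (s - 2).
Proof.
move=> a0 nij.
pose w z := if E u v z then a ^ 9 else a.+1 ^ 9.
pose Q (l : 'I_s) z := ((l == i) ==> (z == u)) && ((l == j) ==> (z == v)).
have wle z : w z <= a.+1 ^ 9.
  by rewrite /w; case: ifP => // _; rewrite leq_exp2r // leqnSn.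
have step1 : #|bad_at i j u v| * (a ^ 7 * a.+1 ^ 2) ^ s <=
    \sum_(f in family Q) \prod_l w (f l).
  rewrite -sum_nat_const big_mkcond [X in _ <= X]big_mkcond /=.
  apply: leq_sum => f _; case: ifP => // fb.
  move: fb; rewrite !inE => /andP[h /andP[/eqP fi /eqP fj]].
  rewrite ifT; last first.
    apply/familyP => l; rewrite unfold_in /= /Q.
    by apply/andP; split; apply/implyP => /eqP ->; rewrite ?fi ?fj.
  rewrite (prod_if (fun l => E u v (f l))).
  have -> : [set l | ~~ E u v (f l)] = nonnbr (induced f) i j.
    by apply/setP => l; rewrite !inE /induced fi fj.
  have : #|[set l | E u v (f l)]| + #|nonnbr (induced f) i j| = s.
    rewrite -[RHS]card_ord -(cardsC (nonnbr (induced f) i j)) addnC; congr (_ + _).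
    by apply: eq_card => l; rewrite !inE /induced fi fj negbK.
  move: h; move: #|nonnbr _ i j| #|[set l | _]| => x y h exy.
  rewrite -!expnM expnMn -!expnM.
  have [e eP] : exists e, 9 * x = 2 * s + e by exists (9 * x - 2 * s); lia.
  have -> : 7 * s = 9 * y + e by lia.
  have le : a ^ e <= a.+1 ^ e by case: (e) => // e'; rewrite leq_exp2r.
  by rewrite eP !expnD -mulnA leq_mul2l [a ^ e * _]mulnC leq_mul2l le !orbT.
(* The sum over tuples factors over the coordinates: the two pinned ones contribute at most
   [a.+1 ^ 9] each, each of the other s - 2 the total weight of V. *)
apply: leq_trans step1 _; rewrite -(bigA_distr_big_dep Q (fun _ z => w z)).
rewrite (bigD1 i) //= (bigD1 j) //=; last by rewrite eq_sym.
rewrite mulnA leq_mul //.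
  rewrite expnS expn1 leq_mul //.
    rewrite (eq_bigl (pred1 u)) ?big_pred1_eq // => z; rewrite /Q eqxx /= (negPf nij) /=.
    by rewrite andbT.
  rewrite (eq_bigl (pred1 v)) ?big_pred1_eq // => z; rewrite /Q eqxx /= eq_sym (negPf nij) /=.
  by [].
rewrite (eq_bigr (fun=> #|~: nonnbr E u v| * a ^ 9 + #|nonnbr E u v| * a.+1 ^ 9)).
  rewrite prod_nat_const; have -> // : #|[pred l | l != i & l != j]| = s - 2.
  have e : #|[pred l | l != i & l != j]| + #|[set i; j]| = s.
    rewrite -[RHS]card_ord -(cardC [pred l : 'I_s | l != i & l != j]); congr (_ + _).
    by apply: eq_card => l; rewrite !inE negb_and !negbK.
  by move: e; rewrite cards2 nij /= => /(congr1 (subn^~ 2)); rewrite addnK.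
move=> l /andP[ni nj]; rewrite (eq_bigl xpredT); last first.
  by move=> z; rewrite /Q (negPf ni) (negPf nj).
rewrite sum_if; congr (_ * _ + _ * _); apply: eq_card => z; rewrite !inE ?negbK //.
Qed.

Lemma card_eq_pair (i j : 'I_s) : 0 < #|V| -> i != j ->
  #|V| * #|[set f : {ffun 'I_s -> V} | f i == f j]| = #|V| ^ s.
Proof.
move=> V0 nij; rewrite -(sum_resample i (fun f => f i == f j)).
rewrite (eq_bigr (fun=> 1)) ?sum1_card ?card_ffun ?card_ord // => f _.
rewrite -(cards1 (f j)); apply: eq_card => x.
by rewrite !inE upd_same ffunE eq_sym [j == i]eq_sym (negPf nij) eq_sym.
Qed.

Lemma weight_arith k n x y A B : 9 * k * x + n <= 2 * k * n -> A <= B -> x + y = n ->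
  9 * k * (y * A + x * B) <= n * (9 * k * A + (2 * k - 1) * (B - A)).
Proof.
move=> h hAB exy; have [e ->] : exists e, B = A + e by exists (B - A); lia.
rewrite addKn; have -> : 9 * k * (y * A + x * (A + e)) = n * (9 * k * A) + 9 * k * x * e.
  by rewrite -exy; lia.
rewrite mulnDr leq_add2l mulnA leq_mul2r; apply/orP; right.
by rewrite mulnBr muln1; lia.
Qed.

(** Pinning the values at [i] and [j] fixes the set whose frequency is to be estimated. The |V| ^ 2
    choices of the two values make up for the exponent s - 2; tuples with equal values at [i] and
    [j] are counted separately. *)
Lemma card_bad_pair (i j : 'I_s) k a C : 1 < s -> 0 < a -> 0 < k -> i != j ->
  dense E k -> 0 < #|V| -> C * s ^ 2 <= #|V| ->
  C * s ^ 2 * (a.+1 ^ 9) ^ 2 *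
    (9 * k * a ^ 9 + (2 * k - 1) * (a.+1 ^ 9 - a ^ 9)) ^ (s - 2)
    <= (9 * k * (a ^ 7 * a.+1 ^ 2)) ^ (s - 2) ->
  C * s ^ 2 * #|bad_pair i j| <= 2 * #|V| ^ s.
Proof.
move=> s2 a0 k0 nij dE V0 leV hs.
set P := (9 * k * a ^ 9 + _) in hs; set B := (a.+1 ^ 9) in hs; set D := (a ^ 7 * _) in hs.
have D0 : 0 < D by rewrite muln_gt0 !expn_gt0 a0.
have aB : a ^ 9 <= B by rewrite leq_exp2r // leqnSn.
have bd u v : u != v -> C * s ^ 2 * #|bad_at i j u v| <= #|V| ^ (s - 2).
  move=> nuv; have := card_bad_at u v a0 nij; rewrite -/B -/D => hb.
  set S := (#|~: nonnbr E u v| * a ^ 9 + #|nonnbr E u v| * B) in hb.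
  have hS : 9 * k * S <= #|V| * P.
    exact: weight_arith (dE u v nuv) aB (cardsC (nonnbr E u v)).
  have hS2 : (9 * k) ^ (s - 2) * S ^ (s - 2) <= #|V| ^ (s - 2) * P ^ (s - 2).
    rewrite -!expnMn; case: (s - 2) => // t; by rewrite leq_exp2r.
  have Ds : D ^ s = D ^ 2 * D ^ (s - 2) by rewrite -expnD subnKC.
  have Q0 : 0 < (9 * k * D) ^ (s - 2) by rewrite expn_gt0 muln_gt0 D0 andbT muln_gt0 k0.
  rewrite -(leq_pmul2r Q0).
  apply: leq_trans (_ : C * s ^ 2 * (B ^ 2 * (#|V| ^ (s - 2) * P ^ (s - 2))) <= _); last first.
    move: hs; rewrite -/B -/D -/P.
    move: (C * s ^ 2) (B ^ 2) (P ^ (s - 2)) ((9 * k * D) ^ (s - 2)) (#|V| ^ (s - 2)).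
    clear => c b p q n h; rewrite (_ : c * (b * (n * p)) = n * (c * b * p)); last by lia.
    by rewrite leq_mul2l h orbT.
  rewrite -[X in X <= _]mulnA leq_mul2l; apply/orP; right.
  apply: leq_trans (_ : B ^ 2 * ((9 * k) ^ (s - 2) * S ^ (s - 2)) <= _); last first.
    by rewrite leq_mul2l hS2 orbT.
  rewrite expnMn mulnCA [X in _ <= X]mulnCA leq_mul2l; apply/orP; right.
  apply: leq_trans hb; rewrite Ds leq_mul2l leq_pmull ?orbT //.
  by rewrite expn_gt0 D0.
have cov : bad_pair i j \subset
    [set f : {ffun 'I_s -> V} | f i == f j] :|:
    \bigcup_(p : V * V | p.1 != p.2) bad_at i j p.1 p.2.
  apply/subsetP => f fb; rewrite in_setU inE.
  case: eqP => //= /eqP nf; apply/bigcupP; exists (f i, f j) => //.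
  by rewrite inE fb /= !eqxx.
have h1 : C * s ^ 2 * #|[set f : {ffun 'I_s -> V} | f i == f j]| <= #|V| ^ s.
  by rewrite -(card_eq_pair V0 nij) leq_mul2r leV orbT.
have h2 : C * s ^ 2 * #|\bigcup_(p : V * V | p.1 != p.2) bad_at i j p.1 p.2| <= #|V| ^ s.
  apply: leq_trans (_ : C * s ^ 2 * \sum_(p : V * V | p.1 != p.2) #|bad_at i j p.1 p.2| <= _).
    by rewrite leq_mul2l card_bigcup_le orbT.
  rewrite big_distrr /=; apply: leq_trans (_ : \sum_(p : V * V) #|V| ^ (s - 2) <= _).
    rewrite big_mkcond /=; apply: leq_sum => p _; case: ifP => // h; exact: bd.
  by rewrite sum_nat_const card_prod -[X in X * _]/(#|V| ^ 2) -expnD subnKC.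
apply: leq_trans (_ : C * s ^ 2 * (#|[set f : {ffun 'I_s -> V} | f i == f j]| +
  #|\bigcup_(p : V * V | p.1 != p.2) bad_at i j p.1 p.2|) <= _).
  rewrite leq_mul2l; apply/orP; right; apply: leq_trans (subset_leq_card cov) _.
  exact: (leq_card_setU _ _).1.
by rewrite mulnDr mul2n -addnn leq_add.
Qed.

Definition sample_bad := \bigcup_(p : 'I_s * 'I_s | p.1 != p.2) bad_pair p.1 p.2.

End Sampling.

(** A union bound over at most s ^ 2 pairs of indices, each estimate carrying the factor s ^ 2
    provided by [exp_beats_square]. The sample size depends on [k], [C] and [s0] but not on V. *)
Lemma sampling k C s0 : 0 < k -> exists s n0, [/\ s0 <= s, 1 < s &
  forall (V : finType) (E : V -> V -> V -> bool), n0 <= #|V| -> dense E k ->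
    C * #|sample_bad E s| <= 2 * #|V| ^ s].
Proof.
move=> k0; have [a [a0 ha]] := chernoff_base k0.
have [s hs0 hs] := exp_beats_square (C * (a.+1 ^ 9) ^ 2) (s0 + 2) ha.
have s1 : 1 < s by apply: leq_trans hs0; rewrite addn2.
exists s, (C * s ^ 2 + 1); split=> //; first by apply: leq_trans hs0; rewrite leq_addr.
move=> V E leV dE.
have V0 : 0 < #|V| by apply: leq_trans leV; rewrite addn1.
have bp (i j : 'I_s) : i != j -> C * s ^ 2 * #|bad_pair E i j| <= 2 * #|V| ^ s.
  move=> nij; apply: (card_bad_pair s1 a0 k0 nij dE V0).
    by apply: leq_trans leV; rewrite leq_addr.
  apply: leq_trans hs; rewrite leq_mul2r; apply/orP; right.
  by rewrite [X in _ <= X]mulnAC.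
have s2 : 0 < s ^ 2 by rewrite expn_gt0 (ltnW s1).
rewrite -(leq_pmul2l s2) mulnA [s ^ 2 * C]mulnC.
apply: leq_trans (_ : C * s ^ 2 * \sum_(p : 'I_s * 'I_s | p.1 != p.2) #|bad_pair E p.1 p.2| <= _).
  by rewrite leq_mul2l card_bigcup_le orbT.
rewrite big_distrr /=; apply: leq_trans (_ : \sum_(p : 'I_s * 'I_s) 2 * #|V| ^ s <= _).
  rewrite big_mkcond /=; apply: leq_sum => p _; case: ifP => // h; exact: bp.
by rewrite sum_nat_const card_prod card_ord.
Qed.

(** * Connecting paths *)

(** Distinctness is kept apart, because walks through the indices of a sample may repeat them. *)
Fixpoint sq (T : eqType) (E : T -> T -> T -> bool) (s : seq T) : bool :=
  if s is a :: s' then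
    (if s' is b :: c :: d :: _ then [&& E a b c, E a b d, E a c d & E b c d] else true) && sq E s'
  else true.

(** A window lying in neither piece would contain the three shared entries and one more on either
    side, but windows have only four entries. *)
Lemma sq_cat (T : eqType) (E : T -> T -> T -> bool) s a b c t :
  sq E (s ++ [:: a; b; c]) -> sq E ([:: a; b; c] ++ t) -> sq E (s ++ [:: a; b; c] ++ t).
Proof.
elim: s => [//|x s IH] /= /andP[h1 h2] h3; rewrite IH // andbT.
by case: s h1 {IH h2} => [|y [|z [|w s]]].
Qed.

Lemma path_sq (T : finType) (E : T -> T -> T -> bool) a b c p :
  path (tstep E) (a, b, c) p -> sq E ([:: a; b; c] ++ [seq q.2 | q <- p]).
Proof.
elim: p a b c => [//|[[b' c'] d] p IH] a b c /= /andP[/and3P[/= /eqP -> /eqP -> K] hp].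
by rewrite -/(k4 E a b c d) K; apply: (IH b c d).
Qed.

Lemma path_last3 (T : finType) (E : T -> T -> T -> bool) a b c p a' b' c' :
  path (tstep E) (a, b, c) p -> last (a, b, c) p = (a', b', c') ->
  exists u, [:: a; b; c] ++ [seq q.2 | q <- p] = u ++ [:: a'; b'; c'].
Proof.
elim: p a b c => [|[[b1 c1] d] p IH] a b c /=.
  by move=> _ [-> -> ->]; exists [::].
move=> /andP[/and3P[/= /eqP -> /eqP -> _] hp] hl.
have [u hu] := IH _ _ _ hp hl; exists (a :: u) => /=.
by rewrite -hu.
Qed.

Section Lift.

Variables (I V : finType) (U : I -> {set V}) (x0 : V) (m : nat).
Hypothesis cU : forall i, #|U i| = m.
Hypothesis dU : forall i j, i != j -> [disjoint U i & U j].

(* Each index is replaced by a vertex of its class that depends on the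
   position, so that repeated indices give distinct vertices. *)
Fixpoint lift j (w : seq I) : seq V :=
  if w is i :: w' then nth x0 (enum (U i)) j :: lift j.+1 w' else [::].

Lemma size_lift j w : size (lift j w) = size w.
Proof. by elim: w j => //= i w IH j; rewrite IH. Qed.

Lemma lift_cat j w w' : lift j (w ++ w') = lift j w ++ lift (j + size w) w'.
Proof. by elim: w j => [j|i w IH j] /=; rewrite ?addn0 // IH addSnnS. Qed.

Lemma nth_in j i : j < m -> nth x0 (enum (U i)) j \in U i.
Proof. by move=> h; rewrite -mem_enum mem_nth // -cardE cU. Qed.

Lemma mem_lift j w v : v \in lift j w -> exists i j',
  [/\ j <= j', j' < j + size w & v = nth x0 (enum (U i)) j'].
Proof.
elim: w j => [//|i w IH] j; rewrite /= inE => /orP[/eqP ->|/IH [i' [j' [h1 h2 ->]]]].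
  by exists i, j; split => //; lia.
by exists i', j'; split => //; lia.
Qed.

Lemma lift_uniq j w : j + size w <= m -> uniq (lift j w).
Proof.
elim: w j => [//|i w IH] j /= h; rewrite IH ?andbT; last lia.
apply/negP => /mem_lift [i' [j' [h1 h2 e]]].
have jm : j < m by lia.
have j'm : j' < m by lia.
have [eii|nii] := eqVneq i i'.
  move/eqP: e; rewrite -eii nth_uniq ?enum_uniq -?cardE ?cU //.
  by rewrite ltn_eqF.
have := disjointFr (dU nii) (nth_in i jm).
by rewrite e nth_in.
Qed.

Lemma mem_lift_class j w v : j + size w <= m -> v \in lift j w -> exists i, v \in U i.
Proof.
move=> h /mem_lift [i [j' [h1 h2 ->]]]; exists i; apply: nth_in.
exact: leq_trans h2 h.
Qed.

Lemma lift_sq (E0 : I -> I -> I -> bool) (E : V -> V -> V -> bool) j w :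
  (forall i1 i2 i3 i4 x1 x2 x3 x4, k4 E0 i1 i2 i3 i4 ->
    x1 \in U i1 -> x2 \in U i2 -> x3 \in U i3 -> x4 \in U i4 -> k4 E x1 x2 x3 x4) ->
  j + size w <= m -> sq E0 w -> sq E (lift j w).
Proof.
move=> hE; elim: w j => [//|i1 w IH] j h /= /andP[h1 h2]; rewrite IH //; last by move: h => /=; lia.
rewrite andbT; case: w h h1 {IH h2} => [|i2 [|i3 [|i4 w]]] //= h K.
by apply: (hE i1 i2 i3 i4) => //; apply: nth_in; lia.
Qed.

End Lift.

Section Fibres.
Variables (S R : finType) (F : {set S}) (h : S -> R).
Lemma sum_fibres : \sum_(y : R) #|[set f in F | h f == y]| = #|F|.
Proof.
rewrite -[RHS]sum1_card (partition_big h xpredT) //=; apply: eq_bigr => y _.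
by rewrite -sum1_card; apply: eq_bigl => f; rewrite inE.
Qed.
End Fibres.

Section Dense.
Variables (V : finType) (E : V -> V -> V -> bool) (k : nat).
Hypotheses (tE : is_tgraph E) (k0 : 0 < k) (dE : dense E k) (V0 : 0 < #|V|).

(** The bound is the largest mu with 9 mu < 2 |V|, as the colouring argument demands; the surplus in
    [dense] provides the strictness. *)
Lemma dense_mu x y : x != y -> #|nonnbr E x y| <= (2 * #|V| - 1) %/ 9.
Proof.
move=> /dE h; rewrite leq_divRL //; move: h k0 V0.
move: #|V| #|nonnbr E x y| => n M; clear; nia.
Qed.

Lemma dense_common x y z : E x y z -> #|V| <= 3 * #|[set v | k4 E x y z v]|.
Proof.
move=> e; have mu_small : 9 * ((2 * #|V| - 1) %/ 9) < 2 * #|V| by move: V0; clear; lia.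
by have := card_common_nbr tE dense_mu mu_small e; rewrite -/(common_nbr E x y z); lia.
Qed.

Lemma card_hits (I : finType) (i : I) (W : {set V}) :
  #|V| * #|[set f : {ffun I -> V} | f i \in W]| = #|V| ^ #|I| * #|W|.
Proof.
rewrite -(sum_resample i (fun f => f i \in W)).
rewrite (eq_bigr (fun=> #|W|)) ?sum_nat_const ?card_ffun // => f _.
by apply: eq_card => x; rewrite inE upd_same.
Qed.

Section Ends.
Variables (t : nat) (a b c a' b' c' : V).
Hypotheses (e : E a b c) (e' : E a' b' c').

Let o0 := @Ordinal t.+4.+2 0 isT.
Let o1 := @Ordinal t.+4.+2 1 isT.
Let o2 := @Ordinal t.+4.+2 2 isT.
Let o3 := @Ordinal t.+4.+2 3 isT.
Let o4 := @Ordinal t.+4.+2 4 isT.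
Let o5 := @Ordinal t.+4.+2 5 isT.

Definition ends_ok (f : {ffun 'I_t.+4.+2 -> V}) :=
  [&& k4 E a b c (f o0), k4 E b c (f o0) (f o1) & k4 E c (f o0) (f o1) (f o2)] &&
  [&& k4 E (f o5) a' b' c', k4 E (f o4) (f o5) a' b' & k4 E (f o3) (f o4) (f o5) a'].

(** 729 = 3 ^ 6: six vertices are chosen in turn, forwards from [a b c] and then backwards from
    [a' b' c']. Each completes an edge to a K4 and so has at least |V| / 3 choices. *)
Lemma card_ends_ok : #|V| ^ t.+4.+2 <= 729 * #|[set f | ends_ok f]|.
Proof.
pose P1 (f : {ffun 'I_t.+4.+2 -> V}) := true && k4 E a b c (f o0).
pose P2 f := P1 f && k4 E b c (f o0) (f o1).
pose P3 f := P2 f && k4 E c (f o0) (f o1) (f o2).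
pose P4 f := P3 f && k4 E (f o5) a' b' c'.
pose P5 f := P4 f && k4 E (f o4) (f o5) a' b'.
pose P6 f := P5 f && k4 E (f o3) (f o4) (f o5) a'.
have cc (g : V -> bool) x y z : (forall v, g v = k4 E x y z v) -> E x y z -> #|V| <= 3 * #|[set v | g v]|.
  move=> hg exy; rewrite (eq_card (B := [set v | k4 E x y z v])); last by move=> v; rewrite !inE.
  exact: dense_common.
have h0 : #|[set f : {ffun 'I_t.+4.+2 -> V} | true]| = #|V| ^ t.+4.+2.
  by rewrite -[in RHS](card_ord t.+4.+2) -card_ffun; apply: eq_card => f; rewrite !inE.
have h1 : #|[set f : {ffun 'I_t.+4.+2 -> V} | true]| <= 3 * #|[set f | P1 f]|.
  apply: (@resample_lb _ _ o0 xpredT (fun f => k4 E a b c (f o0))) => // f _.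
  by apply: (cc _ a b c) => // v; rewrite upd_same.
have h2 : #|[set f | P1 f]| <= 3 * #|[set f | P2 f]|.
  apply: (@resample_lb _ _ o1 P1 (fun f => k4 E b c (f o0) (f o1))) => // [f x|f].
    by rewrite /P1 !ffunE.
  move=> /andP[_ /and4P[_ _ _ ?]]; apply: (cc _ b c (f o0)) => // v; by rewrite !ffunE.
have h3 : #|[set f | P2 f]| <= 3 * #|[set f | P3 f]|.
  apply: (@resample_lb _ _ o2 P2 (fun f => k4 E c (f o0) (f o1) (f o2))) => // [f x|f].
    by rewrite /P2 /P1 !ffunE.
  move=> /andP[_ /and4P[_ _ _ ?]]; apply: (cc _ c (f o0) (f o1)) => // v; by rewrite !ffunE.
have h4 : #|[set f | P3 f]| <= 3 * #|[set f | P4 f]|.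
  apply: (@resample_lb _ _ o5 P3 (fun f => k4 E (f o5) a' b' c')) => // [f x|f].
    by rewrite /P3 /P2 /P1 !ffunE.
  by move=> _; apply: (cc _ a' b' c') => // v; rewrite !ffunE /= k4_rot.
have h5 : #|[set f | P4 f]| <= 3 * #|[set f | P5 f]|.
  apply: (@resample_lb _ _ o4 P4 (fun f => k4 E (f o4) (f o5) a' b')) => // [f x|f].
    by rewrite /P4 /P3 /P2 /P1 !ffunE.
  move=> /andP[_ /and4P[? _ _ _]].
  by apply: (cc _ (f o5) a' b') => // v; rewrite !ffunE /= k4_rot.
have h6 : #|[set f | P5 f]| <= 3 * #|[set f | P6 f]|.
  apply: (@resample_lb _ _ o3 P5 (fun f => k4 E (f o3) (f o4) (f o5) a')) => // [f x|f].
    by rewrite /P5 /P4 /P3 /P2 /P1 !ffunE.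
  move=> /andP[_ /and4P[? _ _ _]].
  by apply: (cc _ (f o4) (f o5) a') => // v; rewrite !ffunE /= k4_rot.
have h7 : #|[set f | P6 f]| = #|[set f | ends_ok f]|.
  apply: eq_card => f; rewrite !inE /P6 /P5 /P4 /P3 /P2 /P1 /ends_ok /=.
  by rewrite -!andbA.
by rewrite -h0 -h7; move: h1 h2 h3 h4 h5 h6; clear; lia.
Qed.

End Ends.
End Dense.

Lemma induced_tgraph (V : finType) (E : V -> V -> V -> bool) s (f : {ffun 'I_s -> V}) :
  is_tgraph E -> is_tgraph (induced E f).
Proof.
by case=> h1 h2 h3; split=> *; [apply: h1 | apply: h2 | apply: h3].
Qed.

Lemma good_sampleP (V : finType) (E : V -> V -> V -> bool) s (f : {ffun 'I_s -> V}) :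
  1 < s -> f \notin sample_bad E s ->
  (forall i j, i != j -> #|nonnbr (induced E f) i j| <= (2 * s - 1) %/ 9) /\
  9 * ((2 * s - 1) %/ 9) < 2 * #|'I_s|.
Proof.
move=> s1 fb; split; last by rewrite card_ord; lia.
move=> i j nij; rewrite leq_divRL //.
have : f \notin bad_pair E i j.
  by apply: contra fb => h; apply/bigcupP; exists (i, j).
rewrite inE -ltnNge; move: (#|_|) => x; clear -s1; lia.
Qed.

(** Two indices with the same vertex have only non-neighbours, since [E x x z] is false; such a pair
    is bad. *)
Lemma induced_inj (V : finType) (E : V -> V -> V -> bool) s (f : {ffun 'I_s -> V}) :
  is_tgraph E -> 1 < s -> f \notin sample_bad E s -> injective f.
Proof.
move=> tE s1 fb i j eij; apply/eqP/negPn/negP => nij.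
have [/(_ i j nij) h _] := good_sampleP s1 fb.
have e : #|nonnbr (induced E f) i j| = s.
  rewrite -[RHS]card_ord; apply: eq_card => l; rewrite !inE /induced eij.
  by case: tE => _ _ ->.
by move: h; rewrite e leq_divRL //; move: s1; clear; lia.
Qed.

(* Sample ordered s-tuples whose first and last three vertices continue the ends,
   which have few non-neighbours and avoid W; by pigeonhole many of them induce the
   same 3-graph on the indices, and [kst] gives a blow-up of it. A walk between the
   two end triples of indices then lifts to a path. *)
Theorem connecting k : 0 < k -> exists ell B n0, 0 < B /\
  forall (V : finType) (E : V -> V -> V -> bool), is_tgraph E -> dense E k -> n0 <= #|V| ->
  forall (a b c a' b' c' : V), E a b c -> E a' b' c' ->
  forall W : {set V}, B * #|W| <= #|V| ->
  exists x : seq V, [/\ size x <= ell, uniq x,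
    forall v, v \in x -> v \notin W :|: [set v | v \in [:: a; b; c; a'; b'; c']] &
    sq E ([:: a; b; c] ++ x ++ [:: a'; b'; c'])].
Proof.
(* A proportion 1 / 729 of all tuples has suitable ends. Bad samples and tuples meeting the
   forbidden set may each take a quarter of it, which leaves the proportion 1 / 1458 used below. *)
move=> k0; have [s [n1 [s6 s1 samp]]] := sampling (8 * 729) 6 k0.
have [t et] : exists t, s = t.+4.+2 by exists (s - 6); lia.
subst s; set s := t.+4.+2 in s6 s1 samp.
pose R : finType := {ffun 'I_s * 'I_s * 'I_s -> bool}.
(* A walk without repetition visits at most s ^ 3 triples, so its index sequence is short enough for
   [lift] to give every entry a position of its own. *)
pose m := s * s * s + 3.
have N0 : 0 < #|R| by apply/card_gt0P; exists [ffun=> true].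
have m0 : 0 < m by rewrite /m addn3.
have [|M hM] := @kst 'I_s m (1458 * #|R|) m0; first by rewrite muln_gt0.
exists m, (729 * 8 * s), (n1 + M + 729 * 48 * s + 1); split; first by rewrite /s; lia.
move=> V E tE dE leV a b c a' b' c' e e' W hW.
have V0 : 0 < #|V| by move: leV; clear; lia.
have hsamp := samp V E (leq_trans (leq_trans (leq_addr _ _) (leq_addr _ _)) (leq_trans (leq_addr _ _) leV)) dE.
pose W' := W :|: [set v | v \in [:: a; b; c; a'; b'; c']].
have cW' : 729 * 4 * s * #|W'| <= #|V|.
  have h6 : #|[set v | v \in [:: a; b; c; a'; b'; c']]| <= 6.
    by rewrite (eq_card (B := mem [:: a; b; c; a'; b'; c'])) ?card_size // => v; rewrite inE.
  have := (leq_card_setU W [set v | v \in [:: a; b; c; a'; b'; c']]).1; rewrite -/W'.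
  move: h6 leV hW; move: #|W'| #|W| #|V| #|[set v | _]| => w' w n z h6 leV hW h.
  have : 729 * 4 * s * w' <= 729 * 4 * s * (w + 6) by rewrite leq_mul2l; apply/orP; right; lia.
  by move: hW leV; clear; lia.
pose F0 : {set {ffun 'I_s -> V}} := [set f | @ends_ok V E t a b c a' b' c' f].
have cF0 : #|V| ^ s <= 729 * #|F0| by apply: (card_ends_ok tE k0 dE V0).
pose hits : {set {ffun 'I_s -> V}} := \bigcup_(i : 'I_s) [set f : {ffun 'I_s -> V} | f i \in W'].
have chits : 729 * 4 * #|hits| <= #|V| ^ s.
  have hi (i : 'I_s) : 729 * 4 * s * #|[set f : {ffun 'I_s -> V} | f i \in W']| <= #|V| ^ s.
    rewrite -(leq_pmul2l V0) mulnCA card_hits card_ord mulnCA [X in _ <= X]mulnC.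
    by rewrite leq_mul2l cW' orbT.
  rewrite -(leq_pmul2l (_ : 0 < s)) // mulnA [s * _]mulnC.
  apply: leq_trans (_ : 729 * 4 * s * \sum_(i : 'I_s) #|[set f : {ffun 'I_s -> V} | f i \in W']| <= _).
    by rewrite leq_mul2l card_bigcup_le orbT.
  rewrite big_distrr /=; apply: leq_trans (_ : \sum_(i : 'I_s) #|V| ^ s <= _).
    by apply: leq_sum => i _; apply: hi.
  by rewrite sum_nat_const card_ord.
pose F : {set {ffun 'I_s -> V}} := F0 :\: (sample_bad E s :|: hits).
have cF : #|V| ^ s <= 1458 * #|F|.
  have ar n f0 f i u x y : n <= 729 * f0 -> 8 * 729 * x <= 2 * n -> 729 * 4 * y <= n ->
    i <= u -> u <= x + y -> f = f0 - i -> n <= 1458 * f by clear; lia.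
  exact: ar cF0 hsamp chits (subset_leq_card (subsetIr F0 (sample_bad E s :|: hits)))
    (leq_card_setU (sample_bad E s) hits).1 (cardsD F0 (sample_bad E s :|: hits)).
pose h (f : {ffun 'I_s -> V}) : R := [ffun q => induced E f q.1.1 q.1.2 q.2].
have Rne : [set: R] != set0 by rewrite -card_gt0 cardsT.
have [E1 _ hE1] := max_ge_avg (fun y => #|[set f in F | h f == y]|) Rne.
move: hE1; rewrite (eq_bigl xpredT) => [|y]; last by rewrite inE.
rewrite sum_fibres cardsT => hF; set F1 := [set f in F | h f == E1] in hF.
have dF1 : #|V| ^ #|'I_s| <= 1458 * #|R| * #|F1|.
  rewrite card_ord; apply: leq_trans cF _; rewrite -mulnA leq_mul2l hF orbT //.
have MV : M <= #|V| by move: leV; clear; lia.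
have [U [cU hU]] := hM V F1 MV V0 dF1.
have F1P f : f \in F1 -> [/\ @ends_ok V E t a b c a' b' c' f, f \notin sample_bad E s,
    forall i, f i \notin W' & h f = E1].
  rewrite inE => /andP[/setDP[]]; rewrite inE => h1 h2 /eqP h3; split=> //.
    by apply: contra h2 => h4; rewrite inE h4.
  by move=> i; apply: contra h2 => h4; rewrite inE; apply/orP; right; apply/bigcupP; exists i => //; rewrite inE.
have F1E f g i1 i2 i3 : f \in F1 -> g \in F1 -> induced E f i1 i2 i3 = induced E g i1 i2 i3.
  move=> /F1P[_ _ _ hf] /F1P[_ _ _ hg].
  by have := congr1 (fun q : R => q (i1, i2, i3)) (etrans hf (esym hg)); rewrite !ffunE.
have [f0 f0F] : exists f, f \in F1.
  apply/set0Pn; rewrite -card_gt0 lt0n; apply/eqP => z.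
  by move: dF1; rewrite z muln0 leqn0 expn_eq0 => /andP[/eqP z0]; rewrite z0 in V0.
have [ok0 nb0 nw0 _] := F1P f0 f0F.
(* Default members of the classes complete a partial choice to a full tuple, which then belongs to
   [F1]. *)
have dflt i : exists x, x \in U i by apply/set0Pn; rewrite -card_gt0 cU.
pose u0 i := xchoose (dflt i).
have u0P i : u0 i \in U i by apply: (xchooseP (dflt i)).
have pick2 i j x y : i != j -> x \in U i -> y \in U j ->
    exists2 f, f \in F1 & f i = x /\ f j = y.
  move=> nij hx hy; exists [ffun l => if l == i then x else if l == j then y else u0 l].
    by apply: hU => l; rewrite ffunE; case: eqP => [->//|_]; case: eqP => [->//|_].
  by rewrite !ffunE eqxx eq_sym (negPf nij) eqxx.
have pick1 i x : x \in U i -> exists2 f, f \in F1 & f i = x.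
  move=> hx; exists [ffun l => if l == i then x else u0 l]; last by rewrite ffunE eqxx.
  by apply: hU => l; rewrite ffunE; case: eqP => [->//|_].
(* A vertex common to two classes would give a tuple in [F1] that is not injective. *)
have dU i j : i != j -> [disjoint U i & U j].
  move=> nij; rewrite -setI_eq0; apply/eqP/setP => x; rewrite in_setI in_set0.
  apply/negP => /andP[h1 h2]; have [f fF [f1 f2]] := pick2 i j x x nij h1 h2.
  have [_ nb _ _] := F1P f fF.
  by move/eqP: nij; apply; apply: (induced_inj tE s1 nb); rewrite f1 f2.
pose E0 := induced E f0.
have tE0 : is_tgraph E0 by apply: induced_tgraph.
have lift_k4 i1 i2 i3 i4 x1 x2 x3 x4 : k4 E0 i1 i2 i3 i4 ->
    x1 \in U i1 -> x2 \in U i2 -> x3 \in U i3 -> x4 \in U i4 -> k4 E x1 x2 x3 x4.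
  move=> K y1 y2 y3 y4; have /and4P[K1 K2 K3 K4] := K.
  have [n12 n13 n23] := edge_neq tE0 K1; have [_ n14 n24] := edge_neq tE0 K2.
  have [_ _ n34] := edge_neq tE0 K3.
  pose f : {ffun 'I_s -> V} := [ffun l => if l == i1 then x1 else if l == i2 then x2 else
    if l == i3 then x3 else if l == i4 then x4 else u0 l].
  have fF : f \in F1.
    apply: hU => l; rewrite ffunE; case: eqP => [->//|_]; case: eqP => [->//|_].
    by case: eqP => [->//|_]; case: eqP => [->//|_].
  have e1 : f i1 = x1 by rewrite ffunE eqxx.
  have e2 : f i2 = x2 by rewrite ffunE eq_sym (negPf n12) eqxx.
  have e3 : f i3 = x3 by rewrite ffunE ![i3 == _]eq_sym (negPf n13) (negPf n23) eqxx.
  have e4 : f i4 = x4.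
    by rewrite ffunE ![i4 == _]eq_sym (negPf n14) (negPf n24) (negPf n34) eqxx.
  by move: K; rewrite /k4 /E0 !(F1E f0 f) // /induced e1 e2 e3 e4.
pose o0 := @Ordinal s 0 isT; pose o1 := @Ordinal s 1 isT; pose o2 := @Ordinal s 2 isT.
pose o3 := @Ordinal s 3 isT; pose o4 := @Ordinal s 4 isT; pose o5 := @Ordinal s 5 isT.
have [mu_ok mu_small] := good_sampleP s1 nb0.
have e012 : E0 o0 o1 o2.
  by move: ok0 => /andP[/and3P[_ _ /and4P[_ _ _ ?]] _].
have e345 : E0 o3 o4 o5.
  by move: ok0 => /andP[_ /and3P[_ _ /and4P[? _ _ _]]].
have /connectP[p0 hp0 lp0] := triples_connected tE0 mu_ok mu_small e012 e345.
have [p [hp lp sp]] : exists p, [/\ path (tstep E0) (o0, o1, o2) p,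
    last (o0, o1, o2) p = (o3, o4, o5) & size p < s * s * s].
  case/shortenP: hp0 lp0 => p hp up _ lp; exists p; split=> //.
  have := max_card (mem ((o0, o1, o2) :: p)); rewrite (card_uniqP up) /= !card_prod !card_ord //.
have [u hu] := path_last3 hp lp.
pose w := [:: o0; o1; o2] ++ [seq q.2 | q <- p].
have sw : size w <= m by rewrite /w size_cat size_map addnC leq_add2r ltnW.
have sqw := path_sq hp; rewrite -/w in sqw.
pose x := lift U a 0 w.
have sqx : sq E x by apply: (lift_sq a cU lift_k4 _ sqw).
have ux : uniq x by apply: (lift_uniq a cU dU).
exists x; split=> //; first by rewrite size_lift.
  move=> v hv; have [i /pick1[f /F1P[_ _ nw _] <-]] := @mem_lift_class _ _ U a m cU 0 w v sw hv; exact: nw.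
have mU j i : j < m -> nth a (enum (U i)) j \in U i by apply: nth_in.
pose l3 := size u.
have su : l3 + 3 = size w by rewrite /w hu size_cat.
have ex : x = lift U a 0 u ++ lift U a l3 [:: o3; o4; o5] by rewrite /x /w hu lift_cat.
have hends (x0 x1 x2 x3 x4 x5 : V) : x0 \in U o0 -> x1 \in U o1 -> x2 \in U o2 ->
    x3 \in U o3 -> x4 \in U o4 -> x5 \in U o5 ->
  [&& k4 E a b c x0, k4 E b c x0 x1 & k4 E c x0 x1 x2] &&
  [&& k4 E x5 a' b' c', k4 E x4 x5 a' b' & k4 E x3 x4 x5 a'].
  move=> y0 y1 y2 y3 y4 y5.
  pose g l := if l == o0 then x0 else if l == o1 then x1 else if l == o2 then x2 else
    if l == o3 then x3 else if l == o4 then x4 else if l == o5 then x5 else u0 l.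
  have fF : [ffun l => g l] \in F1.
    apply: hU => l; rewrite ffunE /g; case: eqP => [->//|_]; case: eqP => [->//|_].
    case: eqP => [->//|_]; case: eqP => [->//|_]; case: eqP => [->//|_].
    by case: eqP => [->//|_].
  by have [+ _ _ _] := F1P _ fF; rewrite /ends_ok !ffunE.
have m6 : 5 < m by rewrite /m /s; clear; lia.
have m_0 : 0 < m by apply: leq_trans m6.
have m_1 : 1 < m by apply: leq_trans m6.
have m_2 : 2 < m by apply: leq_trans m6.
have m_5 : l3.+2 < m by apply: leq_trans sw; rewrite -su addn3.
have m_4 : l3.+1 < m by apply: ltnW.
have m_3 : l3 < m by apply: ltnW.
set x3 := nth a (enum (U o3)) l3; set x4 := nth a (enum (U o4)) l3.+1.
set x5 := nth a (enum (U o5)) l3.+2.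
have /andP[/and3P[k1 k2 k3] /and3P[k4' k5 k6]] := hends _ _ _ x3 x4 x5
  (mU 0 o0 m_0) (mU 1 o1 m_1) (mU 2 o2 m_2)
  (mU _ _ m_3) (mU _ _ m_4) (mU _ _ m_5).
have ex' : x = lift U a 0 u ++ [:: x3; x4; x5] by rewrite ex.
rewrite [x]ex' -!catA; apply: (@sq_cat _ E ([:: a; b; c] ++ lift U a 0 u)); last first.
  by rewrite /= -/(k4 E _ _ _ _) k6 -/(k4 E _ _ _ _) k5 -/(k4 E _ _ _ _) k4'.
rewrite -catA -ex' /x /w /=.
by rewrite -/(k4 E _ _ _ _) k1 -/(k4 E _ _ _ _) k2 -/(k4 E _ _ _ _) k3; apply: sqx.
Qed.

Lemma subset_of_card (T : finType) (D : {set T}) M : M <= #|D| ->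
  exists2 D0 : {set T}, D0 \subset D & #|D0| = M.
Proof. by move=> /(subset_ge_avg (fun=> 0))[D0 [? ? _]]; exists D0. Qed.

(** * Complete partite patterns inside prescribed sets *)

Fixpoint prods (V : finType) (Ds : seq {set V}) : seq (seq V) :=
  if Ds is D :: Ds' then [seq x :: w | x <- enum D, w <- prods Ds'] else [:: [::]].

Lemma size_prods (V : finType) (D : {set V}) Ds :
  size (prods (D :: Ds)) = #|D| * size (prods Ds).
Proof. by rewrite /= size_allpairs -cardE. Qed.

Lemma count_prods (V : finType) (D : {set V}) Ds F :
  count F (prods (D :: Ds)) = \sum_(x in D) count (fun w => F (x :: w)) (prods Ds).
Proof.
rewrite /= -big_enum /=; elim: (enum D) => [|x s IH] /=; first by rewrite big_nil.
by rewrite big_cons count_cat IH count_map.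
Qed.

Lemma mem_prods_cons (V : finType) (D : {set V}) Ds x w :
  x \in D -> w \in prods Ds -> x :: w \in prods (D :: Ds).
Proof. by move=> hx hw; apply/allpairsP; exists (x, w); rewrite mem_enum. Qed.

Lemma mem_prodsP (V : finType) (D : {set V}) Ds w : w \in prods (D :: Ds) ->
  exists x w', [/\ x \in D, w' \in prods Ds & w = x :: w'].
Proof.
by move=> /allpairsP [[x w'] [hx hw ->]]; exists x, w'; split; rewrite // -mem_enum.
Qed.

Lemma mem_prods1 (V : finType) (D : {set V}) x : x \in D -> [:: x] \in prods [:: D].
Proof. by move=> hx; apply: mem_prods_cons => //; apply: mem_head. Qed.

Lemma prods_dense (V : finType) (D : {set V}) Ds F K :
  (forall x, x \in D -> size (prods Ds) <= K * count (fun w => F (x :: w)) (prods Ds)) ->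
  size (prods (D :: Ds)) <= K * count F (prods (D :: Ds)).
Proof.
move=> h; rewrite size_prods count_prods big_distrr /= -sum_nat_const.
by apply: leq_sum.
Qed.

Lemma prods_dense1 (V : finType) (D : {set V}) F K :
  #|D| <= K * #|[set x in D | F [:: x]]| ->
  size (prods [:: D]) <= K * count F (prods [:: D]).
Proof.
move=> h; rewrite size_prods count_prods /= muln1; apply: leq_trans h _.
rewrite leq_mul2l; apply/orP; right; rewrite -sum1_card.
rewrite (eq_bigl (fun x => (x \in D) && F [:: x])) => [|x]; last by rewrite inE.
rewrite big_mkcondr /=; apply: leq_sum => x _; by case: (F _).
Qed.

(** The parts may differ in size, so density is measured within their product; the list of tuples
    over the remaining parts plays the part of [W] in [bipartite_pigeonhole]. *)
Lemma kst_list r m K : 0 < m -> 0 < K -> exists M, forall (V : finType) (Ds : seq {set V}),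
  size Ds = r -> all (fun D : {set V} => M <= #|D|) Ds ->
  forall F : seq V -> bool, size (prods Ds) <= K * count F (prods Ds) ->
  exists Us : seq {set V},
    all2 (fun U D : {set V} => (U \subset D) && (#|U| == m)) Us Ds /\
    forall w, w \in prods Us -> F w.
Proof.
move=> m0; elim: r K => [|r IH] K K0.
  exists 0 => V [] // _ _ F /=; rewrite addn0 => h; exists [::]; split=> // w.
  by rewrite inE => /eqP ->; move: h; case: (F [::]) => //; rewrite muln0.
have [|M hM] := IH (2 * K * 2 ^ (2 * K * m)).
  by rewrite !muln_gt0 K0 expn_gt0.
exists (M + 2 * K * m) => V [//|D Ds] /= [sD] /andP[cD aD] F.
rewrite -[[seq _ | _ <- _, _ <- _]]/(prods (D :: Ds)) size_prods count_prods => dens.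
have [|S [SD cS dS]] := bipartite_pigeonhole m0 K0 _ dens.
  by apply: leq_trans cD; apply: leq_addl.
have aD' : all (fun D : {set V} => M <= #|D|) Ds.
  by apply: sub_all aD => D'; apply: leq_trans; apply: leq_addr.
have [Us [hU1 hU2]] := hM V Ds sD aD' _ dS.
exists (S :: Us); split=> /=; first by rewrite SD cS eqxx.
move=> w /allpairsP [[x w'] /= [xS hw' ->]]; rewrite mem_enum in xS.
by have /forall_inP/(_ x xS) := hU2 w' hw'.
Qed.

Lemma kst2 m K : 0 < m -> 0 < K -> exists M, forall (V : finType) (X Y : {set V}),
  M <= #|X| -> M <= #|Y| -> forall F : V -> V -> bool,
  size (prods [:: X; Y]) <= K * count (fun w => if w is [:: x; y] then F x y else false) (prods [:: X; Y]) ->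
  exists X' Y' : {set V}, [/\ X' \subset X /\ #|X'| = m, Y' \subset Y /\ #|Y'| = m &
    forall x y, x \in X' -> y \in Y' -> F x y].
Proof.
move=> m0 K0; have [M hM] := kst_list 2 m0 K0; exists M => V X Y hX hY F dens.
have [|Us [h1 h2]] := hM V [:: X; Y] erefl _ _ dens; first by rewrite /= hX hY.
case: Us h1 h2 => [//|X' [|Y' [|]]] //=; rewrite ?andbF // andbT => /andP[/andP[s1 /eqP c1] /andP[s2 /eqP c2]] h.
exists X', Y'; split=> // x y hx hy.
exact: (h [:: x; y] (mem_prods_cons hx (mem_prods1 hy))).
Qed.

Lemma kst3_gen m K : 0 < m -> 0 < K -> exists M, forall (V : finType) (X Y Z : {set V}),
  M <= #|X| -> M <= #|Y| -> M <= #|Z| -> forall F : V -> V -> V -> bool,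
  size (prods [:: X; Y; Z]) <=
    K * count (fun w => if w is [:: x; y; z] then F x y z else false) (prods [:: X; Y; Z]) ->
  exists X' Y' Z' : {set V}, [/\ X' \subset X /\ #|X'| = m, Y' \subset Y /\ #|Y'| = m,
    Z' \subset Z /\ #|Z'| = m & forall x y z, x \in X' -> y \in Y' -> z \in Z' -> F x y z].
Proof.
move=> m0 K0; have [M hM] := kst_list 3 m0 K0; exists M => V X Y Z hX hY hZ F dens.
have [|Us [h1 h2]] := hM V [:: X; Y; Z] erefl _ _ dens; first by rewrite /= hX hY hZ.
case: Us h1 h2 => [//|X' [|Y' [|Z' [|]]]] //=; rewrite ?andbF // andbT.
move=> /and3P[/andP[s1 /eqP c1] /andP[s2 /eqP c2] /andP[s3 /eqP c3]] h.
exists X', Y', Z'; split=> // x y z hx hy hz.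
exact: (h [:: x; y; z] (mem_prods_cons hx (mem_prods_cons hy (mem_prods1 hz)))).
Qed.

Lemma kst3 m K : 0 < m -> 0 < K -> exists M, forall (V : finType) (X Y Z : {set V}),
  M <= #|X| -> M <= #|Y| -> M <= #|Z| -> forall F : V -> V -> V -> bool,
  (forall x y, x \in X -> y \in Y -> #|Z| <= K * #|[set z in Z | F x y z]|) ->
  exists X' Y' Z' : {set V}, [/\ X' \subset X /\ #|X'| = m, Y' \subset Y /\ #|Y'| = m,
    Z' \subset Z /\ #|Z'| = m & forall x y z, x \in X' -> y \in Y' -> z \in Z' -> F x y z].
Proof.
move=> m0 K0; have [M hM] := kst3_gen m0 K0; exists M => V X Y Z hX hY hZ F dens.
apply: hM => //; apply: prods_dense => x hx; apply: prods_dense => y hy.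
exact: prods_dense1 (dens x y hx hy).
Qed.

Lemma kst4 m K : 0 < m -> 0 < K -> exists M, forall (V : finType) (X Y A Z : {set V}),
  M <= #|X| -> M <= #|Y| -> M <= #|A| -> M <= #|Z| -> forall F : V -> V -> V -> V -> bool,
  (forall x y a, x \in X -> y \in Y -> a \in A -> #|Z| <= K * #|[set z in Z | F x y a z]|) ->
  exists X' Y' A' Z' : {set V}, [/\ X' \subset X /\ #|X'| = m, Y' \subset Y /\ #|Y'| = m,
    A' \subset A /\ #|A'| = m, Z' \subset Z /\ #|Z'| = m &
    forall x y a z, x \in X' -> y \in Y' -> a \in A' -> z \in Z' -> F x y a z].
Proof.
move=> m0 K0; have [M hM] := kst_list 4 m0 K0; exists M => V X Y A Z hX hY hA hZ F dens.
have [||Us [h1 h2]] := hM V [:: X; Y; A; Z] erefl _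
    (fun w => if w is [:: x; y; a; z] then F x y a z else false).
- by rewrite /= hX hY hA hZ.
- apply: prods_dense => x hx; apply: prods_dense => y hy; apply: prods_dense => a ha.
  exact: prods_dense1 (dens x y a hx hy ha).
case: Us h1 h2 => [//|X' [|Y' [|A' [|Z' [|]]]]] //=; rewrite ?andbF // andbT.
move=> /and4P[/andP[s1 /eqP c1] /andP[s2 /eqP c2] /andP[s3 /eqP c3] /andP[s4 /eqP c4]] h.
exists X', Y', A', Z'; split=> // x y a z hx hy ha hz.
exact: (h [:: x; y; a; z] (mem_prods_cons hx (mem_prods_cons hy (mem_prods_cons ha (mem_prods1 hz))))).
Qed.

(** This is how a single tile is found that serves a fixed proportion of all pairs or triples under
    consideration. *)
Lemma pigeonhole_seq (T : finType) (Y : eqType) (P : {set T}) (W : seq Y)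
    (good : T -> Y -> bool) K : P != set0 ->
  (forall w, w \in W -> #|P| <= K * #|[set t in P | good t w]|) ->
  exists2 t, t \in P & size W <= K * count (good t) W.
Proof.
move=> P0 h; have [t tP ht] := max_ge_avg (fun t => count (good t) W) P0.
exists t => //; rewrite -(leq_pmul2l (_ : 0 < #|P|)) ?card_gt0 //.
rewrite mulnCA; apply: leq_trans (_ : K * \sum_(t in P) count (good t) W <= _); last first.
  by rewrite leq_mul2l ht orbT.
rewrite sum_count big_distrr /= mulnC -sum1_size big_distrl /=.
rewrite !big_seq; apply: leq_sum => w hw; rewrite mul1n; exact: h.
Qed.

(** * Almost tilings *)

(* The four classes of a complete 4-partite 3-graph. *)
Definition tile (V : finType) : finType := ({set V} * {set V} * {set V} * {set V})%type.

Section Tiles.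

Variable V : finType.
Implicit Types (t : tile V) (P : {set tile V}) (Z S : {set V}).

Definition cls t : seq {set V} := let: (A, B, C, D) := t in [:: A; B; C; D].
Definition sup t : {set V} := let: (A, B, C, D) := t in A :|: B :|: C :|: D.
Definition cls_pairs t : seq ({set V} * {set V}) := let: (A, B, C, D) := t in
  [:: (A, B); (A, C); (A, D); (B, C); (B, D); (C, D)].
(** The size of the union encodes that the four classes are disjoint. Completeness is kept separate
    because the filler tiles lack it. *)
Definition tshape m t := all (fun C : {set V} => #|C| == m) (cls t) && (#|sup t| == 4 * m).
Definition complete (E : V -> V -> V -> bool) t : bool := let: (A, B, C, D) := t in
  [forall a in A, forall b in B, forall c in C, forall d in D, k4 E a b c d].
(* [mn t Z] vertices of each class of [t] avoid [Z], so [pot] measures what a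
   system of tiles can still cover once [Z] has been used elsewhere. *)
Definition mn t Z : nat := let: (A, B, C, D) := t in
  minn (minn #|A :\: Z| #|B :\: Z|) (minn #|C :\: Z| #|D :\: Z|).
Definition cov P : {set V} := \bigcup_(t in P) sup t.
Definition pot P Z := \sum_(t in P) mn t Z.
Definition tsys m P := (forall t, t \in P -> tshape m t) /\
  (forall t t', t \in P -> t' \in P -> t != t' -> [disjoint sup t & sup t']).

Lemma cls_sub t C : C \in cls t -> C \subset sup t.
Proof.
case: t => [[[A B] C'] D]; rewrite !inE => /or4P[] /eqP ->; apply/subsetP => x hx;
by rewrite !inE hx ?orbT.
Qed.

Lemma sup_cov P t : t \in P -> sup t \subset cov P.
Proof. by move=> h; apply: bigcup_sup. Qed.

Lemma covP P v : reflect (exists2 t, t \in P & v \in sup t) (v \in cov P).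
Proof. by apply: (iffP bigcupP) => -[t h1 h2]; exists t. Qed.

Lemma leq_mn q t Z : (q <= mn t Z) = all (fun C : {set V} => q <= #|C :\: Z|) (cls t).
Proof. by case: t => [[[A B] C] D] /=; rewrite !leq_min andbT -!andbA. Qed.

Lemma mn_cap t Z S u : (forall C, C \in cls t -> #|C :&: S| <= u) ->
  mn t Z <= mn t (Z :|: S) + u.
Proof.
move=> h; rewrite addnC -leq_subLR leq_mn; apply/allP => C hC.
have : mn t Z <= #|C :\: Z|.
  by have := leqnn (mn t Z); rewrite leq_mn => /allP/(_ C hC).
have sub : C :\: Z \subset (C :\: (Z :|: S)) :|: (C :&: S).
  by apply/subsetP => v; rewrite !inE; case: (v \in C); case: (v \in Z); case: (v \in S).
have := subset_leq_card sub; have := (leq_card_setU (C :\: (Z :|: S)) (C :&: S)).1.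
have := h C hC; clear; lia.
Qed.

Lemma mn_disj t Z S : [disjoint S & sup t] -> mn t Z <= mn t (Z :|: S).
Proof.
move=> d; rewrite -[X in _ <= X]addn0; apply: mn_cap => C /cls_sub sC.
rewrite leqn0 cards_eq0 setI_eq0 disjoint_sym.
exact: disjointWr sC d.
Qed.

(** [mn] is a minimum over the classes, so taking up to [u] vertices from every class of one tile
    costs [u] only once. *)
Lemma pot_cap P Z S u t0 : (forall t, t \in P -> t != t0 -> [disjoint S & sup t]) ->
  (forall C, C \in cls t0 -> #|C :&: S| <= u) -> pot P Z <= pot P (Z :|: S) + u.
Proof.
move=> hd hc.
have : pot P Z <= \sum_(t in P) (mn t (Z :|: S) + if t == t0 then u else 0).
  apply: leq_sum => t tP; case: eqP => [->|/eqP n]; first exact: mn_cap.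
  by rewrite addn0 mn_disj // hd.
rewrite big_split /= -/(pot P (Z :|: S)) => h; apply: leq_trans h _; rewrite leq_add2l.
rewrite -big_mkcondr /=.
case: (boolP (t0 \in P)) => h; last first.
  by rewrite big1 // => t /andP[tP /eqP e]; rewrite e (negPf h) in tP.
by rewrite (eq_bigl (pred1 t0)) ?big_pred1_eq // => t /=; case: eqP => [->|_]; rewrite ?h ?andbF.
Qed.

Lemma pot_disj P Z S : [disjoint S & cov P] -> pot P Z <= pot P (Z :|: S).
Proof.
move=> d; apply: leq_sum => t tP; apply: mn_disj.
exact: disjointWr (sup_cov tP) d.
Qed.

Lemma pot_mono P S S' : S \subset S' -> pot P S' <= pot P S.
Proof.
move=> sS; apply: leq_sum => t _; rewrite leq_mn; apply/allP => C hC.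
have : mn t S' <= #|C :\: S'|.
  by have := leqnn (mn t S'); rewrite leq_mn => /allP/(_ C hC).
by move=> h; apply: leq_trans h _; apply/subset_leq_card/setDS.
Qed.

Lemma sum_sup P N : #|N :&: cov P| <= \sum_(t in P) #|N :&: sup t|.
Proof.
have -> : N :&: cov P = \bigcup_(t in P) (N :&: sup t).
  by rewrite /cov big_distrr.
exact: card_bigcup_le.
Qed.

Lemma card_tsys m P : tsys m P -> 4 * m * #|P| = #|cov P|.
Proof.
case=> h1 h2; rewrite mulnC -sum_nat_const.
transitivity (\sum_(t in P) #|sup t|).
  by apply: eq_bigr => t /h1 /andP[_ /eqP].
under eq_bigr => t _ do rewrite -sum1_card.
rewrite -sum1_card (exchange_big_dep (mem (cov P))) /=; last first.
  by move=> t v tP; apply: (subsetP (sup_cov tP)).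
apply: eq_bigr => v /covP [t0 t0P hv].
rewrite (eq_bigl (pred1 t0)) ?big_pred1_eq // => t /=.
case: eqP => [->|/eqP n]; first by rewrite t0P hv.
by apply/negP => /andP[tP hv']; have := disjointFr (h2 t t0 tP t0P n) hv'; rewrite hv.
Qed.

End Tiles.

Definition robust (V : finType) (E : V -> V -> V -> bool) :=
  [/\ is_tgraph E, forall x y, x != y -> 9 * #|nonnbr E x y| <= 2 * #|V|
    & forall x y z, E x y z -> #|V| <= 3 * #|[set v | k4 E x y z v]|].

(** * Tiles whose classes are rich in a given neighbourhood *)

Section Average.

Variables (V : finType) (m : nat) (P : {set tile V}).
Hypothesis sysP : tsys m P.
Implicit Types (N Z : {set V}).

Lemma sum_sup_ub (good : tile V -> bool) N b : b <= 400 ->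
  (forall t, t \in P -> ~~ good t -> 100 * #|N :&: sup t| <= b * m) ->
  100 * #|N :&: cov P| <= b * m * #|P| + (400 - b) * m * #|[set t in P | good t]|.
Proof.
move=> b4 h; have h0 := sum_sup P N.
have : \sum_(t in P) 100 * #|N :&: sup t| <=
    \sum_(t in P) (b * m + (400 - b) * m * good t).
  apply: leq_sum => t tP; case: (boolP (good t)) => gt; last first.
    by rewrite muln0 addn0; exact: h.
  have /andP[_ /eqP ct] := (sysP.1 t tP).
  rewrite muln1 -mulnDl subnKC //.
  have := subset_leq_card (subsetIr N (sup t)); rewrite ct /=; clear; lia.
rewrite -big_distrr /= big_split /= sum_nat_const -!big_distrr /=.
have -> : \sum_(t in P) (good t : nat) = #|[set t in P | good t]|.
  rewrite -sum1_card [RHS](eq_bigl (fun t => (t \in P) && good t)) => [|t]; last by rewrite inE.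
  by rewrite [RHS]big_mkcondr; apply: eq_bigr => t _; case: (good t).
rewrite [#|P| * _]mulnC; apply: leq_trans.
by rewrite leq_mul2l h0 orbT.
Qed.

Definition rich N (C : {set V}) := 3 * m <= 100 * #|N :&: C|.

(** A tile with a class that is not rich has at most 3.03 m vertices in [N :\: Z], while the average
    is at least 4 (7/9 - 1/100) m > 3.07 m. Dividing the excess by the remaining 0.97 m gives the
    constant 24. *)
Lemma rich_tiles4 N Z : 0 < m -> 9 * #|~: N| <= 2 * #|V| ->
  100 * (#|~: cov P| + #|Z|) <= #|V| ->
  #|P| <= 24 * #|[set t in P | all (rich (N :\: Z)) (cls t)]|.
Proof.
move=> m0 hN hZ; have := card_tsys sysP.
have : 100 * #|(N :\: Z) :&: cov P| <= 303 * m * #|P| +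
    (400 - 303) * m * #|[set t in P | all (rich (N :\: Z)) (cls t)]|.
  apply: sum_sup_ub => // t tP; have /andP[] := (sysP.1 t tP).
  case: t {tP} => [[[A B] C] D] /=; rewrite andbT => /and4P[/eqP cA /eqP cB /eqP cC /eqP cD] _.
  set N' := N :\: Z; rewrite /rich => ng.
  have := (leq_card_setU (N' :&: (A :|: B :|: C)) (N' :&: D)).1; rewrite -setIUr.
  have := (leq_card_setU (N' :&: (A :|: B)) (N' :&: C)).1; rewrite -setIUr.
  have := (leq_card_setU (N' :&: A) (N' :&: B)).1; rewrite -setIUr.
  move: (subset_leq_card (subsetIr N' A)) (subset_leq_card (subsetIr N' B)).
  move: (subset_leq_card (subsetIr N' C)) (subset_leq_card (subsetIr N' D)) ng.
  rewrite cA cB cC cD !negb_and -!ltnNge; clear; lia.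
have : #|V| <= #|(N :\: Z) :&: cov P| + #|~: N| + #|Z| + #|~: cov P|.
  rewrite -(cardsC ((N :\: Z) :&: cov P)) -!addnA leq_add2l.
  have sub : ~: ((N :\: Z) :&: cov P) \subset ~: N :|: Z :|: ~: cov P.
    by apply/subsetP => v; rewrite !inE; case: (v \in N); case: (v \in Z); case: (v \in cov P).
  apply: leq_trans (subset_leq_card sub) _.
  have := (leq_card_setU (~: N :|: Z) (~: cov P)).1; have := (leq_card_setU (~: N) Z).1.
  clear; lia.
have := cardsC (cov P); move: hN hZ m0.
move: #|[set t in P | _]| #|P| #|_ :&: cov P| #|cov P| #|~: cov P| #|~: N| #|Z| #|V|.
clear => g p x c c' y z n hN hZ m0 h1 h2 h3 h4.
have [gp|//] := ltnP (24 * g) p.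
have h5 : m * (24 * g).+1 <= m * p by rewrite leq_mul2l gp orbT.
by move: h1 h2 h3 h4 h5 hN hZ m0; rewrite mulnS; clear; lia.
Qed.

Definition rich_pair N (p : {set V} * {set V}) := rich N p.1 && rich N p.2.

(** A tile without two rich classes has at most 1.09 m vertices in [N :\: Z], while the average is
    at least 4 (1/3 - 1/100) m > 1.29 m. *)
Lemma rich_tiles2 N Z : 0 < m -> #|V| <= 3 * #|N| ->
  100 * (#|~: cov P| + #|Z|) <= #|V| ->
  #|P| <= 15 * #|[set t in P | has (rich_pair (N :\: Z)) (cls_pairs t)]|.
Proof.
move=> m0 hN hZ; have := card_tsys sysP.
have : 100 * #|(N :\: Z) :&: cov P| <= 109 * m * #|P| +
    (400 - 109) * m * #|[set t in P | has (rich_pair (N :\: Z)) (cls_pairs t)]|.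
  apply: sum_sup_ub => // t tP; have /andP[] := (sysP.1 t tP).
  case: t {tP} => [[[A B] C] D] /=; rewrite andbT => /and4P[/eqP cA /eqP cB /eqP cC /eqP cD] _.
  set N' := N :\: Z; rewrite /rich_pair /rich /= => ng.
  have := (leq_card_setU (N' :&: (A :|: B :|: C)) (N' :&: D)).1; rewrite -setIUr.
  have := (leq_card_setU (N' :&: (A :|: B)) (N' :&: C)).1; rewrite -setIUr.
  have := (leq_card_setU (N' :&: A) (N' :&: B)).1; rewrite -setIUr.
  move: (subset_leq_card (subsetIr N' A)) (subset_leq_card (subsetIr N' B)).
  move: (subset_leq_card (subsetIr N' C)) (subset_leq_card (subsetIr N' D)) ng.
  rewrite cA cB cC cD; move: #|N' :&: A| #|N' :&: B| #|N' :&: C| #|N' :&: D|.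
  clear; lia.
have : #|N| <= #|(N :\: Z) :&: cov P| + #|Z| + #|~: cov P|.
  have sub : N \subset ((N :\: Z) :&: cov P) :|: Z :|: ~: cov P.
    by apply/subsetP => v; rewrite !inE; case: (v \in N); case: (v \in Z); case: (v \in cov P).
  apply: leq_trans (subset_leq_card sub) _.
  have := (leq_card_setU (((N :\: Z) :&: cov P) :|: Z) (~: cov P)).1.
  have := (leq_card_setU ((N :\: Z) :&: cov P) Z).1; clear; lia.
have := cardsC (cov P); move: hN hZ m0.
move: #|[set t in P | _]| #|P| #|_ :&: cov P| #|cov P| #|~: cov P| #|N| #|Z| #|V|.
clear => g p x c c' y z n hN hZ m0 h1 h2 h3 h4.
have [gp|//] := ltnP (15 * g) p.
have h5 : m * (15 * g).+1 <= m * p by rewrite leq_mul2l gp orbT.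
by move: h1 h2 h3 h4 h5 hN hZ m0; rewrite mulnS; clear; lia.
Qed.

End Average.

(** The classes are treated one after another by [kst3], each time shrinking X and Y, which must
    stay large enough for the classes still to come. 34 is 100 / 3 rounded up, the density of a rich
    class. *)
Lemma nbr_blocks r j : 0 < r -> exists M, forall (V : finType) (E : V -> V -> V -> bool)
    (Z X Y : {set V}) (Cs : seq {set V}), size Cs = j -> M <= #|X| -> M <= #|Y| ->
  all (fun C : {set V} => M <= #|C|) Cs ->
  (forall C x y, C \in Cs -> x \in X -> y \in Y ->
     #|C| <= 34 * #|[set c in C | E x y c && (c \notin Z)]|) ->
  exists (X' Y' : {set V}) (As : seq {set V}), [/\ X' \subset X /\ r <= #|X'|,
    Y' \subset Y /\ r <= #|Y'|,
    all2 (fun A C : {set V} => (A \subset C :\: Z) && (r <= #|A|)) As Cs &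
    forall A x y a, A \in As -> x \in X' -> y \in Y' -> a \in A -> E x y a].
Proof.
move=> r0; elim: j => [|j [M IH]].
  by exists r => V E Z X Y [] // _ hX hY _ _; exists X, Y, [::]; split.
have [|M' hM'] := @kst3 (maxn M r) 34 _ isT; first by rewrite leq_max r0 orbT.
exists (maxn M M') => V E Z X Y [//|C Cs] /= [sC]; rewrite !geq_max.
move=> /andP[_ hX] /andP[_ hY] /andP[/andP[_ hC] hCs] dens.
have [X1 [Y1 [A [[sX cX] [sY cY] [sA cA] hA]]]] := hM' V X Y C hX hY hC
  (fun x y c => E x y c && (c \notin Z)) (fun x y => dens C x y (mem_head _ _)).
have [||||X' [Y' [As [[sX' cX'] [sY' cY'] hAs EAs]]]] := IH V E Z X1 Y1 Cs sC.
- by rewrite cX leq_maxl.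
- by rewrite cY leq_maxl.
- by apply: sub_all hCs => D; rewrite geq_max => /andP[].
- move=> D x y hD hx hy; apply: dens; first by rewrite inE hD orbT.
    exact: (subsetP sX).
  exact: (subsetP sY).
have AZ x y a : x \in X1 -> y \in Y1 -> a \in A -> E x y a /\ a \notin Z.
  by move=> hx hy ha; have /andP[] := hA x y a hx hy ha.
have pos (S S' : {set V}) n : 0 < n -> #|S| = n -> exists v, v \in S.
  by move=> n0 cS; apply/set0Pn; rewrite -card_gt0 cS.
have m0 : 0 < maxn M r by rewrite leq_max r0 orbT.
have [x1 hx1] := pos X1 X1 _ m0 cX; have [y1 hy1] := pos Y1 Y1 _ m0 cY.
exists X', Y', (A :: As); split.
- by rewrite (subset_trans sX').
- by rewrite (subset_trans sY').
- rewrite /= hAs andbT cA leq_maxr andbT; apply/subsetP => a ha.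
  by rewrite inE (subsetP sA) // (AZ x1 y1 a hx1 hy1 ha).2.
- move=> B x y a; rewrite inE => /orP[/eqP ->|hB] hx hy ha; last exact: EAs hB hx hy ha.
  exact: (AZ x y a (subsetP sX' _ hx) (subsetP sY' _ hy) ha).1.
Qed.

Section TileLemmas.

Variables (V : finType) (E : V -> V -> V -> bool).
Hypothesis rE : robust E.

(** Disjointness follows from completeness: the four vertices of a K4 are distinct. *)
Lemma complete_tshape m (A B C D : {set V}) : 0 < m -> #|A| = m -> #|B| = m -> #|C| = m -> #|D| = m ->
  complete E (A, B, C, D) -> tshape m (A, B, C, D).
Proof.
move=> m0 cA cB cC cD h; have tE : is_tgraph E by case: rE.
have pos (S : {set V}) : #|S| = m -> exists v, v \in S.
  by move=> cS; apply/set0Pn; rewrite -card_gt0 cS.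
have [a hA] := pos A cA; have [b hB] := pos B cB.
have [c hC] := pos C cC; have [d hD] := pos D cD.
have K p q r s : p \in A -> q \in B -> r \in C -> s \in D -> k4 E p q r s.
  by move=> h1 h2 h3 h4; move: h => /forall_inP/(_ p h1)/forall_inP/(_ q h2)/forall_inP/(_ r h3)/forall_inP/(_ s h4).
have ne p q r s : p \in A -> q \in B -> r \in C -> s \in D ->
    [/\ p != q, p != r, q != r & [/\ p != s, q != s & r != s]].
  move=> h1 h2 h3 h4; have /and4P[k1 k2 k3 _] := K p q r s h1 h2 h3 h4.
  have [-> -> ->] := edge_neq tE k1; have [_ -> ->] := edge_neq tE k2.
  by have [_ _ ->] := edge_neq tE k3.
have dis (S S' : {set V}) : (forall v, v \in S -> v \in S' -> False) -> [disjoint S & S'].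
  move=> hS; rewrite -setI_eq0; apply/eqP/setP => v; rewrite in_setI in_set0.
  by apply/negP => /andP[h1 h2]; exact: hS h1 h2.
have U2 (S S' : {set V}) : [disjoint S & S'] -> #|S :|: S'| = #|S| + #|S'|.
  by move=> dS; apply/eqP; rewrite (leq_card_setU S S').2.
rewrite /tshape /= cA cB cC cD eqxx /= !U2 ?cA ?cB ?cC ?cD; last 3 first.
- by apply: dis => v hA' hB'; have [] := ne v v c d hA' hB' hC hD; rewrite eqxx.
- by apply: dis => v; rewrite inE => /orP[h1|h1] h2;
  [have [_] := ne v b v d h1 hB h2 hD | have [_ _] := ne a v v d hA h1 h2 hD]; rewrite eqxx.
- apply: dis => v; rewrite !inE => /orP[/orP[h1|h1]|h1] h2.
  + by have [_ _ _ []] := ne v b c v h1 hB hC h2; rewrite eqxx.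
  + by have [_ _ _ [_]] := ne a v c v hA h1 hC h2; rewrite eqxx.
  + by have [_ _ _ [_ _]] := ne a b v v hA hB h1 h2; rewrite eqxx.
by apply/eqP; lia.
Qed.

Lemma cls_disjoint m (t : tile V) : tshape m t ->
  forall C C1 C2, C \in cls t -> (C1, C2) \in cls_pairs t ->
  [disjoint C1 & C2] /\ ([disjoint C & C1] \/ [disjoint C & C2]).
Proof.
case: t => [[[A B] C] D] /andP[/= /and5P[/eqP cA /eqP cB /eqP cC /eqP cD _] /eqP cU].
have h1 := leq_card_setU (A :|: B :|: C) D.
have h2 := leq_card_setU (A :|: B) C; have h3 := leq_card_setU A B.
have dD : [disjoint A :|: B :|: C & D] by rewrite -h1.2; move: h1.1 h2.1 h3.1; lia.
have dC : [disjoint A :|: B & C] by rewrite -h2.2; move: h1.1 h2.1 h3.1; lia.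
have dB : [disjoint A & B] by rewrite -h3.2; move: h1.1 h2.1 h3.1; lia.
have BA : [disjoint B & A] by rewrite disjoint_sym.
have AC : [disjoint A & C] by apply: disjointWl dC; rewrite subsetUl.
have CA : [disjoint C & A] by rewrite disjoint_sym.
have BC : [disjoint B & C] by apply: disjointWl dC; rewrite subsetUr.
have CB : [disjoint C & B] by rewrite disjoint_sym.
have AD : [disjoint A & D] by apply: disjointWl dD; rewrite -setUA subsetUl.
have DA : [disjoint D & A] by rewrite disjoint_sym.
have BD : [disjoint B & D] by apply: disjointWl dD; rewrite setUAC subsetUr.
have DB : [disjoint D & B] by rewrite disjoint_sym.
have CD : [disjoint C & D] by apply: disjointWl dD; rewrite subsetUr.
have DC : [disjoint D & C] by rewrite disjoint_sym.
move=> C0 C1 C2; rewrite /= !inE => /or4P[] /eqP ->;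
move=> /orP[/eqP[-> ->]|/orP[/eqP[-> ->]|/orP[/eqP[-> ->]|/or3P[] /eqP[-> ->]]]];
by split=> //; first [left; assumption | right; assumption].
Qed.

Lemma nonnbr_nbrs x y : ~: [set v | E x y v] = nonnbr E x y.
Proof. by apply/setP => v; rewrite !inE. Qed.

Lemma tsys_nonempty (P : {set tile V}) (Z : {set V}) : 0 < #|V| ->
  100 * (#|~: cov P| + #|Z|) <= #|V| -> P != set0.
Proof.
move=> V0 h; apply/eqP => e; move: h; rewrite e /cov big_set0 setC0 cardsT.
by move: V0; clear; lia.
Qed.

Lemma rich_card (m : nat) (N Z C : {set V}) : #|C| = m -> rich m (N :\: Z) C ->
  #|C| <= 34 * #|[set c in C | (c \in N) && (c \notin Z)]|.
Proof.
move=> cC; rewrite /rich; have -> : (N :\: Z) :&: C = [set c in C | (c \in N) && (c \notin Z)].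
  by apply/setP => v; rewrite !inE; case: (v \in C); case: (v \in N); case: (v \in Z).
by rewrite cC; lia.
Qed.

End TileLemmas.

(** Every pair [x y] finds a proportion 1/24 of the tiles rich in all four classes, so one tile is
    rich in this way for a proportion 1/24 of the pairs. *)
Lemma nbr_blocks_in_tile r : 0 < r -> exists M, forall (V : finType) (E : V -> V -> V -> bool) m
    (P : {set tile V}) (Z X Y : {set V}),
  robust E -> tsys m P -> M <= m -> 0 < m -> 0 < #|V| ->
  100 * (#|~: cov P| + #|Z|) <= #|V| -> [disjoint X & Y] -> M <= #|X| -> M <= #|Y| ->
  exists (t : tile V) (X' Y' : {set V}) (As : seq {set V}),
  [/\ t \in P, X' \subset X /\ r <= #|X'|, Y' \subset Y /\ r <= #|Y'|,
    all2 (fun A C : {set V} => (A \subset C :\: Z) && (r <= #|A|)) As (cls t) &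
    forall A x y a, A \in As -> x \in X' -> y \in Y' -> a \in A -> E x y a].
Proof.
move=> r0; have [M1 h1] := nbr_blocks 4 r0.
have [|M2 h2] := @kst2 (M1.+1) 24 _ isT; first by [].
exists (maxn M1 M2) => V E m P Z X Y rE sysP; rewrite !geq_max.
move=> /andP[mM1 mM2] m0 V0 hZ dXY /andP[_ hX] /andP[_ hY].
pose good (t : tile V) (w : seq V) := if w is [:: x; y] then
  all (rich m ([set v | E x y v] :\: Z)) (cls t) else false.
have [w|t tP ht] := @pigeonhole_seq _ _ P (prods [:: X; Y]) good 24 (tsys_nonempty V0 hZ).
  move=> /mem_prodsP [x [w1 [hx /mem_prodsP [y [w2 [hy hw ->]]] ->]]].
  rewrite /= inE in hw; rewrite (eqP hw) /=; apply: rich_tiles4 => //; rewrite nonnbr_nbrs.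
  case: rE => _ + _; apply; apply: contraTneq hx => ->.
  by rewrite (disjointFl dXY).
have [X1 [Y1 [[sX cX] [sY cY] hg]]] := h2 V X Y hX hY
  (fun x y => all (rich m ([set v | E x y v] :\: Z)) (cls t)) ht.
have /andP[sht _] := sysP.1 t tP.
have [||||| X' [Y' [As [[sX' cX'] [sY' cY'] hAs EAs]]]] := h1 V E Z X1 Y1 (cls t) _.
- by case: (t) => [[[? ?] ?] ?].
- by rewrite cX.
- by rewrite cY.
- by apply/allP => C hC; rewrite (eqP (allP sht C hC)).
- move=> C x y hC hx hy.
  have := rich_card (eqP (allP sht C hC)) (allP (hg x y hx hy) C hC).
  by congr (_ <= 34 * _); apply: eq_card => v; rewrite !inE.
by exists t, X', Y', As; split; rewrite ?(subset_trans sX') ?(subset_trans sY').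
Qed.

Lemma disjoint_by (T : finType) (A B : {set T}) :
  (forall v, v \in A -> v \in B -> False) -> [disjoint A & B].
Proof.
move=> h; rewrite -setI_eq0; apply/eqP/setP => v; rewrite in_setI in_set0.
by apply/negP => /andP[h1 h2]; exact: h h1 h2.
Qed.

Lemma halve (T : finType) (X : {set T}) m : #|X| = 2 * m -> exists X1 X2 : {set T},
  [/\ X1 \subset X, X2 \subset X, [disjoint X1 & X2], #|X1| = m & #|X2| = m].
Proof.
move=> cX; have [|X1 s1 c1] := @subset_of_card _ X m; first by rewrite cX; lia.
exists X1, (X :\: X1); split; rewrite ?subsetDl //.
  by apply: disjoint_by => v h; rewrite inE h.
by rewrite cardsDS // cX c1; lia.
Qed.

Lemma completeP (V : finType) (E : V -> V -> V -> bool) (A B C D : {set V}) :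
  (forall a b c d, a \in A -> b \in B -> c \in C -> d \in D -> k4 E a b c d) ->
  complete E (A, B, C, D).
Proof.
move=> h; apply/forall_inP => a hA; apply/forall_inP => b hB.
by apply/forall_inP => c hC; apply/forall_inP => d hD; apply: h.
Qed.

(* The triples of X * Y * A extend to K4's through two classes of some tile: two
   new tiles at the expense of one unit of an old one. *)
Lemma extension m' : 0 < m' -> exists M, forall (V : finType) (E : V -> V -> V -> bool) m
    (P : {set tile V}) (Z X Y A : {set V}),
  robust E -> tsys m P -> M <= m -> 0 < m -> 0 < #|V| ->
  100 * (#|~: cov P| + #|Z|) <= #|V| -> M <= #|X| -> M <= #|Y| -> M <= #|A| ->
  (forall x y a, x \in X -> y \in Y -> a \in A -> E x y a) ->
  exists (t t1 t2 : tile V) (X' Y' A' U : {set V}),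
  [/\ t \in P, X' \subset X /\ #|X'| = 2 * m', Y' \subset Y /\ #|Y'| = 2 * m',
    A' \subset A /\ #|A'| = 2 * m' &
    [/\ [disjoint U & Z], U \subset sup t, forall C, C \in cls t -> #|C :&: U| <= m' &
      [/\ tshape m' t1 /\ complete E t1, tshape m' t2 /\ complete E t2,
        [disjoint sup t1 & sup t2] &
        sup t1 :|: sup t2 \subset X' :|: Y' :|: A' :|: U]]].
Proof.
move=> m'0; have m2 : 0 < 2 * m' by rewrite muln_gt0.
(* The constants are built backwards: [hMc] will fix a tile's pair of classes for all triples, [hMb]
   then treats the first class and leaves enough for [hMa] to treat the second. *)
have [Ma hMa] := @kst4 (2 * m') 34 m2 isT.
have mb : 0 < maxn Ma (2 * m') by rewrite leq_max m2 orbT.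
have [Mb hMb] := @kst4 (maxn Ma (2 * m')) 34 mb isT.
have [Mc hMc] := @kst3_gen Mb.+1 90 isT isT.
exists (maxn Ma (maxn Mb Mc)) => V E m P Z X Y A rE sysP; rewrite !geq_max.
move=> /and3P[mMa mMb _] m0 V0 hZ /and3P[_ _ hX] /and3P[_ _ hY] /and3P[_ _ hA] EXYA.
have tE : is_tgraph E by case: rE.
(* The pigeonhole runs over tiles together with one of their six pairs of classes, hence 90 = 6
   times 15. *)
pose pr (q : tile V * 'I_6) := nth (set0, set0) (cls_pairs q.1) q.2.
pose N x y a := [set v | k4 E x y a v].
pose good (q : tile V * 'I_6) (w : seq V) := if w is [:: x; y; a] then
  rich_pair m (N x y a :\: Z) (pr q) else false.
pose PP : {set tile V * 'I_6} := setX P [set: 'I_6].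
have PP0 : PP != set0.
  have /set0Pn[t tP] := tsys_nonempty V0 hZ; apply/set0Pn; exists (t, ord0).
  by rewrite !inE tP.
have szp (t : tile V) : size (cls_pairs t) = 6 by case: t => [[[? ?] ?] ?].
have [w|[t i] tiP ht] := @pigeonhole_seq _ _ PP (prods [:: X; Y; A]) good 90 PP0.
  move=> /mem_prodsP [x [w1 [hx /mem_prodsP [y [w2 [hy /mem_prodsP [a [w3 [ha hw ->]]] ->]]] ->]]].
  rewrite /= inE in hw; rewrite (eqP hw) /= cardsX cardsT card_ord.
  have hN : #|V| <= 3 * #|N x y a| by case: rE => _ _; apply; apply: EXYA.
  have h1 := rich_tiles2 sysP m0 hN hZ.
  set G := [set t in P | _] in h1.
  apply: leq_trans (_ : 15 * #|G| * 6 <= _); first by rewrite leq_mul2r h1 orbT.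
  rewrite mulnAC leq_mul2l; apply/orP; right.
  set H := [set q in PP | _].
  apply: leq_trans (leq_imset_card (fun q : tile V * 'I_6 => q.1) H).
  apply/subset_leq_card/subsetP => t; rewrite inE => /andP[tP /hasP [p hp hr]].
  have hi : index p (cls_pairs t) < 6 by rewrite -(szp t) index_mem.
  apply/imsetP; exists (t, Ordinal hi) => //.
  by rewrite !inE tP /= /pr /= nth_index.
move: tiP; rewrite !inE /= andbT => tP.
have prP : pr (t, i) \in cls_pairs t by apply: mem_nth; rewrite szp.
have [X1 [Y1 [A1 [[sX1 cX1] [sY1 cY1] [sA1 cA1] hg]]]] := hMc V X Y A hX hY hA
  (fun x y a => rich_pair m (N x y a :\: Z) (pr (t, i))) ht.
case: (pr (t, i)) prP hg => C1 C2 prP hg {ht}.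
have sht := sysP.1 t tP.
have C1t : C1 \in cls t.
  by case: (t) prP => [[[? ?] ?] ?] /=; rewrite !inE !xpair_eqE => /or4P[| | |/or3P[]] /andP[/eqP -> _];
    rewrite ?eqxx ?orbT.
have C2t : C2 \in cls t.
  by case: (t) prP => [[[? ?] ?] ?] /=; rewrite !inE !xpair_eqE => /or4P[| | |/or3P[]] /andP[_ /eqP ->];
    rewrite ?eqxx ?orbT.
have cC1 : #|C1| = m by case/andP: sht => /allP/(_ _ C1t)/eqP.
have cC2 : #|C2| = m by case/andP: sht => /allP/(_ _ C2t)/eqP.
have dens (C : {set V}) : #|C| = m ->
    (forall x y a, x \in X1 -> y \in Y1 -> a \in A1 -> rich m (N x y a :\: Z) C) ->
    forall x y a, x \in X1 -> y \in Y1 -> a \in A1 ->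
    #|C| <= 34 * #|[set c in C | k4 E x y a c && (c \notin Z)]|.
  move=> cC hr x y a hx hy ha; have := rich_card cC (hr x y a hx hy ha).
  by congr (_ <= 34 * _); apply: eq_card => v; rewrite !inE.
have d1 x y a : x \in X1 -> y \in Y1 -> a \in A1 ->
    #|C1| <= 34 * #|[set c in C1 | k4 E x y a c && (c \notin Z)]|.
  by apply: dens => // {}x {}y {}a hx hy ha; have /andP[] := hg x y a hx hy ha.
have d2 x y a : x \in X1 -> y \in Y1 -> a \in A1 ->
    #|C2| <= 34 * #|[set c in C2 | k4 E x y a c && (c \notin Z)]|.
  by apply: dens => // {}x {}y {}a hx hy ha; have /andP[] := hg x y a hx hy ha.
have b1 (S : {set V}) : #|S| = Mb.+1 -> Mb <= #|S| by move=> ->.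
have b2 (S : {set V}) : #|S| = maxn Ma (2 * m') -> Ma <= #|S| by move=> ->; rewrite leq_maxl.
have bC1 : Mb <= #|C1| by rewrite cC1.
have bC2 : Ma <= #|C2| by rewrite cC2.
have [X2 [Y2 [A2 [U1 [[sX2 cX2] [sY2 cY2] [sA2 cA2] [sU1 cU1] hU1]]]]] :=
  hMb V X1 Y1 A1 C1 (b1 _ cX1) (b1 _ cY1) (b1 _ cA1) bC1 _ d1.
have d2' x y a : x \in X2 -> y \in Y2 -> a \in A2 ->
    #|C2| <= 34 * #|[set c in C2 | k4 E x y a c && (c \notin Z)]|.
  move=> hx hy ha.
  exact: d2 (subsetP sX2 _ hx) (subsetP sY2 _ hy) (subsetP sA2 _ ha).
have [X3 [Y3 [A3 [U2 [[sX3 cX3] [sY3 cY3] [sA3 cA3] [sU2 cU2] hU2]]]]] :=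
  hMa V X2 Y2 A2 C2 (b2 _ cX2) (b2 _ cY2) (b2 _ cA2) bC2 _ d2'.
(* Only m' vertices are taken from each of the two classes, against 2 m' from each of X, Y, A: the
   halves of these three are matched with [V1] and [V2]. *)
have [|V1 sV1 cV1] := @subset_of_card _ U1 m'; first by rewrite cU1 leq_max leq_pmull ?orbT.
have [|V2 sV2 cV2] := @subset_of_card _ U2 m'; first by rewrite cU2 leq_pmull.
have K x y a u : x \in X3 -> y \in Y3 -> a \in A3 -> u \in V1 :|: V2 -> k4 E x y a u /\ u \notin Z.
  move=> hx hy ha; rewrite inE => /orP[/(subsetP sV1)|/(subsetP sV2)] hu.
    by apply/andP; apply: hU1; rewrite ?(subsetP sX3) ?(subsetP sY3) ?(subsetP sA3).
  by apply/andP; apply: hU2.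
have pos (S : {set V}) n : 0 < n -> #|S| = n -> exists v, v \in S.
  by move=> n0 cS; apply/set0Pn; rewrite -card_gt0 cS.
have [x0 hx0] := pos X3 _ m2 cX3; have [y0 hy0] := pos Y3 _ m2 cY3.
have [a0 ha0] := pos A3 _ m2 cA3; have [u0 hu0'] := pos V1 _ m'0 cV1.
have hu0 : u0 \in V1 :|: V2 by rewrite inE hu0'.
have ne x y a u : x \in X3 -> y \in Y3 -> a \in A3 -> u \in V1 :|: V2 ->
    [/\ x != y, x != a, y != a & [/\ x != u, y != u & a != u]].
  move=> h1 h2 h3 h4; have [/and4P[k1 k2 k3 _] _] := K x y a u h1 h2 h3 h4.
  have [-> -> ->] := edge_neq tE k1; have [_ -> ->] := edge_neq tE k2.
  by have [_ _ ->] := edge_neq tE k3.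
have XY v : v \in X3 -> v \in Y3 -> False.
  by move=> h1 h2; have [] := ne v v a0 u0 h1 h2 ha0 hu0; rewrite eqxx.
have XA v : v \in X3 -> v \in A3 -> False.
  by move=> h1 h2; have [_] := ne v y0 v u0 h1 hy0 h2 hu0; rewrite eqxx.
have YA v : v \in Y3 -> v \in A3 -> False.
  by move=> h1 h2; have [_ _] := ne x0 v v u0 hx0 h1 h2 hu0; rewrite eqxx.
have XU v : v \in X3 -> v \in V1 :|: V2 -> False.
  by move=> h1 h2; have [_ _ _ []] := ne v y0 a0 v h1 hy0 ha0 h2; rewrite eqxx.
have YU v : v \in Y3 -> v \in V1 :|: V2 -> False.
  by move=> h1 h2; have [_ _ _ [_]] := ne x0 v a0 v hx0 h1 ha0 h2; rewrite eqxx.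
have AU v : v \in A3 -> v \in V1 :|: V2 -> False.
  by move=> h1 h2; have [_ _ _ [_ _]] := ne x0 y0 v v hx0 hy0 h1 h2; rewrite eqxx.
have [C12 _] := cls_disjoint sht C1t prP.
have sVC1 : V1 \subset C1 := subset_trans sV1 sU1.
have sVC2 : V2 \subset C2 := subset_trans sV2 sU2.
have UU v : v \in V1 -> v \in V2 -> False.
  by move=> /(subsetP sVC1) h1 /(subsetP sVC2) h2; move: (disjointFr C12 h1); rewrite h2.
have [Xa [Xb [sXa sXb dX cXa cXb]]] := halve cX3.
have [Ya [Yb [sYa sYb dY cYa cYb]]] := halve cY3.
have [Aa [Ab [sAa sAb dA cAa cAb]]] := halve cA3.
have [inXa inXb] := (subsetP sXa, subsetP sXb).
have [inYa inYb] := (subsetP sYa, subsetP sYb).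
have [inAa inAb] := (subsetP sAa, subsetP sAb).
have inV1 v : v \in V1 -> v \in V1 :|: V2 by move=> h; rewrite inE h.
have inV2 v : v \in V2 -> v \in V1 :|: V2 by move=> h; rewrite inE h orbT.
have co1 : complete E (Xa, Ya, Aa, V1).
  by apply: completeP => x y a u hx hy ha hu; apply: (K x y a u _ _ _ _).1; auto.
have co2 : complete E (Xb, Yb, Ab, V2).
  by apply: completeP => x y a u hx hy ha hu; apply: (K x y a u _ _ _ _).1; auto.
exists t, (Xa, Ya, Aa, V1), (Xb, Yb, Ab, V2), X3, Y3, A3, (V1 :|: V2); split=> //.
- by rewrite cX3 (subset_trans sX3) // (subset_trans sX2).
- by rewrite cY3 (subset_trans sY3) // (subset_trans sY2).
- by rewrite cA3 (subset_trans sA3) // (subset_trans sA2).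
split.
- by apply: disjoint_by => v hv hz; have [_] := K x0 y0 a0 v hx0 hy0 ha0 hv; rewrite hz.
- by rewrite subUset (subset_trans sVC1) ?(subset_trans sVC2) ?cls_sub.
- move=> C hC; rewrite setIUr; apply: leq_trans (leq_card_setU _ _).1 _.
  have [_ [d|d]] := cls_disjoint sht hC prP.
    have -> : C :&: V1 = set0 by apply/eqP; rewrite setI_eq0; apply: disjointWr d.
    by rewrite cards0 add0n -cV2 subset_leq_card // subsetIr.
  have -> : C :&: V2 = set0 by apply/eqP; rewrite setI_eq0; apply: disjointWr d.
  by rewrite cards0 addn0 -cV1 subset_leq_card // subsetIr.
split.
- by split=> //; apply: (complete_tshape rE m'0).
- by split=> //; apply: (complete_tshape rE m'0).
- apply: disjoint_by => v /=; rewrite !in_setU.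
  case/orP => [/orP[/orP[h|h]|h]|h]; case/orP => [/orP[/orP[h'|h']|h']|h'].
  + by move: (disjointFr dX h); rewrite h'.
  + exact: XY (inXa _ h) (inYb _ h').
  + exact: XA (inXa _ h) (inAb _ h').
  + exact: XU (inXa _ h) (inV2 _ h').
  + exact: XY (inXb _ h') (inYa _ h).
  + by move: (disjointFr dY h); rewrite h'.
  + exact: YA (inYa _ h) (inAb _ h').
  + exact: YU (inYa _ h) (inV2 _ h').
  + exact: XA (inXb _ h') (inAa _ h).
  + exact: YA (inYb _ h') (inAa _ h).
  + by move: (disjointFr dA h); rewrite h'.
  + exact: AU (inAa _ h) (inV2 _ h').
  + exact: XU (inXb _ h') (inV1 _ h).
  + exact: YU (inYb _ h') (inV1 _ h).
  + exact: AU (inAb _ h') (inV1 _ h).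
  + exact: UU h h'.
- apply/subsetP => v /=; rewrite !in_setU.
  case/orP => /orP[/orP[/orP[h|h]|h]|h].
  + by rewrite (inXa _ h).
  + by rewrite (inYa _ h) orbT.
  + by rewrite (inAa _ h) orbT.
  + by rewrite h !orbT.
  + by rewrite (inXb _ h).
  + by rewrite (inYb _ h) orbT.
  + by rewrite (inAb _ h) orbT.
  + by rewrite h !orbT.
Qed.

Definition tiling (V : finType) (E : V -> V -> V -> bool) m (P : {set tile V}) :=
  tsys m P /\ forall t, t \in P -> complete E t.

Lemma covU (V : finType) (P Q : {set tile V}) : cov (P :|: Q) = cov P :|: cov Q.
Proof. exact: bigcup_setU. Qed.

Lemma cov1 (V : finType) (t : tile V) : cov [set t] = sup t.
Proof. exact: big_set1. Qed.

Lemma cov0 (V : finType) : cov (set0 : {set tile V}) = set0.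
Proof. exact: big_set0. Qed.

Lemma tiling0 (V : finType) (E : V -> V -> V -> bool) m : tiling E m set0.
Proof. by split=> [|t]; [split=> t | ]; rewrite inE. Qed.

Lemma tiling1 (V : finType) (E : V -> V -> V -> bool) m t :
  tshape m t -> complete E t -> tiling E m [set t].
Proof.
move=> h1 h2; split=> [|t']; [split=> [t'|t' t'']|]; rewrite !inE => /eqP -> //.
by move=> /eqP ->; rewrite eqxx.
Qed.

Lemma tilingU (V : finType) (E : V -> V -> V -> bool) m (P Q : {set tile V}) :
  tiling E m P -> tiling E m Q -> [disjoint cov P & cov Q] -> tiling E m (P :|: Q).
Proof.
move=> [[p1 p2] p3] [[q1 q2] q3] d.
have mix t t' : t \in P -> t' \in Q -> [disjoint sup t & sup t'].
  by move=> h h'; apply: disjointWl (sup_cov h) _; apply: disjointWr (sup_cov h') _.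
split=> [|t]; last by rewrite inE => /orP[/p3|/q3].
split=> [t|t t']; first by rewrite inE => /orP[/p1|/q1].
rewrite !inE => /orP[h|h] /orP[h'|h'] n; [exact: p2 | exact: mix | | exact: q2].
by rewrite disjoint_sym; apply: mix.
Qed.

Lemma disjoint_cards (T : finType) (A B : {set T}) : [disjoint A & B] -> #|A :|: B| = #|A| + #|B|.
Proof. by move=> d; apply/eqP; rewrite (leq_card_setU A B).2. Qed.

(** [Zf] contains everything in play and grows by the vertices each extension takes, so later
    extensions cannot collide with earlier ones. The loss is measured on a subsystem [Pr], as [P]
    will also contain the filler tiles. *)
Lemma extensions m' j : 0 < m' -> exists M, forall (V : finType) (E : V -> V -> V -> bool) m
    (P : {set tile V}) (Zf X Y : {set V}) (As : seq {set V}),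
  robust E -> tsys m P -> M <= m -> 0 < m -> 0 < #|V| -> size As = j ->
  100 * (#|~: cov P| + #|Zf| + 4 * m' * j) <= #|V| -> M <= #|X| -> M <= #|Y| ->
  all (fun A : {set V} => M <= #|A|) As ->
  [disjoint X & Y] -> (forall A, A \in As -> [disjoint A & X] /\ [disjoint A & Y]) ->
  pairwise (fun A B : {set V} => [disjoint A & B]) As ->
  (forall A x y a, A \in As -> x \in X -> y \in Y -> a \in A -> E x y a) ->
  X \subset Zf -> Y \subset Zf -> (forall A, A \in As -> A \subset Zf) ->
  exists S : {set tile V}, [/\ tiling E m' S, #|cov S| = 8 * m' * j,
    forall v, v \in cov S -> [\/ v \in X, v \in Y, has (fun A : {set V} => v \in A) As | v \notin Zf],
    forall A, A \in As -> #|cov S :&: A| <= 2 * m' &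
    forall (Pr : {set tile V}) Z0, Pr \subset P ->
      pot Pr Z0 <= pot Pr (Z0 :|: (cov S :\: Zf)) + j * m'].
Proof.
move=> m'0; elim: j => [|j [M IH]].
  exists 0 => V E m P Zf X Y As _ _ _ _ _ /size0nil -> *; exists set0; rewrite cov0.
  split; rewrite ?cards0 ?muln0 //; first exact: tiling0.
    by move=> v; rewrite inE.
  by move=> Pr Z0 _; rewrite set0D setU0 mul0n addn0.
have [Me hMe] := extension m'0.
exists (maxn M Me + 2 * m') => V E m P Zf X Y [//|A As] rE sysP hm m0 V0 [sAs] hZ hX hY.
move=> /= /andP[hA hAs] dXY dA /andP[pA pAs] EA sX sY sA.
have le1 n : maxn M Me + 2 * m' <= n -> M <= n /\ Me <= n.
  by move=> h; split; apply: leq_trans h; apply: leq_trans (leq_addr _ _); rewrite leq_max leqnn ?orbT.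
have leD (S S' : {set V}) : S' \subset S -> maxn M Me + 2 * m' <= #|S| -> #|S'| = 2 * m' -> M <= #|S :\: S'|.
  move=> sS h cS; rewrite cardsDS // cS leq_subRL; last first.
    by apply: leq_trans h; apply: leq_addl.
  by apply: leq_trans h; rewrite addnC leq_add2r leq_maxl.
have EA1 x y a : x \in X -> y \in Y -> a \in A -> E x y a by apply: EA; apply: mem_head.
have hZ1 : 100 * (#|~: cov P| + #|Zf|) <= #|V|.
  by apply: leq_trans hZ; rewrite leq_mul2l leq_addr orbT.
have [t [t1 [t2 [X' [Y' [A' [U [tP [sX' cX'] [sY' cY'] [sA' cA'] [dU sU cU [[sh1 co1] [sh2 co2] d12 s12]]]]]]]]]]
  := hMe V E m P Zf X Y A rE sysP (le1 _ hm).2 m0 V0 hZ1 (le1 _ hX).2 (le1 _ hY).2 (le1 _ hA).2 EA1.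
have sAZ : A \subset Zf by apply: sA; apply: mem_head.
have [dAX dAY] := dA A (mem_head _ _).
have cU4 : #|U| <= 4 * m'.
  have : U \subset \bigcup_(C <- cls t) (C :&: U).
    apply/subsetP => v hv; have := subsetP sU v hv; case: (t) => [[[C1 C2] C3] C4] /=.
    by rewrite !big_cons big_nil !inE hv !andbT orbF -!orbA.
  move=> h; apply: leq_trans (subset_leq_card h) _.
  case: (t) cU => [[[C1 C2] C3] C4] /= cU; rewrite !big_cons big_nil setU0.
  have := (leq_card_setU (C1 :&: U) (C2 :&: U :|: (C3 :&: U :|: C4 :&: U))).1.
  have := (leq_card_setU (C2 :&: U) (C3 :&: U :|: C4 :&: U)).1.
  have := (leq_card_setU (C3 :&: U) (C4 :&: U)).1.
  have := cU C1; have := cU C2; have := cU C3; have := cU C4.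
  rewrite !inE !eqxx !orbT => /(_ isT) h4 /(_ isT) h3 /(_ isT) h2 /(_ isT) h1.
  move: h1 h2 h3 h4; clear; lia.
have hZ2 : 100 * (#|~: cov P| + #|Zf :|: U| + 4 * m' * j) <= #|V|.
  apply: leq_trans hZ; rewrite leq_mul2l; apply/orP; right.
  have := (leq_card_setU Zf U).1; rewrite mulnS; move: cU4; clear; lia.
have dXY' : [disjoint X :\: X' & Y :\: Y'].
  by apply: disjointW dXY; rewrite subsetDl.
have aAs : all (fun A : {set V} => M <= #|A|) As by apply: sub_all hAs => B /le1[].
have dA2 B : B \in As -> [disjoint B & X :\: X'] /\ [disjoint B & Y :\: Y'].
  move=> hB; have [|d1 d2] := dA B; first by rewrite inE hB orbT.
  by split; [exact: disjointWr (subsetDl _ _) d1 | exact: disjointWr (subsetDl _ _) d2].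
have EA2 B x y a : B \in As -> x \in X :\: X' -> y \in Y :\: Y' -> a \in B -> E x y a.
  move=> hB /setDP[hx _] /setDP[hy _]; apply: (EA B) => //; by rewrite inE hB orbT.
have sX2 : X :\: X' \subset Zf :|: U.
  by rewrite (subset_trans (subsetDl _ _)) // (subset_trans sX) // subsetUl.
have sY2 : Y :\: Y' \subset Zf :|: U.
  by rewrite (subset_trans (subsetDl _ _)) // (subset_trans sY) // subsetUl.
have sA2 B : B \in As -> B \subset Zf :|: U.
  by move=> hB; rewrite (subset_trans (sA B _)) ?subsetUl // inE hB orbT.
have [S [tS cS covS capS potS]] := IH V E m P (Zf :|: U) (X :\: X') (Y :\: Y') As rE sysP
  (le1 _ hm).1 m0 V0 sAs hZ2 (leD _ _ sX' hX cX') (leD _ _ sY' hY cY') aAs dXY' dA2 pAs EA2 sX2 sY2 sA2.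
pose T := [set t1] :|: [set t2].
have covT : cov T = sup t1 :|: sup t2 by rewrite covU !cov1.
have inT v : v \in cov T -> [\/ v \in X', v \in Y', v \in A' | v \in U].
  rewrite covT => /(subsetP s12); by rewrite !in_setU -!orbA => /or4P.
have X'X := subsetP sX'; have Y'Y := subsetP sY'; have A'A := subsetP sA'.
have XZ := subsetP sX; have YZ := subsetP sY; have AZ := subsetP sAZ.
have no (S1 S2 : {set V}) v : [disjoint S1 & S2] -> v \in S1 -> v \in S2 -> False.
  by move=> d h1 h2; move: (disjointFr d h1); rewrite h2.
have BX B v : B \in As -> v \in B -> v \in X -> False.
  by move=> hB; apply: no; have [] := dA B; rewrite // inE hB orbT.
have BY B v : B \in As -> v \in B -> v \in Y -> False.
  by move=> hB; apply: no; have [] := dA B; rewrite // inE hB orbT.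
have BA B v : B \in As -> v \in B -> v \in A -> False.
  by move=> hB hv hv'; apply: (no A B v) => //; exact: (allP pA).
have BZ B v : B \in As -> v \in B -> v \in Zf.
  by move=> hB; apply: subsetP; apply: sA; rewrite inE hB orbT.
have dTS : [disjoint cov T & cov S].
  apply: disjoint_by => v /inT hT /covS hS.
  case: hT => hT; case: hS => [/setDP[h1 h2]|/setDP[h1 h2]|/hasP[B hB h1]|h1].
  - by rewrite hT in h2.
  - exact: no dXY (X'X _ hT) h1.
  - exact: BX hB h1 (X'X _ hT).
  - by move: h1; rewrite inE XZ ?X'X.
  - exact: no dXY h1 (Y'Y _ hT).
  - by rewrite hT in h2.
  - exact: BY hB h1 (Y'Y _ hT).
  - by move: h1; rewrite inE YZ ?Y'Y.
  - exact: no dAX (A'A _ hT) h1.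
  - exact: no dAY (A'A _ hT) h1.
  - exact: BA hB h1 (A'A _ hT).
  - by move: h1; rewrite inE AZ ?A'A.
  - exact: no dU hT (XZ _ h1).
  - exact: no dU hT (YZ _ h1).
  - exact: no dU hT (BZ _ _ hB h1).
  - by move: h1; rewrite inE hT orbT.
have tT : tiling E m' T.
  by apply: tilingU; rewrite ?cov1 //; apply: tiling1.
exists (T :|: S); rewrite covU; split.
- exact: tilingU.
- rewrite disjoint_cards // cS covT disjoint_cards //.
  by case/andP: sh1 => _ /eqP ->; case/andP: sh2 => _ /eqP ->; clear; lia.
- move=> v; rewrite in_setU => /orP[/inT|/covS] [] h.
  + by apply: Or41; apply: X'X.
  + by apply: Or42; apply: Y'Y.
  + by apply: Or43; rewrite /= A'A.
  + by apply: Or44; apply/negP => h'; exact: no dU h h'.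
  + by apply: Or41; case/setDP: h.
  + by apply: Or42; case/setDP: h.
  + by apply: Or43; rewrite /= h orbT.
  + by apply: Or44; move: h; rewrite inE negb_or => /andP[].
- move=> B; rewrite inE => /orP[/eqP ->|hB].
    rewrite -cA'; apply/subset_leq_card/subsetP => v; rewrite in_setI in_setU => /andP[hv hvA].
    case/orP: hv => [/inT|/covS] [] h //.
    + by case: (no A X v dAX hvA (X'X _ h)).
    + by case: (no A Y v dAY hvA (Y'Y _ h)).
    + by case: (no U Zf v dU h (AZ _ hvA)).
    + by case/setDP: h => h _; case: (no A X v dAX hvA h).
    + by case/setDP: h => h _; case: (no A Y v dAY hvA h).
    + by case/hasP: h => B' hB' h; case: (BA B' v hB' h hvA).
    + by move: h; rewrite inE AZ.
  apply: leq_trans (capS B hB); apply/subset_leq_card/subsetP => v.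
  rewrite !in_setI in_setU => /andP[hv hvB]; rewrite hvB andbT.
  case/orP: hv => [/inT [] h|//].
  + by case: (BX B v hB hvB (X'X _ h)).
  + by case: (BY B v hB hvB (Y'Y _ h)).
  + by case: (BA B v hB hvB (A'A _ h)).
  + by case: (no U Zf v dU h (BZ _ _ hB hvB)).
- move=> Pr Z0 sPr.
  have p1 : pot Pr Z0 <= pot Pr (Z0 :|: U) + m'.
    apply: (@pot_cap _ _ _ _ _ t) => // t' ht' n; apply: disjointWl sU _.
    by apply: (sysP.2 t t' tP (subsetP sPr _ ht')); rewrite eq_sym.
  have p2 := potS Pr (Z0 :|: U) sPr.
  have p3 : pot Pr (Z0 :|: U :|: (cov S :\: (Zf :|: U))) <= pot Pr (Z0 :|: ((cov T :|: cov S) :\: Zf)).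
    apply: pot_mono; apply/subsetP => v; rewrite !in_setU !in_setD !in_setU.
    case: (v \in Z0) => //=; case hz: (v \in Zf) => //=.
    case hu: (v \in U) => //= /orP[/inT|->//] [] h.
    + by rewrite XZ ?X'X in hz.
    + by rewrite YZ ?Y'Y in hz.
    + by rewrite AZ ?A'A in hz.
    + by rewrite h in hu.
  rewrite mulSn; move: p1 p2 p3; clear; lia.
Qed.

Lemma pairwise_cls (V : finType) m (t : tile V) : tshape m t ->
  pairwise (fun A B : {set V} => [disjoint A & B]) (cls t).
Proof.
move=> sh; have h C1 C2 : (C1, C2) \in cls_pairs t -> [disjoint C1 & C2].
  move=> h; case: (t) sh h => [[[A B] C] D] sh h.
  by have [] := cls_disjoint sh (mem_head _ _) h.
by case: t h {sh} => [[[A B] C] D] /= h; rewrite !h // !inE !eqxx ?orbT.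
Qed.

(* Between two uncovered sets and one tile, four extensions (one per class of the
   tile) give eight new tiles, i.e. 32 m' vertices, while [pot] drops by at most
   6 m', i.e. 24 m' vertices of the old tiles: 2 m' for the tile and m' for each of
   the four extensions. *)
Lemma gadget m' : 0 < m' -> exists M, forall (V : finType) (E : V -> V -> V -> bool) m
    (P : {set tile V}) (Z X Y : {set V}),
  robust E -> tsys m P -> M <= m -> 0 < m -> 0 < #|V| ->
  100 * (#|~: cov P| + (#|Z| + #|X| + #|Y| + 4 * m) + 16 * m') <= #|V| ->
  M <= #|X| -> M <= #|Y| -> [disjoint X & Y] -> [disjoint X & Z] -> [disjoint Y & Z] ->
  exists S : {set tile V}, [/\ tiling E m' S, #|cov S| = 32 * m', [disjoint cov S & Z] &
    forall Pr : {set tile V}, Pr \subset P -> [disjoint X :|: Y & cov Pr] ->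
      pot Pr Z <= pot Pr (Z :|: cov S) + 6 * m'].
Proof.
move=> m'0; have [M1 h1] := extensions 4 m'0.
have [M2 h2] := @nbr_blocks_in_tile M1.+1 isT.
exists (maxn M1 M2) => V E m P Z X Y rE sysP; rewrite !geq_max => /andP[mM1 mM2] m0 V0 hZ.
move=> /andP[_ hX] /andP[_ hY] dXY dXZ dYZ.
have cZXY : #|Z :|: X :|: Y| <= #|Z| + #|X| + #|Y|.
  have := (leq_card_setU (Z :|: X) Y).1; have := (leq_card_setU Z X).1; clear; lia.
have [|t [X' [Y' [As [tP [sX cX] [sY cY] hAs EAs]]]]] :=
    h2 V E m P (Z :|: X :|: Y) X Y rE sysP mM2 m0 V0 _ dXY hX hY.
  by apply: leq_trans hZ; move: cZXY; clear; lia.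
have sht := sysP.1 t tP; have pw := pairwise_cls sht.
have [_ /eqP csup] := andP sht.
case: t tP hAs sht pw csup => [[[C1 C2] C3] C4] tP hAs sht pw csup.
case: As hAs EAs => [//|A1 [|A2 [|A3 [|A4 [|]]]]] /=; rewrite ?andbF // andbT => hAs EAs.
have /and4P[/andP[s1 c1] /andP[s2 c2] /andP[s3 c3] /andP[s4 c4]] := hAs.
move: pw; rewrite /= !andbT => /and3P[/and3P[d12 d13 d14] /andP[d23 d24] d34].
have sub C (A : {set V}) : A \subset C :\: (Z :|: X :|: Y) -> A \subset C.
  by move=> h; apply: subset_trans h (subsetDl _ _).
have dis C (A : {set V}) : A \subset C :\: (Z :|: X :|: Y) ->
    [/\ [disjoint A & Z], [disjoint A & X] & [disjoint A & Y]].
  move=> /subsetP h; split; apply: disjoint_by => v /h; rewrite !inE !negb_or;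
  by move=> /andP[/andP[/andP[a b] c] _] h'; rewrite h' in a b c.
pose U := A1 :|: A2 :|: A3 :|: A4.
pose Zf := Z :|: X :|: Y :|: U.
have sU : U \subset C1 :|: C2 :|: C3 :|: C4.
  exact: setUSS (setUSS (setUSS (sub _ _ s1) (sub _ _ s2)) (sub _ _ s3)) (sub _ _ s4).
have cU : #|U| <= 4 * m by rewrite -csup subset_leq_card.
have cZf : 100 * (#|~: cov P| + #|Zf| + 4 * m' * 4) <= #|V|.
  apply: leq_trans hZ; have := (leq_card_setU (Z :|: X :|: Y) U).1.
  by rewrite -/Zf; move: cZXY cU; clear; lia.
pose As := [:: A1; A2; A3; A4].
have inAs A : A \in As -> exists C, A \subset C :\: (Z :|: X :|: Y).
  by rewrite !inE => /or4P[] /eqP ->; eexists; eassumption.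
have inU A : A \in As -> A \subset U.
  by rewrite !inE => /or4P[] /eqP ->; apply/subsetP => v hv; rewrite !inE hv ?orbT.
have aAs : all (fun A : {set V} => M1 <= #|A|) As.
  by rewrite /= (ltnW c1) (ltnW c2) (ltnW c3) (ltnW c4).
have dX'Y' : [disjoint X' & Y'] by apply: disjointW dXY.
have dA A : A \in As -> [disjoint A & X'] /\ [disjoint A & Y'].
  move=> /inAs [C /dis [_ d1 d2]].
  by split; [apply: disjointWr d1 | apply: disjointWr d2].
have pAs : pairwise (fun A B : {set V} => [disjoint A & B]) As.
  have dd (C D A B : {set V}) : [disjoint C & D] -> A \subset C :\: (Z :|: X :|: Y) ->
      B \subset D :\: (Z :|: X :|: Y) -> [disjoint A & B].
    by move=> d /sub h /sub h'; apply: disjointW d.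
  rewrite /= !andbT (dd _ _ _ _ d12 s1 s2) (dd _ _ _ _ d13 s1 s3) (dd _ _ _ _ d14 s1 s4).
  by rewrite (dd _ _ _ _ d23 s2 s3) (dd _ _ _ _ d24 s2 s4) (dd _ _ _ _ d34 s3 s4).
have X'Zf : X' \subset Zf.
  by apply/subsetP => v /(subsetP sX) h; rewrite !inE h ?orbT.
have Y'Zf : Y' \subset Zf.
  by apply/subsetP => v /(subsetP sY) h; rewrite !inE h ?orbT.
have AsZf A : A \in As -> A \subset Zf.
  by move=> /inU h; apply: subset_trans h (subsetUr _ _).
have [S [tS cS covS capS potS]] := h1 V E m P Zf X' Y' As rE sysP mM1 m0 V0 erefl cZf
  (ltnW cX) (ltnW cY) aAs dX'Y' dA pAs EAs X'Zf Y'Zf AsZf.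
exists S; split=> //; first by rewrite cS; clear; lia.
  apply: disjoint_by => v /covS [] h hz.
  - by move: (disjointFr dXZ (subsetP sX _ h)); rewrite hz.
  - by move: (disjointFr dYZ (subsetP sY _ h)); rewrite hz.
  - case/hasP: h => A /inAs[C /dis[d _ _]] h; by move: (disjointFr d h); rewrite hz.
  - by move: h; rewrite !inE hz.
move=> Pr sPr dXYPr.
have p1 : pot Pr Z <= pot Pr (Z :|: (cov S :&: U)) + 2 * m'.
  apply: (@pot_cap _ _ _ _ _ (C1, C2, C3, C4)) => [t' ht' n|C].
    apply: disjointWl (subset_trans (subsetIr _ _) sU) _.
    by apply: (sysP.2 (C1, C2, C3, C4) t' tP (subsetP sPr _ ht')); rewrite eq_sym.
  have cap A (C0 : {set V}) : A \in As -> (forall v, v \in C0 -> v \in U -> v \in A) ->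
      #|C0 :&: (cov S :&: U)| <= 2 * m'.
    move=> hA h; apply: leq_trans (capS A hA); apply/subset_leq_card/subsetP => v.
    by rewrite !in_setI => /andP[hc /andP[-> hu]] /=; apply: h.
  have no (D D' : {set V}) v : [disjoint D & D'] -> v \in D -> v \in D' -> false.
    by move=> d h h'; move: (disjointFr d h); rewrite h'.
  move: (subsetP (sub _ _ s1)) (subsetP (sub _ _ s2)) (subsetP (sub _ _ s3)) (subsetP (sub _ _ s4)) => i1 i2 i3 i4.
  rewrite !inE => /or4P[] /eqP ->; [apply: (cap A1)|apply: (cap A2)|apply: (cap A3)|apply: (cap A4)];
  rewrite ?inE ?eqxx ?orbT // => v hC; rewrite !inE => /orP[/orP[/orP[h|h]|h]|h] //.
  - by have := no _ _ v d12 hC (i2 _ h).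
  - by have := no _ _ v d13 hC (i3 _ h).
  - by have := no _ _ v d14 hC (i4 _ h).
  - by have := no _ _ v d12 (i1 _ h) hC.
  - by have := no _ _ v d23 hC (i3 _ h).
  - by have := no _ _ v d24 hC (i4 _ h).
  - by have := no _ _ v d13 (i1 _ h) hC.
  - by have := no _ _ v d23 (i2 _ h) hC.
  - by have := no _ _ v d34 hC (i4 _ h).
  - by have := no _ _ v d14 (i1 _ h) hC.
  - by have := no _ _ v d24 (i2 _ h) hC.
  - by have := no _ _ v d34 (i3 _ h) hC.
have p2 := potS Pr (Z :|: (cov S :&: U)) sPr.
set W := Z :|: _ :|: _ in p2.
(* X and Y are disjoint from the tiles of [Pr], so their vertices cost nothing. *)
have p3 : pot Pr W <= pot Pr (W :|: (cov S :&: (X :|: Y))).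
  by apply: pot_disj; apply: disjointWl (subsetIr _ _) dXYPr.
have p4 : pot Pr (W :|: (cov S :&: (X :|: Y))) <= pot Pr (Z :|: cov S).
  apply: pot_mono; apply/subsetP => v; rewrite in_setU => /orP[h|h].
    by rewrite /W !in_setU h.
  rewrite /W /Zf !in_setU !in_setI in_setD !in_setU h /= andbT.
  case: (v \in Z) => //; case: (v \in X); rewrite /= ?orbT //.
  by case: (v \in Y); rewrite /= ?orbT // !orbF orbN.
by move: p1 p2 p3 p4; clear; lia.
Qed.

Lemma chop (V : finType) m (L : {set V}) : 0 < m ->
  exists D : {set tile V}, [/\ tsys m D, cov D \subset L & #|L :\: cov D| < 4 * m].
Proof.
move=> m0; have [n] := ubnP #|L|; elim: n L => // n IH L ltn.
have [h|h] := ltnP #|L| (4 * m).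
  exists set0; rewrite cov0 sub0set setD0; split=> //.
  by split=> t; rewrite inE.
have [L0 sL0 cL0] := subset_of_card h.
have [|L1 [L2 [s1 s2 d12 c1 c2]]] := @halve _ L0 (2 * m); first by rewrite cL0; lia.
have [C1 [C2 [t1 t2 e12 f1 f2]]] := halve c1.
have [C3 [C4 [t3 t4 e34 f3 f4]]] := halve c2.
pose t : tile V := (C1, C2, C3, C4).
have st : sup t \subset L0.
  by rewrite /= !subUset (subset_trans t1) // (subset_trans t2) // (subset_trans t3) // (subset_trans t4).
have ct : #|sup t| = 4 * m.
  rewrite /= -setUA disjoint_cards.
    by rewrite (disjoint_cards e12) (disjoint_cards e34) f1 f2 f3 f4; clear; lia.
  by apply: disjointW d12; rewrite subUset ?t1 ?t2 ?t3 ?t4.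
have sht : tshape m t by rewrite /tshape /= f1 f2 f3 f4 !eqxx -[_ :|: C4]/(sup t) ct eqxx.
have cL := cardsDS (subset_trans st sL0); rewrite ct in cL.
have [|D [sD covD cD]] := IH (L :\: sup t).
  by rewrite cL; move: ltn h m0; clear; lia.
have dtD t' : t' \in D -> [disjoint sup t & sup t'].
  move=> ht'; apply: disjointWr (subset_trans (sup_cov ht') covD) _.
  by apply: disjoint_by => v hv; rewrite inE hv.
exists ([set t] :|: D); rewrite covU cov1; split.
- split=> [t'|t' t'']; first by rewrite !inE => /orP[/eqP ->|/sD.1].
  rewrite !inE => /orP[/eqP ->|h'] /orP[/eqP ->|h''] n'; rewrite ?eqxx // in n' *.
  + exact: dtD.
  + by rewrite disjoint_sym dtD.
  + exact: sD.2.
- by rewrite subUset (subset_trans st) // (subset_trans covD) // subsetDl.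
- by rewrite -setDDl.
Qed.

Lemma complete_sub (V : finType) (E : V -> V -> V -> bool) (A B C D A' B' C' D' : {set V}) :
  A' \subset A -> B' \subset B -> C' \subset C -> D' \subset D ->
  complete E (A, B, C, D) -> complete E (A', B', C', D').
Proof.
move=> /subsetP sA /subsetP sB /subsetP sC /subsetP sD h; apply: completeP => a b c d.
move=> /sA hA /sB hB /sC hC /sD hD.
exact: (forall_inP (forall_inP (forall_inP (forall_inP h a hA) b hB) c hC) d hD).
Qed.

Lemma extract (V : finType) (E : V -> V -> V -> bool) m' b (A B C D : {set V}) :
  robust E -> 0 < m' -> complete E (A, B, C, D) ->
  pairwise (fun A B : {set V} => [disjoint A & B]) [:: A; B; C; D] ->
  b * m' <= #|A| -> b * m' <= #|B| -> b * m' <= #|C| -> b * m' <= #|D| ->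
  exists S : {set tile V}, [/\ tiling E m' S, cov S \subset A :|: B :|: C :|: D &
    #|cov S| = 4 * m' * b].
Proof.
move=> rE m'0; elim: b A B C D => [|b IH] A B C D co pw hA hB hC hD.
  by exists set0; rewrite cov0 sub0set cards0 muln0; split=> //; apply: tiling0.
have take1 (S : {set V}) : b.+1 * m' <= #|S| -> exists S1 : {set V},
    [/\ S1 \subset S, #|S1| = m' & b * m' <= #|S :\: S1|].
  move=> h; have [|S1 s1 c1] := @subset_of_card _ S m'.
    by apply: leq_trans h; rewrite leq_pmull.
  by exists S1; split; rewrite // cardsDS // c1; move: h; rewrite mulSn; clear; lia.
have [A1 [sA cA rA]] := take1 A hA; have [B1 [sB cB rB]] := take1 B hB.
have [C1 [sC cC rC]] := take1 C hC; have [D1 [sD cD rD]] := take1 D hD.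
move: pw; rewrite /= !andbT => /and3P[/and3P[dAB dAC dAD] /andP[dBC dBD] dCD].
have W (S1 S S2 S' : {set V}) : S1 \subset S -> S2 \subset S' -> [disjoint S & S'] -> [disjoint S1 & S2].
  by move=> h1 h2; apply: disjointW.
have DW (S S1 : {set V}) : S :\: S1 \subset S by apply: subsetDl.
have [||S [tS covS cS]] := IH (A :\: A1) (B :\: B1) (C :\: C1) (D :\: D1) _ _ rA rB rC rD.
- by apply: complete_sub co; apply: DW.
- by rewrite /= !andbT (W _ A _ B) ?DW // (W _ A _ C) ?DW // (W _ A _ D) ?DW // (W _ B _ C) ?DW // (W _ B _ D) ?DW // (W _ C _ D) ?DW.
have co1 : complete E (A1, B1, C1, D1) by apply: complete_sub co.
have sh1 : tshape m' (A1, B1, C1, D1) by apply: (complete_tshape rE).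
have no (S1 S2 : {set V}) v : [disjoint S1 & S2] -> v \in S1 -> v \in S2 -> False.
  by move=> d h h'; move: (disjointFr d h); rewrite h'.
have [iA iB iC iD] := And4 (subsetP sA) (subsetP sB) (subsetP sC) (subsetP sD).
have d1 : [disjoint cov [set (A1, B1, C1, D1) : tile V] & cov S].
  rewrite cov1; apply: disjoint_by => v /= h /(subsetP covS) h'.
  move: h; rewrite !in_setU => /orP[/orP[/orP[h|h]|h]|h];
  move: h'; rewrite !in_setU !in_setD h /= => h'.
  - move: h' => /orP[/orP[/andP[_ h']|/andP[_ h']]|/andP[_ h']].
    + exact: no dAB (iA _ h) h'. + exact: no dAC (iA _ h) h'. + exact: no dAD (iA _ h) h'.
  - rewrite orbF in h'; move: h' => /orP[/orP[/andP[_ h']|/andP[_ h']]|/andP[_ h']].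
    + exact: no dAB h' (iB _ h). + exact: no dBC (iB _ h) h'. + exact: no dBD (iB _ h) h'.
  - rewrite orbF in h'; move: h' => /orP[/orP[/andP[_ h']|/andP[_ h']]|/andP[_ h']].
    + exact: no dAC h' (iC _ h). + exact: no dBC h' (iC _ h). + exact: no dCD (iC _ h) h'.
  - rewrite orbF in h'; move: h' => /orP[/orP[/andP[_ h']|/andP[_ h']]|/andP[_ h']].
    + exact: no dAD h' (iD _ h). + exact: no dBD h' (iD _ h). + exact: no dCD h' (iD _ h).
exists ([set (A1, B1, C1, D1) : tile V] :|: S); split.
- by apply: tilingU => //; apply: tiling1.
- rewrite covU cov1 /= subUset; apply/andP; split.
    exact: setUSS (setUSS (setUSS sA sB) sC) sD.
  apply: subset_trans covS _.
  exact: setUSS (setUSS (setUSS (DW _ _) (DW _ _)) (DW _ _)) (DW _ _).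
- rewrite covU disjoint_cards // cS cov1.
  by case/andP: sh1 => _ /eqP ->; clear; lia.
Qed.

Lemma extract_all (V : finType) (E : V -> V -> V -> bool) m m' (P : {set tile V}) Z :
  robust E -> 0 < m' -> tiling E m P ->
  exists S : {set tile V}, [/\ tiling E m' S, cov S \subset cov P :\: Z &
    #|cov S| = 4 * m' * \sum_(t in P) (mn t Z %/ m')].
Proof.
move=> rE m'0; have [n] := ubnP #|P|; elim: n P => // n IH P ltn tP.
have [->|/set0Pn[t ht]] := eqVneq P set0.
  by exists set0; rewrite cov0 sub0set cards0 big_set0 muln0; split=> //; apply: tiling0.
have tP' : tiling E m (P :\ t).
  case: tP => [[h1 h2] h3]; split=> [|t']; last by rewrite inE => /andP[_ /h3].
  split=> [t'|t' t'']; first by rewrite inE => /andP[_ /h1].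
  by rewrite !inE => /andP[_ h'] /andP[_ h'']; apply: h2.
have [|S [tS covS cS]] := IH (P :\ t) _ tP'.
  by have := cardsD1 t P; rewrite ht; move: ltn; clear; lia.
have [S1 [tS1 covS1 cS1]] : exists S1 : {set tile V}, [/\ tiling E m' S1,
    cov S1 \subset sup t :\: Z & #|cov S1| = 4 * m' * (mn t Z %/ m')].
  have co := tP.2 t ht; have pw := pairwise_cls (tP.1.1 t ht).
  have hq C : C \in cls t -> mn t Z %/ m' * m' <= #|C :\: Z|.
    move=> hC; apply: leq_trans (leq_divM _ _) _.
    by have := leqnn (mn t Z); rewrite leq_mn => /allP/(_ C hC).
  case: t co pw hq {ht tP' covS cS} => [[[A B] C] D] co pw hq.
  have sD (S' : {set V}) : S' :\: Z \subset S' by apply: subsetDl.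
  have := @extract V E m' (mn ((A, B, C, D) : tile V) Z %/ m') (A :\: Z) (B :\: Z) (C :\: Z) (D :\: Z) rE m'0.
  case.
  - by apply: complete_sub co; apply: sD.
  - move: pw; rewrite /= !andbT => /and3P[/and3P[dAB dAC dAD] /andP[dBC dBD] dCD].
    by rewrite !(disjointW (sD _) (sD _)).
  - by apply: hq; rewrite !inE eqxx ?orbT.
  - by apply: hq; rewrite !inE eqxx ?orbT.
  - by apply: hq; rewrite !inE eqxx ?orbT.
  - by apply: hq; rewrite !inE eqxx ?orbT.
  by move=> S1 [h1 h2 h3]; exists S1; split; rewrite //= !setDUl.
have d : [disjoint cov S1 & cov S].
  apply: disjoint_by => v /(subsetP covS1)/setDP[h _] /(subsetP covS)/setDP[/covP[t' ht' h'] _].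
  move: ht'; rewrite !inE => /andP[n' ht'].
  have := disjointFr (tP.1.2 t t' ht ht' _) h; rewrite h' eq_sym => /(_ n'); by [].
exists (S1 :|: S); rewrite covU; split.
- exact: tilingU.
- rewrite subUset (subset_trans covS1) ?setSD ?sup_cov //.
  rewrite (subset_trans covS) // setSD //; apply/bigcupsP => t'; rewrite inE => /andP[_ h].
  exact: sup_cov.
- by rewrite disjoint_cards // cS cS1 (big_setD1 t ht) /= mulnDr.
Qed.

Lemma mn0 (V : finType) m (t : tile V) : tshape m t -> mn t set0 = m.
Proof.
case: t => [[[A B] C] D] /andP[/= /and5P[/eqP cA /eqP cB /eqP cC /eqP cD _] _].
by rewrite !setD0 cA cB cC cD !minnn.
Qed.

Lemma pot0 (V : finType) m (P : {set tile V}) : tsys m P -> pot P set0 = m * #|P|.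
Proof.
move=> [h _]; rewrite mulnC -sum_nat_const; apply: eq_bigr => t /h; exact: mn0.
Qed.

(* The averages of [rich_tiles4] and [rich_tiles2] need tiles covering almost all
   of V, so the uncovered set is first chopped into tiles that need not be complete
   and do not count in [pot]. *)
Lemma gadgets g q m' : 0 < g -> 400 * (32 * g) <= q -> 0 < m' -> exists M, forall m, M <= m -> 0 < m -> exists n0,
  forall (V : finType) (E : V -> V -> V -> bool) (P : {set tile V}),
  robust E -> n0 <= #|V| -> tsys m P -> #|V| < g * #|~: cov P| ->
  forall G, q * m' * G <= #|V| ->
  exists S : {set tile V}, [/\ tiling E m' S, #|cov S| = 32 * m' * G &
    pot P set0 <= pot P (cov S) + 6 * m' * G].
Proof.
move=> g0 hq m'0; have [M hM] := gadget m'0; exists M => m hm m0.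
exists (4 * M * g + 200 * (8 * m + 2 * M + 16 * m') + 1) => V E P rE hn sysP hL.
have V0 : 0 < #|V| by move: hn; clear; lia.
have [D [sD covD cD]] := chop (~: cov P) m0.
have dPD t t' : t \in P -> t' \in D -> [disjoint sup t & sup t'].
  move=> h h'; apply: disjoint_by => v hv hv'.
  have := subsetP covD v (subsetP (sup_cov h') v hv'); rewrite inE.
  by rewrite (subsetP (sup_cov h) v hv).
have sysPD : tsys m (P :|: D).
  split=> [t|t t']; first by rewrite inE => /orP[/sysP.1|/sD.1].
  rewrite !inE => /orP[h|h] /orP[h'|h'] n'; [exact: sysP.2|exact: dPD| |exact: sD.2].
  by rewrite disjoint_sym; apply: dPD.
have cPD : #|~: cov (P :|: D)| < 4 * m by rewrite covU setCU -setDE.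
elim=> [|G IH] hG.
  by exists set0; rewrite cov0 cards0 !muln0 addn0; split=> //; apply: tiling0.
have hG' : q * m' * G <= #|V| by apply: leq_trans hG; rewrite leq_mul2l leqnSn orbT.
have [S [tS cS pS]] := IH hG'.
(* The new tiles occupy at most 1 / (400 g) of V, while more than 1 / g is uncovered by [P]; so two
   fresh uncovered sets remain, and the budget of one per cent is respected. *)
have gZ : 400 * (g * #|cov S|) <= #|V|.
  apply: leq_trans hG'; rewrite cS.
  have -> : 400 * (g * (32 * m' * G)) = 400 * (32 * g) * (m' * G) by clear; lia.
  by rewrite -[X in _ <= X]mulnA leq_mul2r hq orbT.
have Z4 : 400 * #|cov S| <= #|V|.
  by apply: leq_trans gZ; rewrite leq_mul2l leq_pmull.
have bigL : 2 * M <= #|(~: cov P) :\: cov S|.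
  have h1 : #|~: cov P| <= #|(~: cov P) :\: cov S| + #|cov S|.
    have := cardsID (cov S) (~: cov P); have := subset_leq_card (subsetIr (~: cov P) (cov S)).
    clear; lia.
  rewrite leqNgt; apply/negP => h2.
  have h3 : g * #|~: cov P| <= g * (2 * M) + g * #|cov S|.
    by rewrite -mulnDr leq_mul2l; apply/orP; right; move: h1 h2; clear; lia.
  move: h3 gZ hL hn; clear; lia.
have [XY sXY cXY] := subset_of_card bigL.
have [X [Y [sX sY dXY cX cY]]] := halve cXY.
have inL v : v \in XY -> v \notin cov P /\ v \notin cov S.
  by move=> /(subsetP sXY); rewrite !inE => /andP[h1 h2].
have dX : [disjoint X & cov S].
  by apply: disjoint_by => v /(subsetP sX)/inL[_ /negPf ->].
have dY : [disjoint Y & cov S].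
  by apply: disjoint_by => v /(subsetP sY)/inL[_ /negPf ->].
have bud : 100 * (#|~: cov (P :|: D)| + (#|cov S| + #|X| + #|Y| + 4 * m) + 16 * m') <= #|V|.
  by rewrite cX cY; move: Z4 hn cPD; clear; nia.
have [||S' [tS' cS' dS' pS']] := hM V E m (P :|: D) (cov S) X Y rE sysPD hm m0 V0 bud _ _ dXY dX dY.
- by rewrite cX.
- by rewrite cY.
have dSS : [disjoint cov S & cov S'] by rewrite disjoint_sym.
have pP : pot P (cov S) <= pot P (cov S :|: cov S') + 6 * m'.
  apply: pS'; first exact: subsetUl.
  apply: disjoint_by => v; rewrite inE => /orP[/(subsetP sX)|/(subsetP sY)] /inL[/negPf -> //].
exists (S :|: S'); rewrite covU disjoint_cards // cS cS'; split.
- exact: tilingU.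
- by rewrite mulnS addnC.
- by rewrite mulnS; move: pS pP; clear; lia.
Qed.

(** The tile size is quantified inside, so that a round can ask the previous one for far larger
    tiles and cut them up. For j > h and V nonempty only the first alternative can hold. *)
Definition tiling_progress g h j := forall m, 0 < m -> exists n0,
  forall (V : finType) (E : V -> V -> V -> bool), robust E -> n0 <= #|V| ->
  exists P : {set tile V}, tiling E m P /\
    (g * #|~: cov P| <= #|V| \/ j * #|V| <= h * #|cov P|).

Lemma progress_arith h m m' n p c T G s pt :
  2 * h * m' <= m -> 16 * h * m' <= n ->
  4 * m * p = c -> c <= n -> n < 4 * h * m' * G.+1 ->
  m * p <= pt + 6 * m' * G -> pt <= s + m' * p -> T = 32 * m' * G + 4 * s ->
  n + h * c <= h * T.
Proof.
move=> hm hn hc hcn hG hp hs hT.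
have h2 : 2 * h * m' * p <= m * p by rewrite leq_mul2r hm orbT.
have h3 : 8 * (m' * G) + c <= T + 4 * (m' * p) by move: hp hs hT hc; clear; lia.
have : h * (8 * (m' * G) + c) <= h * (T + 4 * (m' * p)) by rewrite leq_mul2l h3 orbT.
have e1 : h * (8 * (m' * G) + c) = 8 * (h * m' * G) + h * c by clear; lia.
have e2 : h * (T + 4 * (m' * p)) = h * T + 4 * (h * m' * p) by clear; lia.
rewrite e1 e2; move: hG h2 hc hcn hn; rewrite mulnS -!mulnA; clear; lia.
Qed.

Lemma tiling_progress_step g j : 0 < g -> tiling_progress g (3200 * g) j -> tiling_progress g (3200 * g) j.+1.
Proof.
(* 3200 g is chosen so that four times it equals 400 times 32 g, the bound [gadgets] puts on [q]. *)
move=> g0; have : 400 * (32 * g) <= 4 * (3200 * g) by clear; lia.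
have : 0 < 3200 * g by rewrite muln_gt0.
move: (3200 * g) => h h0 hq H m' m'0.
have [M hM] := gadgets g0 hq m'0.
(* A multiple of m', so that tiles which already cover enough can be cut up without loss; the factor
   makes m at least M and at least 2 h m'. *)
pose m := m' * (M + 2 * h).
have m0 : 0 < m by rewrite muln_gt0 m'0 addn_gt0 muln_gt0 h0 !orbT.
have Mm : M <= m by rewrite /m; apply: leq_trans (leq_addr (2 * h) M) _; rewrite leq_pmull.
have [n1 hn1] := hM m Mm m0; have [n2 hn2] := H m m0.
exists (n1 + n2 + 16 * h * m') => V E rE hn.
have V1 : n1 <= #|V| by move: hn; clear; lia.
have V2 : n2 <= #|V| by move: hn; clear; lia.
have V3 : 16 * h * m' <= #|V| by apply: leq_trans hn; apply: leq_addl.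
have [P [tP hP]] := hn2 V E rE V2.
have sysP := tP.1.
have [small|big] := leqP (g * #|~: cov P|) #|V|.
  have [S [tS covS cS]] := extract_all set0 rE m'0 tP.
  exists S; split=> //; left.
  suff -> : cov S = cov P by [].
  apply/eqP; rewrite eqEcard; rewrite setD0 in covS; rewrite covS /= cS -(card_tsys sysP).
  rewrite (eq_bigr (fun=> M + 2 * h)); last first.
    by move=> t ht; rewrite (mn0 (sysP.1 t ht)) /m mulKn.
  have ar a b c : 4 * (a * b) * c <= 4 * a * (c * b) by clear; lia.
  by rewrite sum_nat_const; apply: ar.
case: hP => [hs|hP]; first by rewrite leqNgt big in hs.
pose G := #|V| %/ (4 * h * m').
have d0 : 0 < 4 * h * m' by rewrite !muln_gt0 h0 m'0.
have hG : 4 * h * m' * G <= #|V| by rewrite mulnC leq_divM.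
have hG2 : #|V| < 4 * h * m' * G.+1 by rewrite mulnC ltn_ceil.
have [S [tS cS pS]] := hn1 V E P rE V1 sysP big G hG.
have [S2 [tS2 covS2 cS2]] := extract_all (cov S) rE m'0 tP.
have d : [disjoint cov S & cov S2].
  by apply: disjoint_by => v hv /(subsetP covS2)/setDP[_]; rewrite hv.
exists (S :|: S2); split; first exact: tilingU.
right; rewrite covU disjoint_cards // cS cS2.
rewrite mulSn; apply: leq_trans (_ : #|V| + h * #|cov P| <= _).
  by rewrite leq_add2l.
have ps : pot P (cov S) <= m' * (\sum_(t in P) mn t (cov S) %/ m') + m' * #|P|.
  rewrite big_distrr /= [m' * #|P|]mulnC -sum_nat_const -big_split /=; apply: leq_sum => t _.
  by have := ltnW (ltn_ceil (mn t (cov S)) m'0); rewrite mulSn mulnC addnC.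
have pS' : m * #|P| <= pot P (cov S) + 6 * m' * G by rewrite -(pot0 sysP).
have hm : 2 * h * m' <= m.
  by rewrite /m mulnC leq_mul2l leq_addl orbT.
apply: (progress_arith hm V3 (card_tsys sysP) (max_card _) hG2 pS' ps).
by rewrite mulnA.
Qed.

Theorem almost_tiling g m : 0 < g -> 0 < m -> exists n0,
  forall (V : finType) (E : V -> V -> V -> bool), robust E -> n0 <= #|V| ->
  exists P : {set tile V}, tiling E m P /\ g * #|~: cov P| <= #|V|.
Proof.
move=> g0 m0; have H j : tiling_progress g (3200 * g) j.
  elim: j => [|j IH]; last exact: tiling_progress_step.
  move=> m1 _; exists 0 => V E _ _; exists set0; split; first exact: tiling0.
  by right; rewrite mul0n.
have [n0 hn] := H (3200 * g).+1 m m0; exists n0.+1 => V E rE hV.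
have [P [tP [h|h]]] := hn V E rE (ltnW hV); exists P; split=> //.
have : 3200 * g * #|cov P| <= 3200 * g * #|V| by rewrite leq_mul2l max_card orbT.
by move: h hV; rewrite mulSn; clear; lia.
Qed.

(** * Assembly *)

Section Walk.

Variables (V : finType) (E : V -> V -> V -> bool) (A B C D : {set V}).
Hypothesis tE : is_tgraph E.
Hypothesis co : complete E (A, B, C, D).
Hypothesis pw : pairwise (fun A B : {set V} => [disjoint A & B]) [:: A; B; C; D].

Lemma complete_k4 a b c d : a \in A -> b \in B -> c \in C -> d \in D -> k4 E a b c d.
Proof.
by move=> h1 h2 h3 h4; exact: (forall_inP (forall_inP (forall_inP (forall_inP co a h1) b h2) c h3) d h4).
Qed.

Lemma sq_turn a b c d a' b' c' s : a \in A -> b \in B -> c \in C -> d \in D ->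
  a' \in A -> b' \in B -> c' \in C ->
  sq E ([:: a'; b'; c'] ++ s) -> sq E ([:: a; b; c; d] ++ [:: a'; b'; c'] ++ s).
Proof.
move=> ha hb hc hd ha' hb' hc' /= h.
rewrite -/(k4 E a b c d) -/(k4 E b c d a') -/(k4 E c d a' b') -/(k4 E d a' b' c').
rewrite complete_k4 // -(k4_rot tE) complete_k4 // -2!(k4_rot tE) complete_k4 //.
by rewrite -3!(k4_rot tE) complete_k4.
Qed.

Lemma tile_walk q (A0 B0 C0 D0 : {set V}) a b c d a' b' c' :
  A0 \subset A -> B0 \subset B -> C0 \subset C -> D0 \subset D ->
  q <= #|A0| -> q <= #|B0| -> q <= #|C0| -> q <= #|D0| ->
  a \in A -> b \in B -> c \in C -> d \in D -> a' \in A -> b' \in B -> c' \in C ->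
  exists w : seq V, [/\ uniq w, size w = 4 * q,
    {subset w <= A0 :|: B0 :|: C0 :|: D0} &
    sq E ([:: a; b; c; d] ++ w ++ [:: a'; b'; c'])].
Proof.
move=> sA sB sC sD; elim: q A0 B0 C0 D0 sA sB sC sD a b c d =>
  [|q IH] A0 B0 C0 D0 sA sB sC sD a b c d hA hB hC hD ha hb hc hd ha' hb' hc'.
  by exists [::]; split=> //; rewrite cat0s -[[:: a'; b'; c']]cats0; apply: sq_turn.
have pick (S : {set V}) : q < #|S| -> exists2 x, x \in S & q <= #|S :\ x|.
  move=> h; have /set0Pn[x hx] : S != set0 by rewrite -card_gt0; apply: leq_trans h.
  by exists x => //; have := cardsD1 x S; rewrite hx; move: h; clear; lia.
have [a1 h1 q1] := pick _ hA; have [b1 h2 q2] := pick _ hB.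
have [c1 h3 q3] := pick _ hC; have [d1 h4 q4] := pick _ hD.
have sub (S S' : {set V}) x : S \subset S' -> S :\ x \subset S'.
  by move=> h; apply: subset_trans (subD1set _ _) h.
have [iA iB] := (subsetP sA _ h1, subsetP sB _ h2).
have [iC iD] := (subsetP sC _ h3, subsetP sD _ h4).
have [w [uw sw hw sqw]] := IH _ _ _ _ (sub _ _ a1 sA) (sub _ _ b1 sB) (sub _ _ c1 sC)
  (sub _ _ d1 sD) a1 b1 c1 d1 q1 q2 q3 q4 iA iB iC iD ha' hb' hc'.
move: pw; rewrite /= !andbT => /and3P[/and3P[dAB dAC dAD] /andP[dBC dBD] dCD].
have no (S1 S2 : {set V}) x y : [disjoint S1 & S2] -> x \in S1 -> y \in S2 -> (x == y) = false.
  by move=> dd hx hy; apply/eqP => e; move: (disjointFr dd hx); rewrite e hy.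
have nin x (S : {set V}) : x \in S -> x \notin S :\ x by rewrite !inE eqxx.
have e1 := no _ _ _ _ dAB iA iB; have e2 := no _ _ _ _ dAC iA iC.
have e3 := no _ _ _ _ dAD iA iD; have e4 := no _ _ _ _ dBC iB iC.
have e5 := no _ _ _ _ dBD iB iD; have e6 := no _ _ _ _ dCD iC iD.
have [sA' sB'] := (subsetP sA, subsetP sB); have [sC' sD'] := (subsetP sC, subsetP sD).
exists ([:: a1; b1; c1; d1] ++ w); split.
- rewrite cat_uniq uw andbT; apply/andP; split.
    by rewrite /= !inE e1 e2 e3 e4 e5 e6.
  apply/hasPn => x /hw; rewrite !in_setU !in_setD1 -!orbA => h.
  rewrite !inE !negb_or; case/or4P: h => /andP[n hx].
  + move/sA': hx => hx.
    by rewrite n (no _ _ _ _ dAB hx iB) (no _ _ _ _ dAC hx iC) (no _ _ _ _ dAD hx iD).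
  + move/sB': hx => hx; rewrite n [x == a1]eq_sym.
    by rewrite (no _ _ _ _ dAB iA hx) (no _ _ _ _ dBC hx iC) (no _ _ _ _ dBD hx iD).
  + move/sC': hx => hx; rewrite n [x == a1]eq_sym [x == b1]eq_sym.
    by rewrite (no _ _ _ _ dAC iA hx) (no _ _ _ _ dBC iB hx) (no _ _ _ _ dCD hx iD).
  + move/sD': hx => hx; rewrite n [x == a1]eq_sym [x == b1]eq_sym [x == c1]eq_sym.
    by rewrite (no _ _ _ _ dAD iA hx) (no _ _ _ _ dBD iB hx) (no _ _ _ _ dCD iC hx).
- by rewrite size_cat sw /= mulnS.
- move=> x; rewrite mem_cat => /orP[|/hw].
    by rewrite !inE => /or4P[] /eqP ->; rewrite ?h1 ?h2 ?h3 ?h4 ?orbT.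
  rewrite !in_setU !in_setD1 => /orP[/orP[/orP[/andP[_ ->]|/andP[_ ->]]|/andP[_ ->]]|/andP[_ ->]];
  by rewrite ?orbT.
- exact: (@sq_turn a b c d a1 b1 c1 (d1 :: w ++ [:: a'; b'; c'])).
Qed.

End Walk.

Definition supp (V : finType) (ts : seq (tile V)) : {set V} := \bigcup_(t <- ts) sup t.

Lemma supp_cons (V : finType) (t : tile V) ts : supp (t :: ts) = sup t :|: supp ts.
Proof. exact: big_cons. Qed.

Lemma suppP (V : finType) (ts : seq (tile V)) v :
  reflect (exists2 t, t \in ts & v \in sup t) (v \in supp ts).
Proof. by rewrite /supp bigcup_seq; apply: bigcupP. Qed.

Lemma mn_attained (V : finType) (t : tile V) Z :
  exists2 C, C \in cls t & #|C :\: Z| <= mn t Z.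
Proof.
have /allPn[C hC h] : ~~ all (fun C : {set V} => mn t Z < #|C :\: Z|) (cls t).
  by rewrite -leq_mn ltnn.
by exists C => //; rewrite leqNgt.
Qed.

Lemma pick2 (V : finType) (S : {set V}) : 1 < #|S| ->
  exists x y, [/\ x \in S, y \in S & x != y].
Proof. by move=> /card_gt1P[x [y [? ? ?]]]; exists x, y. Qed.

Section Assemble.

Variables (V : finType) (E : V -> V -> V -> bool) (M ell B : nat).
Hypothesis rE : robust E.
Hypothesis conn : forall (a b c a' b' c' : V), E a b c -> E a' b' c' ->
  forall W : {set V}, B * #|W| <= #|V| ->
  exists x : seq V, [/\ size x <= ell, uniq x,
    forall v, v \in x -> v \notin W :|: [set v | v \in [:: a; b; c; a'; b'; c']] &
    sq E ([:: a; b; c] ++ x ++ [:: a'; b'; c'])].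

Let tE : is_tgraph E. Proof. by case: rE. Qed.

Lemma card_seq_set (s : seq V) : #|[set v | v \in s]| <= size s.
Proof. by rewrite (eq_card (B := mem s)) ?card_size // => v; rewrite inE. Qed.

Local Opaque sup.

(* The connecting paths may run through vertices of the tiles; a tile is only
   traversed once all connecting paths are known, on its unused vertices. *)
Lemma assemble (ts : seq (tile V)) a b c a' b' c' (W : {set V}) :
  pairwise (fun t t' => [disjoint sup t & sup t']) ts ->
  (forall t, t \in ts -> tshape M t /\ complete E t) ->
  E a b c -> E a' b' c' -> uniq [:: a; b; c; a'; b'; c'] ->
  (forall v, v \in [:: a; b; c; a'; b'; c'] -> v \notin W /\ v \notin supp ts) ->
  B * (#|W| + (ell + 7) * size ts + 10) <= #|V| ->
  exists (x : seq V) (K : {set V}), [/\ uniq x,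
    forall v, v \in x -> v \notin W :|: [set v | v \in [:: a; b; c; a'; b'; c']],
    sq E ([:: a; b; c] ++ x ++ [:: a'; b'; c']),
    #|K| <= ell * (size ts).+1 /\ (forall v, v \in x -> v \in K :|: supp ts) &
    #|supp ts :\: [set v | v \in x]| <= 4 * #|supp ts :&: (W :|: K)| + 28 * size ts].
Proof.
elim: ts a b c W => [|t ts IH] a b c W.
  move=> _ _ e e' u hends hB.
  have [|x [sx ux hx sqx]] := conn e e' (W := W).
    by apply: leq_trans hB; rewrite leq_mul2l; apply/orP; right; clear; lia.
  exists x, [set v | v \in x]; split=> //; last by rewrite /supp big_nil set0D cards0.
  split; first by rewrite muln1; apply: leq_trans (card_seq_set x) sx.
  by move=> v hv; rewrite !inE hv.
rewrite pairwise_cons => /andP[dt pts] hts e e' u hends hB.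
have [sht cot] : tshape M t /\ complete E t by apply: hts; apply: mem_head.
have hts' t' : t' \in ts -> tshape M t' /\ complete E t' by move=> h; apply: hts; rewrite inE h orbT.
have dtS : [disjoint sup t & supp ts].
  apply: disjoint_by => v hv /suppP[t' ht' hv'].
  by move: (disjointFr (allP dt t' ht') hv); rewrite hv'.
pose ends := [:: a; b; c; a'; b'; c'].
have endsW v : v \in ends -> v \notin W by move=> /hends[].
have endst v : v \in ends -> v \notin sup t.
  by move=> /hends[_]; rewrite supp_cons inE negb_or => /andP[].
have endsS v : v \in ends -> v \notin supp ts.
  by move=> /hends[_]; rewrite supp_cons inE negb_or => /andP[].
have hends2 v : v \in ends -> v \notin W /\ v \notin supp ts.
  by move=> h; rewrite endsW ?endsS.
have ct : #|sup t| = 4 * M by case/andP: sht => _ /eqP.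
have cls_card C : C \in cls t -> #|C| = M by case/andP: sht => /allP h _ /h /eqP.
(* If some class has at most one vertex outside [W], the tile is skipped and its 4 M vertices are
   charged to the M - 1 or more vertices of [W] in that class. *)
have [few|/allPn [C hC few]] := boolP (all (fun C : {set V} => 1 < #|C :\: W|) (cls t)); last first.
  have hB' : B * (#|W| + (ell + 7) * size ts + 10) <= #|V|.
    by apply: leq_trans hB; rewrite leq_mul2l; apply/orP; right; rewrite /= mulnS; clear; lia.
  have [x [K [ux hx sqx [cK hK] hcov]]] := IH a b c W pts hts' e e' u hends2 hB'.
  exists x, K; split=> //.
    split; first by apply: leq_trans cK _; rewrite leq_mul2l leqnSn orbT.
    by move=> v /hK; rewrite supp_cons !in_setU => /orP[] ->; rewrite ?orbT.
  rewrite supp_cons setDUl setIUl.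
  apply: leq_trans (leq_card_setU _ _).1 _.
  rewrite disjoint_cards; last first.
    by apply: disjointW dtS; rewrite subsetIl.
  have h1 : #|sup t :\: [set v | v \in x]| <= 4 * M by rewrite -ct subset_leq_card // subsetDl.
  have h2 : M <= #|sup t :&: (W :|: K)| + 1.
    rewrite -leqNgt in few; rewrite -(cls_card C hC) -(cardsID W C) leq_add //.
    by apply/subset_leq_card/setISS; [apply: cls_sub | apply: subsetUl].
  by move: h1 h2 hcov; rewrite /= mulnS; clear; lia.
have pw := pairwise_cls sht; rewrite [size _]/= in hB.
case: t dt hts sht cot hts' dtS endst ct cls_card few pw hends
  => [[[A B0] C] D] dt hts sht cot hts' dtS endst ct cls_card few pw hends.
set t : tile V := (A, B0, C, D) in dt hts sht cot hts' dtS endst ct cls_card hends *.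
have /and4P[fA fB fC fD] : [&& 1 < #|A :\: W|, 1 < #|B0 :\: W|, 1 < #|C :\: W| & 1 < #|D :\: W|].
  by move: few; rewrite /= andbT.
(* The tile is entered through [a0 b0 c0 d0] and left through [a1 b1 c1]; these seven reserved
   vertices account for 28 = 4 times 7 in the bound on the loss. *)
have [a0 [a1 [/setDP[a0A a0W] /setDP[a1A a1W] na]]] := pick2 fA.
have [b0 [b1 [/setDP[b0B b0W] /setDP[b1B b1W] nb]]] := pick2 fB.
have [c0 [c1 [/setDP[c0C c0W] /setDP[c1C c1W] nc]]] := pick2 fC.
have [d0 [_ [/setDP[d0D d0W] _ _]]] := pick2 fD.
have K4 := complete_k4 cot.
have nek p q r s : k4 E p q r s -> [/\ p != q, p != r, q != r & [/\ p != s, q != s & r != s]].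
  move=> /and4P[k1 k2 k3 _]; have [-> -> ->] := edge_neq tE k1; have [_ -> ->] := edge_neq tE k2.
  by have [_ _ ->] := edge_neq tE k3.
pose R := [:: a0; b0; c0; d0; a1; b1; c1].
have inA := subsetP (cls_sub (_ : A \in cls t)); have inB := subsetP (cls_sub (_ : B0 \in cls t)).
have inC := subsetP (cls_sub (_ : C \in cls t)); have inD := subsetP (cls_sub (_ : D \in cls t)).
have Rt v : v \in R -> v \in sup t.
  rewrite !in_cons in_nil orbF => /or4P[/eqP->|/eqP->|/eqP->|/or4P[/eqP->|/eqP->|/eqP->|/eqP->]];
  by [apply: inA; rewrite // !inE eqxx ?orbT | apply: inB; rewrite // !inE eqxx ?orbT
     |apply: inC; rewrite // !inE eqxx ?orbT | apply: inD; rewrite // !inE eqxx ?orbT].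
have RW v : v \in R -> v \notin W.
  by rewrite !in_cons in_nil orbF => /or4P[/eqP->|/eqP->|/eqP->|/or4P[/eqP->|/eqP->|/eqP->|/eqP->]].
have uR : uniq R.
  have [n1 n2 n3 [n4 n5 n6]] := nek _ _ _ _ (K4 _ _ _ _ a0A b0B c0C d0D).
  have [_ _ _ [m4 m5 m6]] := nek _ _ _ _ (K4 _ _ _ _ a1A b1B c1C d0D).
  have [k1 k2 k3 _] := nek _ _ _ _ (K4 _ _ _ _ a1A b1B c1C d0D).
  have [p1 p2 _ _] := nek _ _ _ _ (K4 _ _ _ _ a0A b1B c1C d0D).
  have [q1 _ q3 _] := nek _ _ _ _ (K4 _ _ _ _ a1A b0B c1C d0D).
  have [_ r2 r3 _] := nek _ _ _ _ (K4 _ _ _ _ a1A b1B c0C d0D).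
  rewrite /= !inE !negb_or n1 n2 n4 na p1 p2 n3 n5 [b0 == a1]eq_sym q1 nb q3 n6.
  rewrite [c0 == a1]eq_sym r2 [c0 == b1]eq_sym r3 nc [d0 == a1]eq_sym m4 [d0 == b1]eq_sym m5.
  by rewrite [d0 == c1]eq_sym m6 k1 k2 k3.
have e0 : E a0 b0 c0 by have /and4P[] := K4 _ _ _ _ a0A b0B c0C d0D.
have e1 : E a1 b1 c1 by have /and4P[] := K4 _ _ _ _ a1A b1B c1C d0D.
have Rends v : v \in R -> v \notin ends.
  by move=> /Rt h; apply/negP => /endst; rewrite h.
(* The path into the tile also has to avoid the seven reserved vertices and the three at the far
   end: the 10 in the budget. *)
pose W1 := W :|: [set v | v \in R ++ [:: a'; b'; c']].
have [|y [sy uy hy sqy]] := conn e e0 (W := W1).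
  apply: leq_trans hB; rewrite leq_mul2l; apply/orP; right.
  have := (leq_card_setU W [set v | v \in R ++ [:: a'; b'; c']]).1.
  have := card_seq_set (R ++ [:: a'; b'; c']); rewrite /= -/W1; clear; lia.
have yno v : v \in y -> [/\ v \notin W, v \notin R & v \notin ends].
  move=> /hy; rewrite /W1 !in_setU !inE !negb_or -!andbA.
  by do !case/andP=> ?; split; rewrite // ?inE ?negb_or; do ?[apply/andP; split].
(* The rest of the path starts at [a1 b1 c1] and must avoid seven further vertices and [y], hence
   ell + 7 per tile. *)
pose W2 := W :|: [set v | v \in [:: a; b; c; a0; b0; c0; d0] ++ y].
have cW2 : #|W2| <= #|W| + (ell + 7).
  have := (leq_card_setU W [set v | v \in [:: a; b; c; a0; b0; c0; d0] ++ y]).1.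
  have := card_seq_set ([:: a; b; c; a0; b0; c0; d0] ++ y); rewrite size_cat /= -/W2.
  by move: sy; clear; lia.
have inR2 v : v \in [:: a1; b1; c1] -> v \in R.
  by move=> h; rewrite -[R]/([:: a0; b0; c0; d0] ++ [:: a1; b1; c1]) mem_cat h orbT.
have inR1 v : v \in [:: a0; b0; c0; d0] -> v \in R.
  by move=> h; rewrite -[R]/([:: a0; b0; c0; d0] ++ [:: a1; b1; c1]) mem_cat h.
have inE2 v : v \in [:: a'; b'; c'] -> v \in ends.
  by move=> h; rewrite -[ends]/([:: a; b; c] ++ [:: a'; b'; c']) mem_cat h orbT.
have inE1 v : v \in [:: a; b; c] -> v \in ends.
  by move=> h; rewrite -[ends]/([:: a; b; c] ++ [:: a'; b'; c']) mem_cat h.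
have [uR1 hR12 uR2] : [/\ uniq [:: a0; b0; c0; d0],
    ~~ has (mem [:: a0; b0; c0; d0]) [:: a1; b1; c1] & uniq [:: a1; b1; c1]].
  by move: uR; rewrite -[R]/([:: a0; b0; c0; d0] ++ [:: a1; b1; c1]) cat_uniq => /and3P.
have [uE1 hE12 uE2] : [/\ uniq [:: a; b; c],
    ~~ has (mem [:: a; b; c]) [:: a'; b'; c'] & uniq [:: a'; b'; c']].
  by move: u; rewrite -[[:: a; b; c; a'; b'; c']]/([:: a; b; c] ++ [:: a'; b'; c']) cat_uniq => /and3P.
have u' : uniq ([:: a1; b1; c1] ++ [:: a'; b'; c']).
  rewrite cat_uniq uR2 uE2 andbT; apply/hasPn => v /inE2 hv; apply/negP => /inR2/Rends.
  by rewrite hv.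
have W2E v : (v \in W2) =
    [|| v \in W, v \in [:: a; b; c], v \in [:: a0; b0; c0; d0] | v \in y].
  by rewrite !inE -!orbA.
have hends' v : v \in [:: a1; b1; c1] ++ [:: a'; b'; c'] -> v \notin W2 /\ v \notin supp ts.
  rewrite mem_cat => /orP[hv|hv].
    split; last by rewrite (disjointFr dtS (Rt _ (inR2 _ hv))).
    apply/negP; rewrite W2E => /or4P[h|/inE1 h|h|/yno[_]].
    - by have := RW _ (inR2 _ hv); rewrite h.
    - by have := Rends _ (inR2 _ hv); rewrite h.
    - by have := hasPn hR12 _ hv; rewrite /= h.
    - by rewrite inR2.
  split; last by apply: endsS; apply: inE2.
  apply/negP; rewrite W2E => /or4P[h|h|/inR1/Rends|/yno[_ _]].
  - by have := endsW _ (inE2 _ hv); rewrite h.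
  - by have := hasPn hE12 _ hv; rewrite /= h.
  - by rewrite inE2.
  - by rewrite inE2.
have hB2 : B * (#|W2| + (ell + 7) * size ts + 10) <= #|V|.
  apply: leq_trans hB; rewrite leq_mul2l; apply/orP; right.
  by move: cW2; rewrite /= mulnS; clear; lia.
have [x' [K' [ux' hx' sqx' [cK' hK'] hcov']]] := IH a1 b1 c1 W2 pts hts' e1 e' u' hends' hB2.
have x'no v : v \in x' -> [/\ v \notin W, v \notin R, v \notin y & v \notin ends].
  move=> /hx'; rewrite in_setU => /norP[h1 h2].
  have {}h2 : v \notin [:: a1; b1; c1] ++ [:: a'; b'; c'] by apply: contra h2; rewrite inE.
  split; first by apply: contra h1; rewrite W2E => ->.
  - rewrite -[R]/([:: a0; b0; c0; d0] ++ [:: a1; b1; c1]) mem_cat; apply/norP; split.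
      by apply: contra h1; rewrite W2E => ->; rewrite !orbT.
    by apply: contra h2; rewrite mem_cat => ->.
  - by apply: contra h1; rewrite W2E => ->; rewrite !orbT.
  - rewrite -[ends]/([:: a; b; c] ++ [:: a'; b'; c']) mem_cat; apply/norP; split.
      by apply: contra h1; rewrite W2E => ->; rewrite !orbT.
    by apply: contra h2; rewrite mem_cat => ->; rewrite orbT.
pose used := W :|: [set v | v \in R ++ y ++ x'].
have sDU (S : {set V}) : S :\: used \subset S by apply: subsetDl.
have hq S : S \in cls t -> mn t used <= #|S :\: used|.
  by move=> hS; have := leqnn (mn t used); rewrite leq_mn => /allP/(_ S hS).
have [||||w [uw sw hw sqw]] := tile_walk tE cot pw (sDU A) (sDU B0) (sDU C) (sDU D) _ _ _ _
    a0A b0B c0C d0D a1A b1B c1C (q := mn t used).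
- by apply: hq; rewrite !inE eqxx ?orbT.
- by apply: hq; rewrite !inE eqxx ?orbT.
- by apply: hq; rewrite !inE eqxx ?orbT.
- by apply: hq; rewrite !inE eqxx ?orbT.
have wno v : v \in w -> [/\ v \in sup t, v \notin W, v \notin R & v \notin y ++ x'].
  move=> /hw; rewrite -!setDUl => /setDP[h1].
  by rewrite in_setU [v \in [set _ | _]]inE mem_cat => /norP[? /norP[? ?]].
have wy v : v \in w -> v \notin y by move=> /wno[_ _ _]; rewrite mem_cat => /norP[].
have wx v : v \in w -> v \notin x' by move=> /wno[_ _ _]; rewrite mem_cat => /norP[].
pose x := y ++ [:: a0; b0; c0; d0] ++ w ++ [:: a1; b1; c1] ++ x'.
have memx v : v \in x -> [\/ v \in y, v \in R, v \in w | v \in x'].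
  rewrite !mem_cat => /orP[h|/orP[/inR1 h|/orP[h|/orP[/inR2 h|h]]]].
  + exact: Or41. + exact: Or42. + exact: Or43. + exact: Or42. + exact: Or44.
have u4 : uniq ([:: a1; b1; c1] ++ x').
  rewrite cat_uniq uR2 ux' andbT; apply/hasPn => v /x'no[_ h _ _].
  by apply: contra h; apply: inR2.
have u3 : uniq (w ++ [:: a1; b1; c1] ++ x').
  rewrite cat_uniq uw u4 andbT; apply/hasPn => v; rewrite mem_cat => /orP[hv|hv].
    by apply/negP => /wno[_ _ h _]; rewrite inR2 in h.
  by apply/negP => /wx; rewrite hv.
have u2 : uniq ([:: a0; b0; c0; d0] ++ w ++ [:: a1; b1; c1] ++ x').
  rewrite cat_uniq uR1 u3 andbT; apply/hasPn => v; rewrite !mem_cat => /or3P[hv|hv|hv].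
  - by have [_ _ h _] := wno _ hv; apply: contra h; apply: inR1.
  - exact: (hasPn hR12 _ hv).
  - by have [_ h _ _] := x'no _ hv; apply: contra h; apply: inR1.
have ux : uniq x.
  rewrite cat_uniq uy u2 andbT; apply/hasPn => v; rewrite !mem_cat.
  move=> /or4P[hv|hv|hv|hv]; apply/negP => h; have [_ h' _] := yno _ h.
  - by rewrite inR1 in h'.
  - by have := wy _ hv; rewrite h.
  - by rewrite inR2 in h'.
  - by have [_ _ h2 _] := x'no _ hv; rewrite h in h2.
have no2 v : v \in x -> v \notin W /\ v \notin ends.
  move=> /memx[/yno[]|h|h|/x'no[]] //; first by rewrite RW ?Rends.
  have [ht -> _ _] := wno _ h; split=> //.
  by apply/negP => /endst; rewrite ht.
have sqx : sq E ([:: a; b; c] ++ x ++ [:: a'; b'; c']).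
  have s1 : sq E (([:: a0; b0; c0; d0] ++ w) ++ [:: a1; b1; c1] ++ (x' ++ [:: a'; b'; c'])).
    by apply: sq_cat; rewrite -?catA.
  have s2 : sq E (([:: a; b; c] ++ y) ++ [:: a0; b0; c0] ++
      (d0 :: w ++ [:: a1; b1; c1] ++ x' ++ [:: a'; b'; c'])).
    apply: sq_cat; first by rewrite -catA.
    by move: s1; rewrite -catA.
  by move: s2; rewrite /x -!catA.
have memK v : v \in x -> v \in ([set v | v \in y] :|: K') :|: supp (t :: ts).
  have tS : v \in sup t -> v \in supp (t :: ts).
    by move=> h; apply/suppP; exists t => //; apply: mem_head.
  move=> /memx hv; rewrite in_setU; apply/orP; case: hv => h.
  - by left; rewrite in_setU inE h.
  - by right; apply: tS; apply: Rt.
  - by right; apply: tS; have [] := wno _ h.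
  - case/setUP: (hK' _ h) => h'; first by left; rewrite in_setU h' orbT.
    by right; rewrite supp_cons in_setU h' orbT.
have sw_t : [set v | v \in w] \subset sup t.
  by apply/subsetP => v; rewrite inE => /wno[].
have cw : #|[set v | v \in w]| = 4 * mn t used.
  by rewrite -sw -(card_uniqP uw); apply: eq_card => v; rewrite inE.
have h1 : #|sup t :\: [set v | v \in x]| + 4 * mn t used <= 4 * M.
  rewrite -ct -cw -(cardsID [set v | v \in w] (sup t)) addnC (setIidPr sw_t) leq_add2l.
  apply/subset_leq_card/setDS/subsetP => v; rewrite !inE => hv.
  by rewrite /x !mem_cat hv !orbT.
(* A class loses vertices only to [W], [y], [R] and the part of [x'] inside [K']; the remaining
   vertices of [x'] lie in other tiles. *)
have h2 : M <= mn t used + (#|sup t :&: (W :|: ([set v | v \in y] :|: K'))| + 7).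
  have [S hS leS] := mn_attained t used.
  rewrite -(cls_card S hS) -(cardsID used S) addnC leq_add //.
  have sub : S :&: used \subset
      sup t :&: (W :|: ([set v | v \in y] :|: K')) :|: [set v | v \in R].
    apply/subsetP => v /setIP[/(subsetP (cls_sub hS)) ht hu].
    have inK : v \in W :|: ([set v | v \in y] :|: K') ->
        v \in sup t :&: (W :|: ([set v | v \in y] :|: K')) :|: [set v | v \in R].
      by move=> h; apply/setUP; left; apply/setIP.
    case/setUP: hu => [h|]; first by apply: inK; apply/setUP; left.
    rewrite inE !mem_cat => /or3P[h|h|h].
    - by apply/setUP; right; rewrite inE.
    - by apply: inK; apply/setUP; right; apply/setUP; left; rewrite inE.
    - case/setUP: (hK' _ h) => h'; last by move: (disjointFr dtS ht); rewrite h'.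
      by apply: inK; apply/setUP; right; apply/setUP; right.
  apply: leq_trans (subset_leq_card sub) _; apply: leq_trans (leq_card_setU _ _).1 _.
  by rewrite leq_add2l; apply: leq_trans (card_seq_set R) _.
have h3 : #|supp ts :\: [set v | v \in x]| <=
    4 * #|supp ts :&: (W :|: ([set v | v \in y] :|: K'))| + 28 * size ts.
  apply: leq_trans (leq_trans _ hcov') _.
    apply/subset_leq_card/setDS/subsetP => v; rewrite !inE => hv.
    by rewrite /x !mem_cat hv !orbT.
  rewrite leq_add2r leq_mul2l /=; apply/subset_leq_card/subsetP => v.
  move=> /setIP[hv hu]; apply/setIP; split=> //; case/setUP: hu; last first.
    by move=> h; apply/setUP; right; apply/setUP; right.
  rewrite W2E => /or4P[h|/inE1/endsS|/inR1/Rt h|h].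
  - by apply/setUP; left.
  - by rewrite hv.
  - by move: (disjointFr dtS h); rewrite hv.
  - by apply/setUP; right; apply/setUP; left; rewrite inE.
exists x, ([set v | v \in y] :|: K'); split=> //.
- by move=> v /no2[h h']; rewrite in_setU inE; apply/norP.
- split=> //; apply: leq_trans (leq_card_setU _ _).1 _.
  rewrite mulnS leq_add //; first by apply: leq_trans (card_seq_set y) sy.
- rewrite supp_cons setDUl setIUl.
  apply: leq_trans (leq_card_setU _ _).1 _.
  rewrite disjoint_cards; last by apply: disjointW dtS; rewrite subsetIl.
  rewrite -[size (t :: ts)]/(size ts).+1 mulnS; move: h1 h2 h3; clear; lia.
Qed.

End Assemble.

(** * Back to 3-graphs, codegrees and real constants *)

Section EdgeRel.

Variables (V : finType) (H : graph3 V).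

Definition edge_rel x y z := [set x; y; z] \in edges H.

Lemma edge_rel_tgraph : is_tgraph edge_rel.
Proof.
split=> [x y z|x y z|x z]; rewrite /edge_rel.
- by rewrite [[set x; y]]setUC.
- by rewrite setUAC.
- apply/negP => /(edges_card3 (g:=H)); rewrite setUid cards2.
  by case: (x != z).
Qed.

Lemma codegree_le x y : x != y -> codegree H x y <= #|[set z | edge_rel x y z]|.
Proof.
move=> nxy; apply: leq_trans (leq_imset_card (fun z => [set x; y; z]) _).
apply/subset_leq_card/subsetP => e; rewrite inE => /andP[eH sub].
have /cards1P[z ez] : #|e :\: [set x; y]| == 1.
  by rewrite cardsDS // (edges_card3 eH) cards2 nxy.
have ee : e = [set x; y; z] by rewrite -ez -[LHS](setID e [set x; y]) (setIidPr sub).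
by apply/imsetP; exists z => //; rewrite inE /edge_rel -ee.
Qed.

End EdgeRel.

Lemma sq_windows (T : finType) (E : T -> T -> T -> bool) s i :
  sq E s -> i + 4 <= size s -> exists a b c d, take 4 (drop i s) = [:: a; b; c; d] /\ k4 E a b c d.
Proof.
elim: s i => [|a s IH] [|i] //=.
  case: s IH => [|b [|c [|d s]]] // _ /andP[K _] _.
  by exists a, b, c, d; rewrite /= take0.
by move=> /andP[_ h]; rewrite addSn ltnS => hs; apply: IH.
Qed.

Lemma k4_forms_K4 (V : finType) (H : graph3 V) a b c d :
  k4 (edge_rel H) a b c d -> forms_K4 H [set x in [:: a; b; c; d]].
Proof.
move=> /and4P[k1 k2 k3 k4]; have tE := edge_rel_tgraph H.
have [n1 n2 n3] := edge_neq tE k1; have [_ n4 n5] := edge_neq tE k2.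
have [_ _ n6] := edge_neq tE k3.
have c4 : #|[set x in [:: a; b; c; d]]| = 4.
  rewrite (eq_card (B := mem [:: a; b; c; d])) => [|v]; last by rewrite inE.
  by apply/card_uniqP; rewrite /= !inE !negb_or n1 n2 n3 n4 n5 n6.
split=> // T sT cT.
have /cards1P[v hv] : #|[set x in [:: a; b; c; d]] :\: T| == 1.
  by rewrite cardsDS // c4 cT.
have eT : T = [set x in [:: a; b; c; d]] :\ v.
  rewrite -hv setDDr setDv set0U; apply/esym/setIidPr; exact: sT.
have /setDP[] : v \in [set x in [:: a; b; c; d]] :\: T by rewrite hv set11.
rewrite !inE => /or4P[] /eqP ev _; subst v; rewrite eT.
- have -> : [set x in [:: a; b; c; d]] :\ a = [set b; c; d]; last exact: k4.
  apply/setP => x; rewrite !inE; case: (eqVneq x a) => [->|_] /=; last by rewrite orbA.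
  by rewrite (negPf n1) (negPf n2) (negPf n4).
- have -> : [set x in [:: a; b; c; d]] :\ b = [set a; c; d]; last exact: k3.
  apply/setP => x; rewrite !inE; case: (eqVneq x b) => [->|_] /=; last by rewrite orbA.
  by rewrite eq_sym (negPf n1) (negPf n3) (negPf n5).
- have -> : [set x in [:: a; b; c; d]] :\ c = [set a; b; d]; last exact: k2.
  apply/setP => x; rewrite !inE; case: (eqVneq x c) => [->|_] /=; last by rewrite orbA.
  by rewrite ![c == _]eq_sym (negPf n2) (negPf n3) eq_sym (negPf n6).
- have -> : [set x in [:: a; b; c; d]] :\ d = [set a; b; c]; last exact: k1.
  apply/setP => x; rewrite !inE; case: (eqVneq x d) => [->|_] /=; last by rewrite orbF orbA.
  by rewrite ![d == _]eq_sym (negPf n4) (negPf n5) (negPf n6).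
Qed.

(* Everything in terms of natural numbers: [k] stands for 1 / (9 alpha) and [g]
   for 1 / gamma. *)
Lemma almost_spanning_path k g : 0 < k -> 0 < g -> exists n0,
  forall (V : finType) (E : V -> V -> V -> bool), n0 <= #|V| ->
  is_tgraph E -> dense E k ->
  forall a b c a' b' c', E a b c -> E a' b' c' -> uniq [:: a; b; c; a'; b'; c'] ->
  exists x : seq V, [/\ uniq ([:: a; b; c] ++ x ++ [:: a'; b'; c']),
    sq E ([:: a; b; c] ++ x ++ [:: a'; b'; c']) &
    g * #|[set v | v \notin [:: a; b; c] ++ x ++ [:: a'; b'; c']]| <= #|V|].
Proof.
move=> k0 g0; have [ell [B [n1 [B0 conn]]]] := connecting k0.
(* There are at most |V| / (4 M) tiles. So the losses of 4 ell + 28 per tile add up to at most |V| /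
   (4 g), and the forbidden sets stay within what [connecting] tolerates. *)
have [M [M0 hM1 hM2]] : exists M, [/\ 0 < M, g * (4 * ell + 28) <= M & B * (ell + 7) <= M].
  by exists (g * (4 * ell + 28) + B * (ell + 7) + 1); split; lia.
(* Half of the permitted loss is for vertices outside the tiles, a quarter for losses inside tiles,
   a quarter for the bounded remainder. *)
have g20 : 0 < 2 * g by rewrite muln_gt0.
have [n2 tiles] := almost_tiling g20 M0.
exists (n1 + n2 + 20 * B + 4 * g * (24 * M + 4 * ell) + 1) => V E hn tE dE.
move=> a b c a' b' c' e e' u.
have V0 : 0 < #|V| by move: hn; clear; lia.
have rE : robust E.
  split=> // [x y nxy|x y z]; last exact: dense_common tE k0 dE V0 x y z.
  have := dense_mu k0 dE V0 nxy; rewrite leq_divRL //; clear; lia.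
have [|P [tP hP]] := tiles V E rE; first by move: hn; clear; lia.
pose ends := [:: a; b; c; a'; b'; c'].
(* Tiles through one of the six end vertices are dropped; being disjoint, they number at most
   six. *)
pose P' := [set t in P | [disjoint sup t & [set v in ends]]].
have sPP : P' \subset P by apply/subsetP => t; rewrite inE => /andP[].
have cPD : #|P :\: P'| <= 6.
  have -> : P :\: P' = \bigcup_(v in [set v in ends]) [set t in P | v \in sup t].
    apply/setP => t; rewrite !inE; apply/idP/bigcupP.
      move=> /andP[h tP']; rewrite tP' /= in h; have /pred0Pn[v /andP[/= h1 h2]] := h.
      by exists v; rewrite // inE tP'.
    move=> [v hv]; rewrite inE => /andP[-> h] /=; rewrite andbT.
    by apply/pred0Pn; exists v; rewrite /= h hv.
  apply: leq_trans (card_bigcup_le _ _) _.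
  apply: leq_trans (_ : \sum_(v in [set v in ends]) 1 <= _); last first.
    by rewrite sum1_card; apply: leq_trans (card_seq_set ends) _.
  apply: leq_sum => v _; apply/card_le1_eqP => t t'; rewrite !inE => /andP[h1 h2] /andP[h3 h4].
  apply/eqP/negPn/negP => n; by have := disjointFr (tP.1.2 _ _ h3 h1 n) h4; rewrite h2.
pose ts := enum P'.
have suppE : supp ts = cov P'.
  by apply/setP => v; apply/suppP/covP => -[t h1 h2]; exists t; rewrite // mem_enum in h1 *.
have tsP t : t \in ts -> t \in P by rewrite mem_enum => /(subsetP sPP).
have pts : pairwise (fun t t' => [disjoint sup t & sup t']) ts.
  apply/(pairwiseP (set0, set0, set0, set0)) => i j hi hj ij.
  apply: tP.1.2; rewrite ?tsP ?mem_nth //.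
  by rewrite nth_uniq ?enum_uniq // ltn_eqF.
have cP : 4 * M * #|P| <= #|V| by rewrite (card_tsys tP.1) max_card.
have sz : size ts = #|P'| by rewrite -cardE.
have leP : #|P'| <= #|P| by apply: subset_leq_card.
have budget : B * (#|(set0 : {set V})| + (ell + 7) * size ts + 10) <= #|V|.
  rewrite cards0 add0n sz mulnDr.
  have h1 : 2 * (B * ((ell + 7) * #|P'|)) <= #|V|.
    by move: (leq_mul hM2 leP) cP; clear; lia.
  by move: h1 hn; clear; lia.
have hn1 : n1 <= #|V| by move: hn; clear; lia.
have endsP v : v \in ends -> v \notin (set0 : {set V}) /\ v \notin supp ts.
  move=> hv; rewrite inE; split=> //; rewrite suppE; apply/negP => /covP[t].
  rewrite inE => /andP[_ d] h; have := disjointFr d h; rewrite inE.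
  by move: hv => ->.
have shs t : t \in ts -> tshape M t /\ complete E t.
  by move=> /tsP h; split; [apply: tP.1.1 | apply: tP.2].
have [x [K [ux hx sqx [cK hK] hcov]]] :=
  assemble rE (conn V E tE dE hn1) pts shs e e' u endsP budget.
exists x; split=> //.
- have u' : uniq ([:: a; b; c] ++ [:: a'; b'; c']) by [].
  move: u'; rewrite cat_uniq => /and3P[u1 u12 u2].
  have hx2 v : v \in x -> v \notin [:: a; b; c] ++ [:: a'; b'; c'].
    by move=> /hx; apply: contra => h; apply/setUP; right; rewrite inE.
  rewrite cat_uniq u1 cat_uniq ux u2 !andTb has_cat negb_or u12 !andbT.
  apply/andP; split; apply/hasPn => v hv; apply/negP => h.
    by apply: (negP (hx2 _ hv)); rewrite mem_cat; apply/orP; left.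
  by apply: (negP (hx2 _ h)); rewrite mem_cat; apply/orP; right.
- set s := _ ++ _.
  have sub : [set v | v \notin s] \subset
      (~: cov P) :|: cov (P :\: P') :|: (supp ts :\: [set v | v \in x]).
    apply/subsetP => v; rewrite inE /s !mem_cat !negb_or => /and3P[_ hv _].
    rewrite suppE; have [h|h] := boolP (v \in cov P'); first by apply/setUP; right; rewrite !inE h hv.
    apply/setUP; left; apply/setUP; have [/covP[t ht h']|h'] := boolP (v \in cov P); last by left; rewrite inE.
    right; apply/covP; exists t => //; rewrite inE ht andbT; apply: contra h => ht'.
    by apply/covP; exists t.
  have c1 : #|cov (P :\: P')| <= 6 * (4 * M).
    apply: leq_trans (card_bigcup_le _ _) _.
    apply: leq_trans (_ : #|P :\: P'| * (4 * M) <= _); last by rewrite leq_mul2r cPD orbT.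
    rewrite -sum_nat_const; apply: leq_sum => t; rewrite inE => /andP[_ /tP.1.1 /andP[_ /eqP ->]].
    exact: leqnn.
  have c2 : #|supp ts :&: (set0 :|: K)| <= #|K|.
    by rewrite set0U subset_leq_card // subsetIr.
  have c3 := subset_leq_card sub.
  have c4 := (leq_card_setU (~: cov P :|: cov (P :\: P')) (supp ts :\: [set v | v \in x])).1.
  have c5 := (leq_card_setU (~: cov P) (cov (P :\: P'))).1.
  have c6 : 4 * (g * ((4 * ell + 28) * size ts)) <= #|V|.
    by rewrite sz; move: (leq_mul hM1 leP) cP; clear; lia.
  have c7 : #|[set v | v \notin s]| <= #|~: cov P| + 24 * M + 4 * ell + (4 * ell + 28) * size ts.
    move: c1 c2 c3 c4 c5 hcov cK; rewrite mulnS; clear; lia.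
  have c8 : 4 * g * (24 * M + 4 * ell) <= #|V| by move: hn; clear; lia.
  have c9 : g * #|[set v | v \notin s]| <=
      g * (#|~: cov P| + 24 * M + 4 * ell + (4 * ell + 28) * size ts) by rewrite leq_mul2l c7 orbT.
  apply: leq_trans c9 _; move: hP c6 c8; clear; lia.
Qed.

Local Open Scope ring_scope.

Theorem lemma1p7 (R : realType) :
  forall alpha : R, 0 < alpha ->
  exists2 gamma0 : R, 0 < gamma0 &
  forall gamma : R, 0 < gamma -> gamma <= gamma0 ->
  exists n0 : nat,
  forall n : nat, (n0 <= n)%N ->
  forall (V : finType) (H : graph3 V), #|V| = n ->
  (7 / 9 + alpha) * n%:R <= (min_codegree H)%:R ->
  forall e1 e2 : 3.-tuple V,
  edge_triple H e1 -> edge_triple H e2 -> [disjoint e1 & e2] ->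
  exists s : seq V,
    [/\ squared_tight_path H s,
        path_from_to s e1 e2 &
        #|[set x : V | x \notin s]|%:R <= gamma * n%:R].
Proof.
move=> alpha a0; exists 1 => // gamma g0 _.
have inv (x : R) : 0 < x -> exists2 k, (0 < k)%N & 1 <= k%:R * x.
  move=> x0; exists (Num.truncn x^-1).+1 => //.
  have h : x^-1 < (Num.truncn x^-1).+1%:R by rewrite truncnS_gt.
  have h2 : x^-1 * x <= (Num.truncn x^-1).+1%:R * x by rewrite ler_pM2r // ltW.
  by rewrite mulVf ?lt0r_neq0 // in h2.
(* This gives 1 / (9 k) <= alpha, the surplus in [dense]. *)
have [k k0 hk] := inv (9 * alpha) ltac:(by rewrite mulr_gt0).
have [g gg0 hg] := inv gamma g0.
have [n0 hn0] := almost_spanning_path k0 gg0.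
(* The 2 ensures two distinct vertices, as [min_codegreeP] requires. *)
exists (n0 + 2)%N => n hn V H cV hcod.
have V2 : (1 < #|V|)%N by rewrite cV; lia.
have dE : dense (edge_rel H) k.
  move=> x y nxy.
  have h1 : (min_codegree H <= #|[set z | edge_rel H x y z]|)%N.
    by apply: leq_trans (codegree_le H nxy); apply: (min_codegreeP H _ V2).
  have h2 : (#|[set z | edge_rel H x y z]| + #|nonnbr (edge_rel H) x y| = n)%N.
    by rewrite -cV -(cardsC [set z | edge_rel H x y z]); congr addn; apply: eq_card => z; rewrite !inE.
  have h3 : (7 * k * n + n <= 9 * k * #|[set z | edge_rel H x y z]|)%N.
    rewrite -(ler_nat R) natrD !natrM.
    have h4 : (min_codegree H)%:R <= #|[set z | edge_rel H x y z]|%:R :> R by rewrite ler_nat.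
    have h5 : 9 * k%:R * ((7 / 9 + alpha) * n%:R) <= 9 * k%:R * #|[set z | edge_rel H x y z]|%:R :> R.
      by rewrite ler_wpM2l ?mulr_ge0 // (le_trans hcod).
    have h6 : n%:R <= k%:R * (9 * alpha) * n%:R :> R by rewrite ler_peMl.
    apply: le_trans h5; apply: le_trans (_ : 7 * k%:R * n%:R + k%:R * (9 * alpha) * n%:R <= _).
      by rewrite lerD2l.
    by rewrite le_eqVlt; apply/orP; left; apply/eqP; field.
  move: h2 h3; rewrite cV; move: #|nonnbr _ x y| #|[set z | _]| => p q; clear; nia.
have tE := edge_rel_tgraph H.
have setE a b c : [set x in [:: a; b; c]] = [set a; b; c] :> {set V}.
  by apply/setP => x; rewrite !inE orbA.
case=> [[|a [|b [|c [|]]]] //= i1]; case=> [[|a' [|b' [|c' [|]]]] //= i2].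
rewrite /edge_triple /= !setE => E1 E2 d.
have uniqE p q r : edge_rel H p q r -> uniq [:: p; q; r].
  by move=> /(edge_neq tE)[n1 n2 n3]; rewrite /= !inE negb_or n1 n2 n3.
have u : uniq ([:: a; b; c] ++ [:: a'; b'; c']).
  by rewrite cat_uniq !uniqE // andbT; move: d; rewrite disjoint_sym disjoint_has.
have [|x [ux sqx cx]] := hn0 V (edge_rel H) _ tE dE a b c a' b' c' E1 E2 u.
  by rewrite cV; lia.
exists ([:: a; b; c] ++ x ++ [:: a'; b'; c']); split.
- split=> // i /(sq_windows sqx)[p [q [r [t [-> K]]]]]; exact: k4_forms_K4.
- by split; [apply: prefix_prefix | rewrite catA; apply: suffix_suffix].
set m := #|_| in cx *.
have h1 : g%:R * m%:R <= n%:R :> R by rewrite -natrM ler_nat -cV.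
apply: le_trans (_ : g%:R * gamma * m%:R <= _); first by rewrite ler_peMl.
by rewrite mulrAC mulrC ler_wpM2l // ltW.
Qed.
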